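(* Let $(R,\mathfrak{m},k)$ be a (commutative) noetherian Gorenstein local ring of dimension $d$. Let $\mathsf{GP}$, $\mathsf{GI}$, $\mathsf{GF}$ be the collections of all Gorenstein projective, Gorenstein injective, and Gorenstein flat $R$-modules, respectively. Then: (1) $\sup\{\operatorname{level}_R^{\mathsf{GP}}(M) \mid M\in \mathsf{D}_{\mathsf{b}}(R)\} \le \max\{2, d+1\}$; (2) $\sup\{\operatorname{level}_R^{\mathsf{GI}}(M) \mid M\in \mathsf{D}_{\mathsf{b}}(R)\} \le \max\{2, d+1\}$; (3) $\sup\{\operatorname{level}_R^{\mathsf{GF}}(M) \mid M\in \mathsf{D}_{\mathsf{b}}(R)\} \le \max\{2, d+1\}$.
   Context: $\mathsf{D}(R)$ is the derived category of $R$; $\mathsf{D}_{\mathsf{b}}(R)$ is the full subcategory of complexes $M$ with bounded homology ($\mathrm{H}_i(M)=0$ for all $|i|\gg 0$); homology modules need not be finitely generated. Level: for a nonempty collection $\mathsf{C}$ of objects of $\mathsf{D}(R)$ (modules are viewed as complexes concentrated in degree $0$), set $\operatorname{thick}_R^0(\mathsf{C}) = \{0\}$; $\operatorname{thick}_R^1(\mathsf{C})$ is the smallest collection of objects containing $\mathsf{C}$ and closed under isomorphism, shifts, finite direct sums and direct summands; for $n\ge 2$, $\operatorname{thick}_R^n(\mathsf{C})$ consists of all $M\in \mathsf{D}(R)$ for which there is a distinguished triangle $K \to L\oplus M \to N \to$ (for some object $L$) with $K\in \operatorname{thick}_R^1(\mathsf{C})$ and $N \in \operatorname{thick}_R^{n-1}(\mathsf{C})$.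 Then $\operatorname{level}_R^{\mathsf{C}}(M) = \inf\{n \mid M\in \operatorname{thick}_R^n(\mathsf{C})\}$ (equal to $\infty$ if no such $n$ exists). Gorenstein modules: a module $G$ is Gorenstein projective if it is a cokernel of a differential in an acyclic complex $P$ of projective modules such that $\operatorname{Hom}_R(P,Q)$ is acyclic for every projective module $Q$; Gorenstein injective if it is a kernel of a differential in an acyclic complex $I$ of injective modules such that $\operatorname{Hom}_R(E,I)$ is acyclic for every injective module $E$; Gorenstein flat if it is a cokernel of a differential in an acyclic complex $F$ of flat modules such that $E\otimes_R F$ is acyclic for every injective module $E$. *)

(* Defs.v *)
From HB Require Import structures.
From mathcomp Require Import all_boot all_order all_algebra.
From mathcomp Require Import boolp classical_sets constructive_ereal.

Set Implicit Arguments.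
Unset Strict Implicit.
Unset Printing Implicit Defensive.

Import Order.TTheory GRing.Theory Num.Theory.
Local Open Scope ring_scope.
Local Open Scope classical_set_scope.

(** * Commutative rings

    [idealr_closed] is the library's predicate for PROPER ideals. *)

Section Rings.
Variable R : comNzRingType.
Implicit Types I J P : {pred R}.

(* The unit ideal, which is not [idealr_closed], is finitely generated. *)
Definition noetherian : Prop :=
  forall I, idealr_closed I ->
    exists n (g : 'I_n -> R), forall x,
      x \in I <-> exists c : 'I_n -> R, x = \sum_i c i * g i.

Definition maximal_ideal I : Prop :=
  idealr_closed I /\
  forall J, idealr_closed J -> {subset I <= J} -> J =i I.

Definition local_ring (m : {pred R}) : Prop :=
  maximal_ideal m /\ forall n, maximal_ideal n -> n =i m.

Definition prime_ideal P : Prop := idealr_closed P /\ prime_idealr_closed P.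

(* P_0 < P_1 < ... < P_n; the values of P beyond n are irrelevant. *)
Definition prime_chain (n : nat) (P : nat -> {pred R}) : Prop :=
  (forall i, (i <= n)%N -> prime_ideal (P i)) /\
  (forall i, (i < n)%N ->
     {subset P i <= P i.+1} /\ exists2 x, x \in P i.+1 & x \notin P i).

Definition krull_dim (d : nat) : Prop :=
  (exists P : nat -> {pred R}, prime_chain d P) /\
  forall n (P : nat -> {pred R}), prime_chain n P -> (n <= d)%N.

End Rings.

(** * Projective and injective modules, Gorenstein rings *)

Section Modules.
Variable R : comNzRingType.

Definition surj (A B : Type) (f : A -> B) : Prop := forall b, exists a, f a = b.

Definition projective : lmodType R -> Prop := fun P =>
  forall (A B : lmodType R) (p : {linear A -> B}) (f : {linear P -> B}),
    surj p -> exists g : {linear P -> A}, forall x, p (g x) = f x.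

Definition injective_module : lmodType R -> Prop := fun J =>
  forall (A B : lmodType R) (i : {linear A -> B}) (f : {linear A -> J}),
    injective i -> exists g : {linear B -> J}, forall x, g (i x) = f x.

(* 0 -> M -> I^0 -> I^1 -> ... exact with all I^k injective and I^k = 0 for
   k >> 0. *)
Definition finite_injective_dimension (M : lmodType R) : Prop :=
  exists (I : nat -> lmodType R) (e : {linear M -> I 0%N})
         (delta : forall k, {linear I k -> I k.+1}),
    [/\ forall k, injective_module (I k),
        injective e,
        forall x, delta 0%N x = 0 <-> exists y, e y = x,
        forall k x, delta k.+1 x = 0 <-> exists y, delta k y = x
      & exists n, forall k, (n < k)%N -> forall x : I k, x = 0].

Definition is_kernel (A B K : lmodType R) (f : {linear A -> B})
    (k : {linear K -> A}) : Prop :=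
  injective k /\ forall x, f x = 0 <-> exists y, k y = x.

Definition is_cokernel (A B C : lmodType R) (f : {linear A -> B})
    (c : {linear B -> C}) : Prop :=
  surj c /\ forall x, c x = 0 <-> exists y, f y = x.

End Modules.

Definition gorenstein (R : comNzRingType) : Prop :=
  finite_injective_dimension (R^o : lmodType R).

(** * Tensor product

    The elements of [tensor E F] are the formal sums of pairs (e, f), encoded
    as lists, modulo the smallest congruence that makes concatenation
    commutative and (e, f) bilinear.  No formal opposites are needed, since
    the opposite of (e, f) is (- e, f). *)

Section Tensor.
Variables (R : comNzRingType) (E F : lmodType R).

Inductive tensor_rel : seq (E * F) -> seq (E * F) -> Prop :=
| tr_refl s : tensor_rel s s
| tr_sym s t : tensor_rel s t -> tensor_rel t s
| tr_trans s t u : tensor_rel s t -> tensor_rel t u -> tensor_rel s u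
| tr_cat s s' t t' :
    tensor_rel s s' -> tensor_rel t t' -> tensor_rel (s ++ t) (s' ++ t')
| tr_catC s t : tensor_rel (s ++ t) (t ++ s)
| tr_zero f : tensor_rel [:: (0, f)] [::]
| tr_addl e e' f : tensor_rel [:: (e + e', f)] [:: (e, f); (e', f)]
| tr_addr e f f' : tensor_rel [:: (e, f + f')] [:: (e, f); (e, f')]
| tr_scale a e f : tensor_rel [:: (a *: e, f)] [:: (e, a *: f)].

Definition tensor_eqb (s t : seq (E * F)) : bool := `[< tensor_rel s t >].

Lemma tensor_eqb_equiv : equiv_class_of tensor_eqb.
Proof.
split=> [s | s t | t s u].
- by apply/asboolP; apply: tr_refl.
- by apply/asboolP/asboolP; apply: tr_sym.
- by move=> /asboolP st /asboolP tu; apply/asboolP; apply: tr_trans st tu.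
Qed.

Canonical tensor_equiv := EquivRelPack tensor_eqb_equiv.

Definition tensor := {eq_quot tensor_equiv}%qT.
HB.instance Definition _ := Choice.on tensor.

Definition tensor_class (s : seq (E * F)) : tensor :=
  (\pi_{eq_quot tensor_equiv} s)%qT.

Lemma tensor_classP s t : tensor_class s = tensor_class t <-> tensor_rel s t.
Proof.
rewrite /tensor_class; split=> [/eqP|st].
  by rewrite eqmodE => /asboolP.
by apply/eqP; rewrite eqmodE; apply/asboolP.
Qed.

Lemma tensor_reprK (x : tensor) : tensor_class (repr x) = x.
Proof. exact: reprK. Qed.

Lemma tensor_repr_class s : tensor_rel (repr (tensor_class s)) s.
Proof. by apply/tensor_classP; rewrite tensor_reprK. Qed.

Definition tensor_zero : tensor := tensor_class [::].
Definition tensor_add (x y : tensor) : tensor :=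
  tensor_class (repr x ++ repr y).
Definition scale_sum (a : R) (s : seq (E * F)) : seq (E * F) :=
  [seq (a *: p.1, p.2) | p <- s].
Definition tensor_scale (a : R) (x : tensor) : tensor :=
  tensor_class (scale_sum a (repr x)).
Definition tensor_opp (x : tensor) : tensor := tensor_scale (-1) x.

Lemma scale_sum_rel a s t :
  tensor_rel s t -> tensor_rel (scale_sum a s) (scale_sum a t).
Proof.
elim=> {s t} [s|s t _|s t u _ st _ tu|s s' t t' _ ss _ tt|s t|f|e e' f|e f f'|b e f].
- exact: tr_refl.
- exact: tr_sym.
- exact: tr_trans st tu.
- by rewrite /scale_sum !map_cat; apply: tr_cat.
- by rewrite /scale_sum !map_cat; apply: tr_catC.
- by rewrite /scale_sum /= scaler0; apply: tr_zero.
- by rewrite /scale_sum /= scalerDr; apply: tr_addl.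
- exact: tr_addr.
- by rewrite /scale_sum /= scalerA mulrC -scalerA; apply: tr_scale.
Qed.

Lemma tensor_addE s t :
  tensor_add (tensor_class s) (tensor_class t) = tensor_class (s ++ t).
Proof. by apply/tensor_classP; apply: tr_cat; apply: tensor_repr_class. Qed.

Lemma tensor_scaleE a s :
  tensor_scale a (tensor_class s) = tensor_class (scale_sum a s).
Proof. by apply/tensor_classP/scale_sum_rel/tensor_repr_class. Qed.

Lemma tensor_addA : associative tensor_add.
Proof.
move=> x y z; rewrite -[x]tensor_reprK -[y]tensor_reprK -[z]tensor_reprK.
by rewrite !tensor_addE catA.
Qed.

Lemma tensor_addC : commutative tensor_add.
Proof.
move=> x y; rewrite -[x]tensor_reprK -[y]tensor_reprK !tensor_addE.
by apply/tensor_classP; apply: tr_catC.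
Qed.

Lemma tensor_add0 : left_id tensor_zero tensor_add.
Proof. by move=> x; rewrite -[x]tensor_reprK tensor_addE. Qed.

Lemma scale_sumDl a b s :
  tensor_rel (scale_sum (a + b) s) (scale_sum a s ++ scale_sum b s).
Proof.
elim: s => [|[e f] s IHs]; first exact: tr_refl.
rewrite /scale_sum /= scalerDl -!/(scale_sum _ s).
apply: (tr_trans (tr_cat (tr_addl _ _ _) IHs)).
apply: (@tr_cat [:: _] [:: _]); first exact: tr_refl.
rewrite -[X in tensor_rel X _]/([:: (b *: e, f)] ++ (scale_sum a s ++ scale_sum b s)).
rewrite -[X in tensor_rel _ X]/(scale_sum a s ++ ([:: (b *: e, f)] ++ scale_sum b s)).
by rewrite !catA; apply: tr_cat; [apply: tr_catC | apply: tr_refl].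
Qed.

Lemma scale_sum0 s : tensor_rel (scale_sum 0 s) [::].
Proof.
elim: s => [|[e f] s IHs]; first exact: tr_refl.
rewrite /scale_sum /= scale0r.
by apply: (@tr_cat [:: _] [::] _ [::]) => //; apply: tr_zero.
Qed.

Lemma scale_sum1 s : scale_sum 1 s = s.
Proof. by elim: s => //= -[e f] s IHs; rewrite /scale_sum /= scale1r -[in RHS]IHs. Qed.

Lemma tensor_addN : left_inverse tensor_zero tensor_opp tensor_add.
Proof.
move=> x; rewrite -[x]tensor_reprK /tensor_opp tensor_scaleE tensor_addE.
apply/tensor_classP; rewrite -[X in _ ++ X]scale_sum1.
apply: tr_trans (tr_sym (scale_sumDl _ _ _)) _.
by rewrite addNr; apply: scale_sum0.
Qed.

HB.instance Definition _ := GRing.isZmodule.Build tensor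
  tensor_addA tensor_addC tensor_add0 tensor_addN.

Lemma tensor_scaleA a b x :
  tensor_scale a (tensor_scale b x) = tensor_scale (a * b) x.
Proof.
rewrite -[x]tensor_reprK !tensor_scaleE /scale_sum -map_comp.
by congr tensor_class; apply: eq_map => p /=; rewrite scalerA.
Qed.

Lemma tensor_scale1 : left_id 1 tensor_scale.
Proof. by move=> x; rewrite -[x]tensor_reprK tensor_scaleE scale_sum1. Qed.

Lemma tensor_scaleDr : right_distributive tensor_scale +%R.
Proof.
move=> a x y; rewrite -[x]tensor_reprK -[y]tensor_reprK.
by rewrite -![_ + _]/(tensor_add _ _) !(tensor_scaleE, tensor_addE) /scale_sum map_cat.
Qed.

Lemma tensor_scaleDl x : {morph tensor_scale^~ x : a b / a + b}.
Proof.
move=> a b; rewrite -[x]tensor_reprK -[RHS]/(tensor_add _ _).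
rewrite !(tensor_scaleE, tensor_addE).
by apply/tensor_classP; apply: scale_sumDl.
Qed.

HB.instance Definition _ := GRing.Zmodule_isLmodule.Build R tensor
  tensor_scaleA tensor_scale1 tensor_scaleDr tensor_scaleDl.

End Tensor.

Section TensorMap.
Variables (R : comNzRingType) (E F F' : lmodType R) (g : {linear F -> F'}).

Definition map_sum (s : seq (E * F)) : seq (E * F') :=
  [seq (p.1, g p.2) | p <- s].

Definition tensor_map (x : tensor E F) : tensor E F' :=
  tensor_class (map_sum (repr x)).

Lemma map_sum_rel s t : tensor_rel s t -> tensor_rel (map_sum s) (map_sum t).
Proof.
elim=> {s t} [s|s t _|s t u _ st _ tu|s s' t t' _ ss _ tt|s t|f|e e' f|e f f'|b e f].
- exact: tr_refl.
- exact: tr_sym.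
- exact: tr_trans st tu.
- by rewrite /map_sum !map_cat; apply: tr_cat.
- by rewrite /map_sum !map_cat; apply: tr_catC.
- exact: tr_zero.
- exact: tr_addl.
- by rewrite /map_sum /= linearD; apply: tr_addr.
- by rewrite /map_sum /= linearZ; apply: tr_scale.
Qed.

Lemma tensor_mapE s : tensor_map (tensor_class s) = tensor_class (map_sum s).
Proof. by apply/tensor_classP/map_sum_rel/tensor_repr_class. Qed.

Lemma tensor_map_linear : linear tensor_map.
Proof.
move=> a x y; rewrite -[x]tensor_reprK -[y]tensor_reprK.
rewrite -![_ + _]/(tensor_add _ _) -![_ *: _]/(tensor_scale _ _).
rewrite !(tensor_scaleE, tensor_mapE, tensor_addE) /map_sum map_cat /scale_sum.
by rewrite -!map_comp.
Qed.

HB.instance Definition _ :=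
  GRing.isLinear.Build R (tensor E F) (tensor E F') *:%R tensor_map
    tensor_map_linear.

End TensorMap.
Arguments tensor_map {R} E {F F'} g x.

Definition flat (R : comNzRingType) : lmodType R -> Prop := fun F =>
  forall (A B : lmodType R) (i : {linear A -> B}),
    injective i -> injective (tensor_map F i).

(** * Chain complexes

    Complexes are Z-indexed and homologically graded.  The differential leaving
    degree i lands in degree [i - 1], so statements about the homology in a
    degree are phrased at degree [i - 1], for all i. *)

Record complex (R : comNzRingType) := Complex {
  ob :> int -> lmodType R;
  diff : forall i, {linear ob i -> ob (i - 1)};
  diffK : forall i x, diff (i - 1) (diff i x) = 0 }.
Arguments diff {R} c i.

Record chain_map (R : comNzRingType) (X Y : complex R) := ChainMap {
  component :> forall i, {linear X i -> Y i};
  chain_mapP : forall i x, component (i - 1) (diff X i x) = diff Y i (component i x) }.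

Section Complexes.
Variable R : comNzRingType.
Implicit Types X Y Z : complex R.

Definition boundary X i (z : X (i - 1)) : Prop := exists x, diff X i x = z.

(* The homology of X in degree i - 1 vanishes. *)
Definition homology_zero_at X i : Prop :=
  forall z : X (i - 1), diff X (i - 1) z = 0 -> boundary z.

Definition acyclic X : Prop := forall i, homology_zero_at X i.

Definition bounded_homology : complex R -> Prop := fun X =>
  exists N : nat, forall i, N%:Z < `|i - 1| -> homology_zero_at X i.

(* H(f) is injective and surjective in every degree. *)
Definition quasi_iso X Y (f : chain_map X Y) : Prop :=
  forall i,
    (forall z : X (i - 1), diff X (i - 1) z = 0 ->
       boundary (f (i - 1) z) -> boundary z) /\
    (forall z : Y (i - 1), diff Y (i - 1) z = 0 ->
       exists2 x : X (i - 1), diff X (i - 1) x = 0 & boundary (z - f (i - 1) x)).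

Definition zero_module : lmodType R := 'rV[R]_0.

Definition in_degree0 (M : lmodType R) : complex R :=
  @Complex R (fun i => if i == 0 then M else zero_module) (fun i => \0)
    (fun i x => erefl).

Definition zero_complex : complex R := in_degree0 zero_module.

Section DirectSum.
Variables X Y : complex R.

Definition dsum_diff i (p : X i * Y i) : X (i - 1) * Y (i - 1) :=
  (diff X i p.1, diff Y i p.2).

Lemma dsum_diff_linear i : linear (@dsum_diff i).
Proof. by move=> a p q; rewrite /dsum_diff !linearP. Qed.

HB.instance Definition _ i :=
  GRing.isLinear.Build R (X i * Y i)%type (X (i - 1) * Y (i - 1))%type *:%R
    (@dsum_diff i) (@dsum_diff_linear i).

Lemma dsum_diffK i p : dsum_diff (dsum_diff p) = 0 :> (X (i - 1 - 1) * Y (i - 1 - 1)).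
Proof. by rewrite /dsum_diff /= !diffK. Qed.

Definition direct_sum : complex R :=
  @Complex R (fun i => (X i * Y i)%type) (fun i => @dsum_diff i) dsum_diffK.

End DirectSum.

Section Shift.
Variable X : complex R.

Lemma shift_diffK i (x : X (i - 1)) :
  (\- diff X (i - 1 - 1)) ((\- diff X (i - 1)) x) = 0.
Proof. by rewrite /= linearN diffK !oppr0. Qed.

(* The suspension: (shift X)_i = X_{i-1}. *)
Definition shift : complex R :=
  @Complex R (fun i => X (i - 1)) (fun i => \- diff X (i - 1)) shift_diffK.

End Shift.

Section Cone.
Variables (X Y : complex R) (f : chain_map X Y).

Definition cone_diff i (p : X (i - 1) * Y i) : X (i - 1 - 1) * Y (i - 1) :=
  (- diff X (i - 1) p.1, f (i - 1) p.1 + diff Y i p.2).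

Lemma cone_diff_linear i : linear (@cone_diff i).
Proof.
move=> a p q; apply: injective_projections; rewrite /= !linearP //=.
by rewrite scalerDr addrACA.
Qed.

HB.instance Definition _ i :=
  GRing.isLinear.Build R (X (i - 1) * Y i)%type (X (i - 1 - 1) * Y (i - 1))%type
    *:%R (@cone_diff i) (@cone_diff_linear i).

Lemma cone_diffK i p :
  cone_diff (cone_diff p) = 0 :> (X (i - 1 - 1 - 1) * Y (i - 1 - 1)).
Proof.
rewrite /cone_diff /= !linearN !linearD /= !diffK chain_mapP addr0 addNr.
by rewrite !oppr0.
Qed.

Definition cone : complex R :=
  @Complex R (fun i => (X (i - 1) * Y i)%type) (fun i => @cone_diff i) cone_diffK.

Definition cone_in_fun i (y : Y i) : X (i - 1) * Y i := (0, y).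

Lemma cone_in_linear i : linear (@cone_in_fun i).
Proof. by move=> a x y; apply: injective_projections; rewrite /= ?scaler0 ?addr0. Qed.

HB.instance Definition _ i :=
  GRing.isLinear.Build R (Y i) (X (i - 1) * Y i)%type *:%R
    (@cone_in_fun i) (@cone_in_linear i).

Lemma cone_inP i (y : Y i) :
  cone_in_fun (diff Y i y) = diff cone i (cone_in_fun y).
Proof. by rewrite /= /cone_diff /= !linear0 add0r. Qed.

Definition cone_in : chain_map Y cone :=
  @ChainMap R Y cone (fun i => @cone_in_fun i) cone_inP.

Definition cone_out : chain_map cone (shift X) :=
  @ChainMap R cone (shift X)
    (fun i => (fst : {linear (X (i - 1) * Y i)%type -> X (i - 1)}))
    (fun i p => erefl).

End Cone.

Lemma shift_mapP X Y (f : chain_map X Y) i (x : shift X i) :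
  f (i - 1 - 1) (diff (shift X) i x) = diff (shift Y) i (f (i - 1) x).
Proof. by rewrite /= linearN chain_mapP. Qed.

Definition shift_map X Y (f : chain_map X Y) : chain_map (shift X) (shift Y) :=
  @ChainMap R (shift X) (shift Y) (fun i => f (i - 1)) (shift_mapP f).

Lemma boundary_shift X i (z : X (i - 1 - 1)) :
  @boundary (shift X) i z <-> @boundary X (i - 1) z.
Proof.
split=> -[x <-]; exists (- x); first by rewrite linearN.
by rewrite /= linearN opprK.
Qed.

Lemma shift_quasi_iso X Y (f : chain_map X Y) :
  quasi_iso f -> quasi_iso (shift_map f).
Proof.
move=> qf i; have [inj sur] := qf (i - 1); split=> z /eqP; rewrite oppr_eq0 => /eqP dz.
  by move=> /boundary_shift bz; apply/boundary_shift; apply: inj.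
have [x dx bx] := sur z dz; exists x; first by rewrite /= dx oppr0.
exact/boundary_shift.
Qed.

(** * The derived category

    D(R) is the localization of the category of complexes at the
    quasi-isomorphisms.  Its morphisms are the formal composites of chain maps
    and formal inverses of quasi-isomorphisms, modulo the congruence [deq]. *)

Inductive dmor : complex R -> complex R -> Type :=
| dmap X Y (f : chain_map X Y) : dmor X Y
| dinv X Y (s : chain_map X Y) (qs : quasi_iso s) : dmor Y X
| dcomp X Y Z (g : dmor Y Z) (f : dmor X Y) : dmor X Z.

Definition id_map X : chain_map X X :=
  @ChainMap R X X (fun i => idfun) (fun i x => erefl).

Definition did X : dmor X X := dmap (id_map X).

Inductive deq : forall X Y, dmor X Y -> dmor X Y -> Prop :=
| deq_refl X Y (f : dmor X Y) : deq f f
| deq_sym X Y (f g : dmor X Y) : deq f g -> deq g f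
| deq_trans X Y (f g h : dmor X Y) : deq f g -> deq g h -> deq f h
| deq_comp X Y Z (g g' : dmor Y Z) (f f' : dmor X Y) :
    deq g g' -> deq f f' -> deq (dcomp g f) (dcomp g' f')
| deq_assoc W X Y Z (h : dmor Y Z) (g : dmor X Y) (f : dmor W X) :
    deq (dcomp h (dcomp g f)) (dcomp (dcomp h g) f)
| deq_idl X Y (f : dmor X Y) : deq (dcomp (did Y) f) f
| deq_idr X Y (f : dmor X Y) : deq (dcomp f (did X)) f
| deq_map_comp X Y Z (g : chain_map Y Z) (f : chain_map X Y) (h : chain_map X Z) :
    (forall i x, h i x = g i (f i x)) ->
    deq (dcomp (dmap g) (dmap f)) (dmap h)
| deq_invl X Y (s : chain_map X Y) (qs : quasi_iso s) :
    deq (dcomp (dinv qs) (dmap s)) (did X)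
| deq_invr X Y (s : chain_map X Y) (qs : quasi_iso s) :
    deq (dcomp (dmap s) (dinv qs)) (did Y).

Definition is_diso X Y (f : dmor X Y) : Prop :=
  exists g : dmor Y X, deq (dcomp g f) (did X) /\ deq (dcomp f g) (did Y).

Definition disomorphic X Y : Prop := exists f : dmor X Y, is_diso f.

Fixpoint dshift X Y (f : dmor X Y) : dmor (shift X) (shift Y) :=
  match f with
  | dmap _ _ f => dmap (shift_map f)
  | dinv _ _ s qs => dinv (shift_quasi_iso qs)
  | dcomp _ _ _ g f => dcomp (dshift g) (dshift f)
  end.

(* X -> Y -> Z -> shift X is isomorphic in D(R) to the mapping cone triangle
   X' -> Y' -> cone f -> shift X' of a chain map f. *)
Definition distinguished X Y Z (u : dmor X Y) (v : dmor Y Z)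
    (w : dmor Z (shift X)) : Prop :=
  exists (X' Y' : complex R) (f : chain_map X' Y')
         (a : dmor X X') (b : dmor Y Y') (c : dmor Z (cone f)),
    [/\ is_diso a, is_diso b & is_diso c] /\
    [/\ deq (dcomp b u) (dcomp (dmap f) a),
        deq (dcomp c v) (dcomp (dmap (cone_in f)) b)
      & deq (dcomp (dshift a) w) (dcomp (dmap (cone_out f)) c)].

(** * Level *)

Section Level.
Variable C : complex R -> Prop.

(* Closure under the inverse shift is [thick1_unshift].  The empty direct sum
   is a direct summand of every complex, so [thick1_sum] suffices for
   nonempty C. *)
Inductive thick1 : complex R -> Prop :=
| thick1_base X : C X -> thick1 X
| thick1_iso X Y : thick1 X -> disomorphic X Y -> thick1 Y
| thick1_shift X : thick1 X -> thick1 (shift X)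
| thick1_unshift X : thick1 (shift X) -> thick1 X
| thick1_sum X Y : thick1 X -> thick1 Y -> thick1 (direct_sum X Y)
| thick1_summand X Y : thick1 (direct_sum X Y) -> thick1 Y.

Fixpoint thick (n : nat) : complex R -> Prop := fun M =>
  match n with
  | 0 => disomorphic M zero_complex
  | 1 => thick1 M
  | n'.+1 =>
      exists (K L N : complex R) (u : dmor K (direct_sum L M))
             (v : dmor (direct_sum L M) N) (w : dmor N (shift K)),
        [/\ thick1 K, thick n' N & distinguished u v w]
  end.

(* The values are natural numbers or +oo, seen in the extended integers. *)
Definition level (M : complex R) : \bar int :=
  infimum +oo%E [set l | exists2 n, thick n M & l = (n%:Z)%:E%E].

End Level.

(* Modules as complexes concentrated in degree 0. *)
Definition as_complexes (G : lmodType R -> Prop) : complex R -> Prop :=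
  fun X => exists2 M, G M & X = in_degree0 M.

Definition sup_level (C D : complex R -> Prop) : \bar int :=
  supremum -oo%E [set l | exists2 M, D M & l = level C M].

(** * Gorenstein projective, injective and flat modules *)

(* Hom(P, Q) is acyclic: a linear map on a term of P that vanishes on
   boundaries factors through the differential. *)
Definition acyclic_hom_into (P : complex R) (Q : lmodType R) : Prop :=
  forall i (phi : {linear P (i - 1) -> Q}),
    (forall x, phi (diff P i x) = 0) ->
    exists psi : {linear P (i - 1 - 1) -> Q},
      forall x, psi (diff P (i - 1) x) = phi x.

(* Hom(E, I) is acyclic. *)
Definition acyclic_hom_from (E : lmodType R) (I : complex R) : Prop :=
  forall i (phi : {linear E -> I (i - 1)}),
    (forall x, diff I (i - 1) (phi x) = 0) ->
    exists psi : {linear E -> I i}, forall x, diff I i (psi x) = phi x.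

Lemma tensor_diffK (E : lmodType R) (F : complex R) i (x : tensor E (F i)) :
  tensor_map E (diff F (i - 1)) (tensor_map E (diff F i) x) = 0.
Proof.
rewrite -[x]tensor_reprK !tensor_mapE; apply/tensor_classP.
elim: (repr x) => [|[e f] s IHs]; first exact: tr_refl.
apply: (@tr_cat _ _ _ [:: _] [::] _ [::]) => //=; rewrite diffK.
rewrite -[X in (_, X)](scale0r 0); apply: tr_trans (tr_sym (tr_scale _ _ _)) _.
by rewrite scale0r; apply: tr_zero.
Qed.

Definition tensor_complex (E : lmodType R) (F : complex R) : complex R :=
  @Complex R (fun i => tensor E (F i)) (fun i => tensor_map E (diff F i))
    (@tensor_diffK E F).

Definition gorenstein_projective : lmodType R -> Prop := fun G =>
  exists P : complex R,
    [/\ acyclic P, forall i, projective (P i),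
        forall Q, projective Q -> acyclic_hom_into P Q
      & exists i (c : {linear P (i - 1) -> G}), is_cokernel (diff P i) c].

Definition gorenstein_injective : lmodType R -> Prop := fun G =>
  exists I : complex R,
    [/\ acyclic I, forall i, injective_module (I i),
        forall E, injective_module E -> acyclic_hom_from E I
      & exists i (k : {linear G -> I i}), is_kernel (diff I i) k].

Definition gorenstein_flat : lmodType R -> Prop := fun G =>
  exists F : complex R,
    [/\ acyclic F, forall i, flat (F i),
        forall E, injective_module E -> acyclic (tensor_complex E F)
      & exists i (c : {linear F (i - 1) -> G}), is_cokernel (diff F i) c].

End Complexes.

(* Main.v *)
(* Bass' theorem bounds the injective dimension of R by d = dim R: if x is a
   maximal regular sequence of length r, then k embeds into R/(x), which forces
   id R <= r, and regular sequences give chains of primes.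

   Flat modules then have injective dimension at most d, and Tor-Ext duality
   makes a d-th syzygy G of an injective module flat.  The syzygy K of G is flat,
   hence Ext^1(G, K) is an Ext^(d+1) into a module of injective dimension at most
   d and vanishes: G is projective.  Applying the horseshoe lemma to
   0 -> N -> I -> N' -> 0 with I injective embeds a d-th syzygy of N into a
   projective module with cokernel a d-th syzygy of N', so d-th syzygies are
   Gorenstein projective.  Dually, d-th cosyzygies are Gorenstein injective.
   Gorenstein projective modules are Gorenstein flat, as injective modules have
   finite projective dimension.

   A complex with bounded homology is isomorphic to a bounded complex X which,
   up to a shift, embeds into a contractible complex of projectives, so that its
   cycles and boundaries are first syzygies.  Covering X by a sum of spheres and
   disks of projectives, surjectively on cycles, replaces all cycles and
   boundaries by their syzygies at the cost of one layer.  After d - 1 layers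
   they are Gorenstein projective, and 0 -> Z -> X -> X/Z -> 0 exhibits the
   remaining complex as two more layers. *)

Require Import Defs.
From HB Require Import structures.
From mathcomp Require Import all_boot all_order all_algebra.
From mathcomp Require Import boolp classical_sets functions constructive_ereal.
From mathcomp Require Import zify.

Set Implicit Arguments.
Unset Strict Implicit.
Unset Printing Implicit Defensive.

Import Order.TTheory GRing.Theory Num.Theory.
Local Open Scope ring_scope.
Local Open Scope classical_set_scope.
(* The library file [functions] has another [surj]. *)
Local Notation surj := Defs.surj.

(** * Linear maps, submodules and quotients *)

(** No Ext or Tor group is formed; only their vanishing is stated, in two forms. For arbitrary
    modules [ext1] says that maps extend along short exact sequences, and higher degrees are reached
    by passing to syzygies of the first argument or cosyzygies of the second. For finitely generated
    modules a resolution is a sequence of matrices, which act on vectors over any module X: the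
    matrices themselves compute Tor with X, their transposes compute Ext into X. Both forms are
    needed. Nakayama's lemma requires finitely generated cohomology, that is a module R/I in the
    first argument and R itself in the second, whereas the cosyzygies of R and the modules in the
    complexes are not finitely generated. Baer's criterion joins the two, since it tests injectivity
    of any module on the R/I alone. *)

Lemma dep_choice (I : Type) (T : I -> Type) (P : forall i, T i -> Prop) :
  (forall i, exists x, P i x) -> exists f : forall i, T i, forall i, P i (f i).
Proof. by move=> h; exists (fun i => sval (cid (h i))) => i; apply: (svalP (cid (h i))). Qed.

Lemma dep_choice2 (I : Type) (T : I -> Type) (V : forall i, T i -> Type)
    (P : forall i x, V i x -> Prop) :
  (forall i, exists x (y : V i x), P i x y) ->
  exists (f : forall i, T i) (g : forall i, V i (f i)), forall i, P i (f i) (g i).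
Proof. by move=> /dep_choice[f /dep_choice[g gP]]; exists f, g. Qed.

Section LinearMaps.
Variable R : comNzRingType.
Implicit Types A B C K M N X : lmodType R.

Definition submod M (S : set M) : Prop :=
  S 0 /\ forall c x y, S x -> S y -> S (c *: x + y).

Lemma submodD M (S : set M) x y : submod S -> S x -> S y -> S (x + y).
Proof. by move=> [_ h] Sx Sy; rewrite -[x]scale1r; apply: h. Qed.

Lemma submodZ M (S : set M) c x : submod S -> S x -> S (c *: x).
Proof. by move=> [S0 h] Sx; rewrite -[_ *: _]addr0; apply: h. Qed.

Lemma submodN M (S : set M) x : submod S -> S x -> S (- x).
Proof. by move=> hS Sx; rewrite -scaleN1r; apply: submodZ. Qed.

Lemma submodB M (S : set M) x y : submod S -> S x -> S y -> S (x - y).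
Proof. by move=> hS Sx Sy; apply: submodD => //; apply: submodN. Qed.

Lemma submod_sum M (S : set M) I (r : seq I) (P : pred I) (F : I -> M) :
  submod S -> (forall i, P i -> S (F i)) -> S (\sum_(i <- r | P i) F i).
Proof.
move=> hS hF; elim/big_rec: _ => [|i x Pi Sx]; first by case: hS.
by apply: submodD => //; apply: hF.
Qed.

Definition mk_linear A B (f : A -> B) (lf : linear f) : {linear A -> B} :=
  HB.pack f (GRing.isLinear.Build R A B *:%R f lf).

Lemma linear_exists A B (f : A -> B) :
  linear f -> exists g : {linear A -> B}, forall x, g x = f x.
Proof. by move=> lf; exists (mk_linear lf). Qed.

(** A total linear relation is single-valued once 0 has no value but 0. Maps given by choosing
    representatives are therefore built without a separate check of well-definedness. *)
Lemma linear_of_rel A B (G : A -> B -> Prop) :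
    (forall a, exists b, G a b) -> (forall b, G 0 b -> b = 0) ->
    (forall c a b a' b', G a b -> G a' b' -> G (c *: a + a') (c *: b + b')) ->
  exists f : {linear A -> B}, forall a, G a (f a).
Proof.
move=> tot fun0 lin; have [f fP] := choice tot.
have Gu a b b' : G a b -> G a b' -> b = b'.
  move=> Gb Gb'; apply/eqP; rewrite -subr_eq0; apply/eqP/fun0.
  by have := lin (-1) _ _ _ _ Gb' Gb; rewrite !scaleN1r addNr addrC.
have lf : linear f by move=> c x y; apply: Gu (fP _) _; apply: lin.
by exists (mk_linear lf).
Qed.

Lemma linear_factor_surj A B C (p : {linear A -> B}) (f : {linear A -> C}) :
  surj p -> (forall x, p x = 0 -> f x = 0) ->
  exists g : {linear B -> C}, forall x, g (p x) = f x.
Proof.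
move=> sp h.
have [||c a b a' b' [x [<- <-]] [y [<- <-]]|g gP] :=
    @linear_of_rel B C (fun b c => exists x, p x = b /\ f x = c).
- by move=> b; have [a <-] := sp b; exists (f a), a.
- by move=> b [x [/h -> <-]].
- by exists (c *: x + y); rewrite !linearP.
- exists g => x; have [y [pe <-]] := gP (p x).
  apply/eqP; rewrite -subr_eq0 -linearB; apply/eqP/h.
  by rewrite linearB pe subrr.
Qed.

Lemma linear_factor_inj A B K (k : {linear K -> A}) (f : {linear B -> A}) :
  injective k -> (forall b, exists y, k y = f b) ->
  exists g : {linear B -> K}, forall x, k (g x) = f x.
Proof.
move=> ik h.
have [||c a b a' b' e e'|g gP] :=
    @linear_of_rel B K (fun b y => k y = f b).
- by move=> b; have [y] := h b; exists y.
- by move=> b; rewrite linear0 -[RHS](linear0 k) => /ik.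
- by rewrite !linearP e e'.
- by exists g.
Qed.

Lemma inj0P A B (f : {linear A -> B}) :
  (forall x, f x = 0 -> x = 0) -> injective f.
Proof.
move=> h x y e; apply/eqP; rewrite -subr_eq0; apply/eqP/h.
by rewrite linearB e subrr.
Qed.

Lemma inj0 A B (f : {linear A -> B}) x : injective f -> f x = 0 -> x = 0.
Proof. by move=> fi; rewrite -(linear0 f) => /fi. Qed.

Lemma ker_submod A B (f : {linear A -> B}) : submod [set x | f x = 0].
Proof.
split=> [|c x y /= fx fy]; first exact: linear0.
by rewrite linearP /= fx fy scaler0 addr0.
Qed.

Lemma im_submod A B (f : {linear A -> B}) : submod [set y | exists x, f x = y].
Proof.
split=> [|c _ _ [x <-] [y <-]] /=; first by exists 0; rewrite linear0.
by exists (c *: x + y); rewrite linearP.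
Qed.

Section Submodule.
Variables (M : lmodType R) (S : set M) (hS : submod S).

(** Membership is made boolean so that its proof is unique and the inclusion is injective. *)
Record submodule := Submodule { sval_ : M; svalP_ : `[< S sval_ >] }.
HB.instance Definition _ := [isSub for sval_].
HB.instance Definition _ := [Choice of submodule by <:].

Definition smk x (Sx : S x) : submodule := Submodule (asboolT Sx).
Lemma svalS (x : submodule) : S (sval_ x). Proof. exact: asboolW (svalP_ x). Qed.

Definition sub_add (x y : submodule) := smk (submodD hS (svalS x) (svalS y)).
Definition sub_opp (x : submodule) := smk (submodN hS (svalS x)).
Definition sub_scale c (x : submodule) := smk (submodZ c hS (svalS x)).
Definition sub_zero := smk (proj1 hS).

Let sub_addA : associative sub_add.
Proof. by move=> x y z; apply: val_inj; apply: addrA. Qed.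
Let sub_addC : commutative sub_add.
Proof. by move=> x y; apply: val_inj; apply: addrC. Qed.
Let sub_add0 : left_id sub_zero sub_add.
Proof. by move=> x; apply: val_inj; apply: add0r. Qed.
Let sub_addN : left_inverse sub_zero sub_opp sub_add.
Proof. by move=> x; apply: val_inj; apply: addNr. Qed.

Definition submodule_zmod : zmodType :=
  HB.pack submodule (GRing.isZmodule.Build submodule
    sub_addA sub_addC sub_add0 sub_addN).

Let sub_scaleA a b (x : submodule_zmod) :
  sub_scale a (sub_scale b x) = sub_scale (a * b) x.
Proof. by apply: val_inj; apply: scalerA. Qed.
Let sub_scale1 : left_id 1 sub_scale.
Proof. by move=> x; apply: val_inj; apply: scale1r. Qed.
Let sub_scaleDr : @right_distributive R submodule_zmod sub_scale +%R.
Proof. by move=> a x y; apply: val_inj; apply: scalerDr. Qed.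
Let sub_scaleDl (x : submodule_zmod) :
  {morph (fun a => sub_scale a x : submodule_zmod) : a b / a + b}.
Proof. by move=> a b; apply: val_inj; apply: scalerDl. Qed.

Definition submodule_lmod : lmodType R :=
  HB.pack submodule submodule_zmod
    (GRing.Zmodule_isLmodule.Build R submodule_zmod
      sub_scaleA sub_scale1 sub_scaleDr sub_scaleDl).

(** The existential hides the construction: later arguments see only an injective map with image
    [S], and so work up to isomorphism. *)
Lemma exists_submodule : exists (K : lmodType R) (k : {linear K -> M}),
  injective k /\ forall x, S x <-> exists y, k y = x.
Proof.
have lv : linear (sval_ : submodule_lmod -> M) by [].
exists submodule_lmod, (mk_linear lv); split; first exact: val_inj.
by move=> x; split=> [Sx|[y <-]]; [exists (smk Sx)|exact: svalS].
Qed.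

End Submodule.

Section Quotient.
Variables (M : lmodType R) (S : set M) (hS : submod S).

Definition qrel (x y : M) : bool := `[< S (x - y) >].

Lemma qrel_equiv : equiv_class_of qrel.
Proof.
split=> [x|x y|y x z]; first by apply/asboolP; rewrite subrr; case: hS.
  by apply/asboolP/asboolP => /(submodN hS); rewrite opprB.
move=> /asboolP xy /asboolP yz; apply/asboolP.
by have := submodD hS xy yz; rewrite addrA subrK.
Qed.

Let qequiv := EquivRelPack qrel_equiv.
Definition quotient_ := {eq_quot qequiv}%qT.
HB.instance Definition _ := Choice.on quotient_.
Definition qproj (x : M) : quotient_ := (\pi_{eq_quot qequiv} x)%qT.

Lemma qprojP x y : qproj x = qproj y <-> S (x - y).
Proof.
rewrite /qproj; split=> [/eqP|st]; first by rewrite eqmodE => /asboolP.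
by apply/eqP; rewrite eqmodE; apply/asboolP.
Qed.

Lemma qreprK (x : quotient_) : qproj (repr x) = x. Proof. exact: reprK. Qed.

Lemma qrepr x : S (repr (qproj x) - x). Proof. by apply/qprojP/qreprK. Qed.

Definition q_add (x y : quotient_) := qproj (repr x + repr y).
Definition q_scale c (x : quotient_) := qproj (c *: repr x).
Definition q_opp (x : quotient_) := q_scale (-1) x.

Lemma q_addE x y : q_add (qproj x) (qproj y) = qproj (x + y).
Proof.
by apply/qprojP; rewrite opprD addrACA; apply: submodD hS (qrepr _) (qrepr _).
Qed.
Lemma q_scaleE c x : q_scale c (qproj x) = qproj (c *: x).
Proof. by apply/qprojP; rewrite -scalerBr; apply: submodZ hS (qrepr _). Qed.

Let q_addA : associative q_add.
Proof.
by move=> x y z; rewrite -[x]qreprK -[y]qreprK -[z]qreprK !q_addE addrA.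
Qed.
Let q_addC : commutative q_add.
Proof. by move=> x y; rewrite -[x]qreprK -[y]qreprK !q_addE addrC. Qed.
Let q_add0 : left_id (qproj 0) q_add.
Proof. by move=> x; rewrite -[x]qreprK !q_addE add0r. Qed.
Let q_addN : left_inverse (qproj 0) q_opp q_add.
Proof.
by move=> x; rewrite -[x]qreprK /q_opp q_scaleE q_addE scaleN1r addNr.
Qed.

Definition quotient_zmod : zmodType :=
  HB.pack quotient_ (GRing.isZmodule.Build quotient_ q_addA q_addC q_add0 q_addN).

Let q_scaleA a b (x : quotient_zmod) : q_scale a (q_scale b x) = q_scale (a * b) x.
Proof. by rewrite -[x]qreprK !q_scaleE scalerA. Qed.
Let q_scale1 : left_id 1 q_scale.
Proof. by move=> x; rewrite -[x]qreprK !q_scaleE scale1r. Qed.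
Let q_scaleDr : @right_distributive R quotient_zmod q_scale +%R.
Proof.
move=> a x y; rewrite -[x]qreprK -[y]qreprK -[LHS]/(q_scale a (q_add _ _)).
by rewrite -[RHS]/(q_add _ _) !(q_addE, q_scaleE) scalerDr.
Qed.
Let q_scaleDl (x : quotient_zmod) :
  {morph (fun a => q_scale a x : quotient_zmod) : a b / a + b}.
Proof.
move=> a b; rewrite -[x]qreprK -[RHS]/(q_add _ _).
by rewrite !(q_addE, q_scaleE) scalerDl.
Qed.

Definition quotient_lmod : lmodType R :=
  HB.pack quotient_ quotient_zmod
    (GRing.Zmodule_isLmodule.Build R quotient_zmod
      q_scaleA q_scale1 q_scaleDr q_scaleDl).

Lemma exists_quotient : exists (Q : lmodType R) (q : {linear M -> Q}),
  surj q /\ forall x, q x = 0 <-> S x.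
Proof.
have lq : linear (qproj : M -> quotient_lmod).
  move=> c x y; rewrite -[RHS]/(q_add (q_scale c (qproj x)) (qproj y)).
  by rewrite q_scaleE q_addE.
exists quotient_lmod, (mk_linear lq); split=> [y|x].
  by exists (repr (y : quotient_)); apply: qreprK.
by rewrite -{2}[x]subr0; apply: (qprojP x 0).
Qed.

End Quotient.

End LinearMaps.

(** * Extensions *)

Section Ext.
Variable R : comNzRingType.
Implicit Types A B C J K M N P Q X : lmodType R.

Definition ses K X A (k : {linear K -> X}) (p : {linear X -> A}) : Prop :=
  [/\ injective k, surj p & forall x, p x = 0 <-> exists y, k y = x].

Lemma sesK K X A (k : {linear K -> X}) (p : {linear X -> A}) y :
  ses k p -> p (k y) = 0.
Proof. by case=> _ _ h; apply/h; exists y. Qed.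

Lemma ses_of_surj X A (p : {linear X -> A}) :
  surj p -> exists K (k : {linear K -> X}), ses k p.
Proof.
move=> sp; have [K [k [ik kP]]] := exists_submodule (ker_submod p).
by exists K, k; split.
Qed.

Lemma ses_of_inj K X (k : {linear K -> X}) :
  injective k -> exists A (p : {linear X -> A}), ses k p.
Proof.
move=> ik; have [A [p [sp pP]]] := exists_quotient (im_submod k).
by exists A, p; split.
Qed.

(* Ext^1(A, B) = 0. *)
Definition ext1 A B : Prop :=
  forall K X (k : {linear K -> X}) (p : {linear X -> A}), ses k p ->
  forall h : {linear K -> B}, exists u : {linear X -> B}, forall y, u (k y) = h y.

(** One projective presentation of A suffices: any extension X of A by K' is the pushout of P along
    the map K -> K' induced by a lift of P -> A to X. *)
Lemma ext1_of_proj K P A B (k : {linear K -> P}) (p : {linear P -> A}) :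
    ses k p -> projective P ->
    (forall h : {linear K -> B},
       exists u : {linear P -> B}, forall y, u (k y) = h y) ->
  ext1 A B.
Proof.
move=> kp pP ext K' X k' p' kp' h.
have [ik sp kerp] := kp; have [ik' sp' kerp'] := kp'.
have [l lP] := pP _ _ p' p sp'.
have [|m mP] := @linear_factor_inj R X K K' k' (l \o k) ik'.
  by move=> y; apply/kerp'; rewrite /= lP (sesK _ kp).
have [v vP] := ext (h \o m).
(* Every x is [l t + k' z], and [v t + h z] does not depend on the choice because [v] extends
   [h \o m]. *)
have [||c x b x' b' [t [z [e1 e2 ->]]] [t' [z' [e1' e2' ->]]]|u uP] :=
    @linear_of_rel R X B (fun x b => exists t z,
      [/\ p t = p' x, k' z = x - l t & b = v t + h z]).
- move=> x; have [t pt] := sp (p' x).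
  have [|z kz] := (kerp' (x - l t)).1; first by rewrite linearB lP pt subrr.
  by exists (v t + h z), t, z.
- move=> b [t [z []]]; rewrite linear0 => /kerp [y <-] kz ->.
  have -> : z = - m y by apply: ik'; rewrite kz linearN mP sub0r.
  by rewrite vP linearN subrr.
- exists (c *: t + t'), (c *: z + z'); split.
  + by rewrite linearP e1 e1' linearP.
  + by rewrite linearP e2 e2' [l (_ + _)]linearP scalerBr opprD addrACA.
  + by rewrite !linearP scalerDr addrACA.
- exists u => y; have [t [z [e1 e2 ->]]] := uP (k' y).
  move: e1; rewrite (sesK _ kp') => /kerp [w tw].
  have -> : z = y - m w by apply: ik'; rewrite e2 linearB mP /= tw.
  by rewrite -tw vP linearB /= addrC subrK.
Qed.

Lemma ext1_of_inj B J C A (i : {linear B -> J}) (q : {linear J -> C}) :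
    ses i q -> injective_module J ->
    (forall f : {linear A -> C},
       exists g : {linear A -> J}, forall x, q (g x) = f x) ->
  ext1 A B.
Proof.
move=> iq iJ lift K X k p kp h.
have [ii sq kerq] := iq; have [ik sp kerp] := kp.
have [v vP] := iJ _ _ k (i \o h) ik.
have [|f fP] := @linear_factor_surj R X A C p (q \o v) sp.
  by move=> x /kerp[y <-]; rewrite /= vP (sesK _ iq).
have [g gP] := lift f.
have [|u uP] := @linear_factor_inj R J X B i (v \- (g \o p)) ii.
  by move=> x; apply/kerq; rewrite linearB /= gP fP subrr.
exists u => y; apply: ii; rewrite uP /= (sesK _ kp) linear0 subr0.
exact: vP.
Qed.

(** The pullback Z of f and q is an extension of A by B. A retraction of Z onto B splits it, and the
    section followed by the projection to X is the lift. *)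
Lemma ext1_lift A B X C (i : {linear B -> X}) (q : {linear X -> C}) :
    ext1 A B -> ses i q -> forall f : {linear A -> C},
  exists g : {linear A -> X}, forall x, q (g x) = f x.
Proof.
move=> ext iq f; have [ii sq kerq] := iq.
have [|Z [z [iz zP]]] := @exists_submodule R (A * X)%type [set t | f t.1 = q t.2].
  by split=> [|c x y /= e e']; rewrite /= ?linear0 ?linearP ?e ?e' // !linearP.
have zf t : f (z t).1 = q (z t).2 by apply/zP; exists t.
have [b' b'P] : exists b' : {linear B -> (A * X)%type},
    forall b, b' b = (0, i b).
  have lb : linear (fun b => (0, i b) : A * X).
    by move=> c x y; apply: injective_projections; rewrite /= ?scaler0 ?addr0 ?linearP.
  exact: linear_exists lb.
have [|k kP] := linear_factor_inj (f := b') iz.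
  by move=> b; apply/zP; rewrite /= b'P /= linear0 (sesK _ iq).
have sp : ses k (fst \o z).
  split=> [x y e|a|t].
  - by have := kP x; rewrite e kP !b'P => -[/ii].
  - have [x qx] := sq (f a).
    by have [|t zt] := (zP (a, x)).1; [rewrite /= qx|exists t; rewrite /= zt].
  - split=> [/= z0|[b <-]]; last by rewrite /= kP b'P.
    have /esym := zf t; rewrite z0 linear0 => /kerq[b ib].
    by exists b; apply: iz; rewrite kP b'P ib -z0 -surjective_pairing.
have [u uP] := ext _ _ _ _ sp idfun.
have [||c a x a' x' [t [e ->]] [t' [e' ->]]|g gP] :=
    @linear_of_rel R A X (fun a x => exists t, (z t).1 = a /\ x = (z t).2 - i (u t)).
- move=> a; have [x qx] := sq (f a).
  by have [|t zt] := (zP (a, x)).1; [rewrite /= qx|exists ((z t).2 - i (u t)), t; rewrite zt].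
- move=> x [t [t0 ->]].
  have [b bt] : exists b, k b = t by case: sp => _ _ h; apply/h.
  by rewrite -bt uP kP b'P subrr.
- exists (c *: t + t'); split; first by rewrite linearP /= e e'.
  rewrite [z (_ + _)]linearP [u (_ + _)]linearP /= [i (_ + _)]linearP.
  by rewrite scalerBr opprD addrACA.
- exists g => a; have [t [ta ->]] := gP a.
  by rewrite linearB (sesK _ iq) subr0 -zf ta.
Qed.

Lemma ext1_proj P B : projective P -> ext1 P B.
Proof.
move=> pP; apply: (@ext1_of_proj (zero_module R) P P B \0 idfun).
- split=> [x y _|x|x]; first by rewrite !thinmx0.
    by exists x.
  by split=> [/= ->|[y <-]] //; exists 0.
- by [].
- by move=> h; exists \0 => y; rewrite [y]thinmx0 !linear0.
Qed.

Lemma ext1_inj A J : injective_module J -> ext1 A J.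
Proof. by move=> iJ K X k p [ik _ _] h; apply: iJ. Qed.

(** Both sides are Ext^2(A, B), by dimension shifting in either argument. *)
Lemma ext1_shift K P A B J C (k : {linear K -> P}) (p : {linear P -> A})
    (i : {linear B -> J}) (q : {linear J -> C}) :
    ses k p -> ses i q -> projective P -> injective_module J ->
  ext1 K B <-> ext1 A C.
Proof.
move=> kp iq pP iJ; have [ik sp kerp] := kp; have [ii sq kerq] := iq.
split=> ext.
- apply: (ext1_of_proj kp pP) => f.
  have [g gP] := ext1_lift ext iq f.
  have [v vP] := iJ _ _ k g ik.
  by exists (q \o v) => y; rewrite /= vP gP.
- apply: (ext1_of_inj iq iJ) => f.
  have [u uP] := ext _ _ _ _ kp f.
  have [v vP] := pP _ _ q u sq.
  by exists (v \o k) => y; rewrite /= vP uP.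
Qed.

Lemma retract_projective P Q (s : {linear P -> Q}) (r : {linear Q -> P}) :
  (forall x, r (s x) = x) -> projective Q -> projective P.
Proof.
move=> rs pQ A B p f sp; have [g gP] := pQ _ _ p (f \o r) sp.
by exists (g \o s) => x; rewrite /= gP /= rs.
Qed.

Lemma ext1_projective K P A (k : {linear K -> P}) (p : {linear P -> A}) :
  ses k p -> projective P -> ext1 A K -> projective A.
Proof.
move=> kp pP ext; have [s sP] := ext1_lift ext kp idfun.
exact: retract_projective sP pP.
Qed.

Lemma pair_linear A B C (f : {linear A -> B}) (g : {linear A -> C}) :
  exists h : {linear A -> (B * C)%type}, forall x, h x = (f x, g x).
Proof.
by apply: linear_exists => c x y; apply: injective_projections; rewrite /= linearP.
Qed.

Lemma copair_linear A B C (f : {linear A -> C}) (g : {linear B -> C}) :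
  exists h : {linear (A * B)%type -> C}, forall x, h x = f x.1 + g x.2.
Proof.
by apply: linear_exists => c x y; rewrite !linearP /= scalerDr addrACA.
Qed.

Lemma injective_prod A B :
  injective_module A -> injective_module B -> injective_module (A * B)%type.
Proof.
move=> iA iB X Y i f ii.
have [g gP] := iA _ _ i (fst \o f) ii; have [h hP] := iB _ _ i (snd \o f) ii.
have [u uP] := pair_linear g h; exists u => x.
by rewrite uP gP hP /= -surjective_pairing.
Qed.

Lemma projective_prod A B :
  projective A -> projective B -> projective (A * B)%type.
Proof.
move=> pA pB X Y p f sp.
have lA : linear (fun a : A => (a, 0) : A * B).
  by move=> c x y; apply: injective_projections; rewrite /= ?scaler0 ?addr0.
have lB : linear (fun b : B => (0, b) : A * B).
  by move=> c x y; apply: injective_projections; rewrite /= ?scaler0 ?addr0.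
have [g gP] := pA _ _ p (f \o mk_linear lA) sp.
have [h hP] := pB _ _ p (f \o mk_linear lB) sp.
have [u uP] := copair_linear g h; exists u => -[a b].
rewrite uP linearD gP hP /= -linearD; congr (f _).
by apply: injective_projections; rewrite /= ?addr0 ?add0r.
Qed.

End Ext.

(** * Free modules *)

Section Free.
Variable R : comNzRingType.
Implicit Types A B M P : lmodType R.

Lemma sum_subset (V : zmodType) (S : eqType) (s t : seq S) (F : S -> V) :
    uniq s -> uniq t -> {subset s <= t} -> (forall x, x \notin s -> F x = 0) ->
  \sum_(x <- t) F x = \sum_(x <- s) F x.
Proof.
move=> us ut st F0; rewrite (bigID (mem s)) /= [X in _ + X]big1 //.
rewrite addr0 -big_filter; apply: perm_big; apply: uniq_perm => //.
  exact: filter_uniq.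
move=> x; rewrite mem_filter /=; case: (boolP (x \in s)) => //= /st.
by [].
Qed.

Definition finsum (V : zmodType) (S : eqType) (F : S -> V) (y : V) : Prop :=
  exists s, [/\ uniq s, forall x, x \notin s -> F x = 0 & y = \sum_(x <- s) F x].

Lemma finsum_big (V : zmodType) (S : eqType) (F : S -> V) y (t : seq S) :
    finsum F y -> exists s, [/\ uniq s, {subset t <= s},
    forall x, x \notin s -> F x = 0 & y = \sum_(x <- s) F x].
Proof.
move=> [s [us s0 ->]]; exists (undup (s ++ t)); split.
- exact: undup_uniq.
- by move=> x xt; rewrite mem_undup mem_cat xt orbT.
- by move=> x; rewrite mem_undup mem_cat negb_or => /andP[/s0].
- apply/esym/sum_subset => //; first exact: undup_uniq.
  by move=> x xs; rewrite mem_undup mem_cat xs.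
Qed.

Lemma finsum0 (V : zmodType) (S : eqType) (F : S -> V) y :
  (forall x, F x = 0) -> finsum F y -> y = 0.
Proof. by move=> F0 [s [_ _ ->]]; apply: big1. Qed.

Lemma finsumP (V : lmodType R) (S : eqType) (F G : S -> V) c y z :
  finsum F y -> finsum G z -> finsum (fun x => c *: F x + G x) (c *: y + z).
Proof.
move=> fy [t [ut t0 ->]].
have [s [us ts s0 ->]] := finsum_big t fy; exists s; split=> //.
  move=> x xs; rewrite s0 // t0 ?scaler0 ?addr0 //.
  by apply: contra xs => /ts.
rewrite big_split -scaler_sumr /=; congr (_ + _).
exact/esym/sum_subset.
Qed.

(** The dual basis of a projective module: the family [e] generates with coordinates [c], but need
    not be independent. It reduces questions about P to its coordinates in R. *)
Record dbasis (S : eqType) P (e : S -> P) (c : S -> {linear P -> R^o}) : Prop :=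
  Dbasis { db_sum : forall p, exists s, [/\ uniq s,
             forall x, x \notin s -> c x p = 0 & p = \sum_(x <- s) c x p *: e x] }.

Lemma dbasis_support (S : eqType) P e (c : S -> {linear P -> R^o}) n (p : 'I_n -> P) :
  dbasis e c -> exists s, [/\ uniq s,
    forall i x, x \notin s -> c x (p i) = 0 &
    forall i, p i = \sum_(x <- s) c x (p i) *: e x].
Proof.
move=> [bas].
have [s sP] := choice (fun i => bas (p i)).
pose t := undup (flatten [seq s i | i <- enum 'I_n]).
have st i : {subset s i <= t}.
  move=> x xs; rewrite mem_undup; apply/flattenP; exists (s i) => //.
  by apply: map_f; rewrite mem_enum.
have t0 i x : x \notin t -> c x (p i) = 0.
  by move=> xt; have [_ s0 _] := sP i; apply: s0; apply: contra xt; apply: st.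
exists t; split=> // [|i]; first exact: undup_uniq.
have [us s0 {1}->] := sP i; apply/esym/sum_subset => //; first exact: undup_uniq.
by move=> x /s0 ->; rewrite scale0r.
Qed.

Lemma dbasis_linear (S : eqType) P e (c : S -> {linear P -> R^o}) A (a : S -> A) :
    dbasis e c ->
  exists g : {linear P -> A}, forall p, finsum (fun x => c x p *: a x) (g p).
Proof.
move=> [bas].
apply: (@linear_of_rel R P A (fun p => finsum (fun x => c x p *: a x))).
- move=> p; have [s [us s0 _]] := bas p.
  exists (\sum_(x <- s) c x p *: a x), s; split=> // x /s0 ->.
  by rewrite scale0r.
- by move=> b /finsum0 -> // x; rewrite linear0 scale0r.
- move=> k p y p' y' fy fy'.
  have := finsumP k fy fy'; congr (finsum _ _); apply/funext => x.
  by rewrite linearP scalerDl scalerA.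
Qed.

Lemma exists_free (S : eqType) : exists (F : lmodType R) (e : S -> F)
  (c : S -> {linear F -> R^o}), dbasis e c /\ forall x y, c x (e y) = (x == y)%:R.
Proof.
pose A : set (S -> R^o) :=
  [set f | exists s, uniq s /\ forall x, x \notin s -> f x = 0].
have hA : submod A.
  split=> [|k f g [s [us s0]] [t [ut t0]]]; first by exists [::].
  exists (undup (s ++ t)); split; first exact: undup_uniq.
  move=> x; rewrite mem_undup mem_cat negb_or => /andP[/s0 e /t0 e'].
  by rewrite -[LHS]/(k *: f x + g x) e e' scaler0 addr0.
have [F [k [ik kP]]] := exists_submodule hA.
have [|e eP] := @choice S F (fun y z => k z = fun x => (x == y)%:R).
  move=> y; suff /kP[z kz] : A (fun x => (x == y)%:R) by exists z.
  by exists [:: y]; split=> // x; rewrite inE => /negPf ->.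
have lev (x : S) : linear (fun f : F => k f x : R^o) by move=> c f g; rewrite linearP.
exists F, e, (fun x => mk_linear (lev x)); split; last by move=> x y /=; rewrite eP.
split=> f; have [s [us s0]] := (kP (k f)).2 (ex_intro _ f erefl).
exists s; split=> //; apply: ik; apply/funext => x.
rewrite linear_sum.
have -> : (\sum_(i <- s) k (k f i *: e i)) x = \sum_(i <- s) k f i * (x == i)%:R.
  elim: (s) => [|i t IH]; first by rewrite !big_nil.
  by rewrite !big_cons -IH linearZ /= eP.
case: (boolP (x \in s)) => xs; last first.
  rewrite s0 // big1_seq // => i /andP[_ si].
  by case: eqP => [xi|]; rewrite ?mulr0 //; rewrite xi si in xs.
rewrite (bigD1_seq x) //= eqxx mulr1 big1 ?addr0 // => i /negPf.
by rewrite eq_sym => ->; rewrite mulr0.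
Qed.

Lemma free_projective (S : eqType) P (e : S -> P) (c : S -> {linear P -> R^o}) :
  dbasis e c -> projective P.
Proof.
move=> bas A B p f sp.
have [a aP] := choice (fun x => sp (f (e x))).
have [g gP] := dbasis_linear a bas; exists g => t.
have [s [us s0 te]] := db_sum bas t.
have [s' [us' ss' s0' ->]] := finsum_big s (gP t).
rewrite {2}te !linear_sum.
rewrite -(@sum_subset _ _ s s') // => [|x /s0 ->]; last by rewrite scale0r linear0.
by apply: eq_bigr => x _; rewrite !linearZ /= aP.
Qed.

Definition trivial_module M : Prop := forall x : M, x = 0.

Lemma zero_module_trivial : trivial_module (zero_module R).
Proof. by move=> x; rewrite [x]thinmx0. Qed.

Lemma free_cover M : exists P (p : {linear P -> M}),
  surj p /\ exists (S : eqType) (e : S -> P) (c : S -> {linear P -> R^o}), dbasis e c.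
Proof.
have [F [e [c [bas ce]]]] := exists_free M.
have [p pP] := dbasis_linear idfun bas.
exists F, p; split; last by exists M, e, c.
move=> m; exists (e m).
have [s [us ms s0 ->]] := finsum_big [:: m] (pP (e m)).
rewrite (bigD1_seq m) ?ms ?inE //= ce eqxx scale1r big1 ?addr0 // => i /negPf im.
by rewrite ce im scale0r.
Qed.

(** No minimality is claimed. Covering trivial modules by trivial ones keeps a complex bounded when
    all its degrees are covered at once. *)
Lemma projective_cover M : exists P (p : {linear P -> M}),
  [/\ projective P, surj p & trivial_module M -> trivial_module P].
Proof.
have [tM|ntM] := pselect (trivial_module M).
  exists (zero_module R), \0; split=> [A B p f sp|m|_].
  - by exists \0 => x; rewrite [x]zero_module_trivial !linear0.
  - by exists 0; rewrite [m]tM.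
  - exact: zero_module_trivial.
have [P [p [sp [S [e [c bas]]]]]] := free_cover M.
by exists P, p; split=> //; apply: free_projective bas.
Qed.

Lemma projective_dbasis P : projective P ->
  exists (S : eqType) (e : S -> P) (c : S -> {linear P -> R^o}), dbasis e c.
Proof.
move=> pP; have [F [p [sp [S [e [c bas]]]]]] := free_cover P.
have [s sP] := pP _ _ p idfun sp.
exists S, (p \o e), (fun x => c x \o s); split=> t.
have [r [ur r0 rE]] := db_sum bas (s t); exists r; split=> //.
by rewrite -{1}[t]sP rE linear_sum; apply: eq_bigr => x _; rewrite linearZ.
Qed.

End Free.

(** * Baer criterion and injective modules *)

Section Baer.
Variable R : comNzRingType.
Implicit Types A B M Y J : lmodType R.

Definition ideal (I : set R) : Prop :=
  I 0 /\ forall c x y, I x -> I y -> I (c * x + y).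

Lemma ideal_submod (I : set R) : ideal I -> submod (I : set R^o).
Proof. by []. Qed.

Definition lin_on M Y (S : set M) (h : M -> Y) : Prop :=
  forall c x y, S x -> S y -> h (c *: x + y) = c *: h x + h y.

(* Ext^1(R/I, Y) = 0. *)
Definition extI (I : set R) Y : Prop :=
  forall h : R^o -> Y, lin_on (I : set R^o) h ->
    exists y, forall a, I a -> h a = a *: y.

Lemma lin_on0 M Y (S : set M) (h : M -> Y) : submod S -> lin_on S h -> h 0 = 0.
Proof.
move=> [S0 _] lh; have := lh 1 0 0 S0 S0; rewrite scaler0 addr0 scale1r.
by move/eqP; rewrite -subr_eq0 opprD addNKr oppr_eq0 => /eqP.
Qed.

Section Extension.
Variables (M Y : lmodType R) (S : set M) (h : M -> Y).
Hypotheses (hS : submod S) (lh : lin_on S h).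
Hypothesis ext : forall I, ideal I -> extI I Y.

Let graph : set (M * Y) := [set t | S t.1 /\ t.2 = h t.1].
(** The graph of [h] is joined to every G because Zorn's lemma asks for the unions of all chains,
    and that of the empty chain is empty. *)
Let good (G : set (M * Y)) : Prop :=
  submod (graph `|` G) /\ forall y, (graph `|` G) (0, y) -> y = 0.

Let good0 : good set0.
Proof.
have h0 := lin_on0 hS lh; split; last by move=> y [[/= _ ->]|].
split=> [|c x y [[Sx ex]|//] [[Sy ey]|//]]; left; first by split=> //=; case: hS.
split; first exact: (proj2 hS).
by rewrite /= ex ey lh.
Qed.

(** A maximal partial extension is total: the r with r b in its domain form an ideal, on which r b
    is sent to r y0 for some y0 by [ext], so that b can be sent to y0. *)
Lemma baer_extension :
  exists g : {linear M -> Y}, forall x, S x -> g x = h x.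
Proof.
have [|G [[sG fG] maxG]] := @Zorn_bigcup _ good.
  move=> F Fgood tot.
  have two p q : (graph `|` \bigcup_(X in F) X) p ->
      (graph `|` \bigcup_(X in F) X) q -> exists X,
      [/\ good X, (graph `|` X) p, (graph `|` X) q &
          (graph `|` X) `<=` (graph `|` \bigcup_(X in F) X)].
    have sub X : F X -> (graph `|` X) `<=` (graph `|` \bigcup_(X in F) X).
      by move=> FX t [gt|Xt]; [left|right; exists X].
    case=> [gp|[X FX Xp]]; case=> [gq|[Z FZ Zq]].
    - by exists set0; split=> //; [left|left|move=> t []//; left].
    - by exists Z; split; [apply: Fgood|left|right|apply: sub].
    - by exists X; split; [apply: Fgood|right|left|apply: sub].
    - have [XZ|ZX] := tot _ _ FX FZ.
        by exists Z; split; [apply: Fgood|right; apply: XZ|right|apply: sub].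
      by exists X; split; [apply: Fgood|right|right; apply: ZX|apply: sub].
  split=> [|y h0].
    split=> [|c p q hp hq].
      by left; split=> /=; [case: hS|rewrite (lin_on0 hS lh)].
    have [X [[sX _] Xp Xq]] := two _ _ hp hq; apply.
    exact: (proj2 sX).
  by have [X [[_ fX] X0 _ _]] := two _ _ h0 h0; apply: fX.
set H := graph `|` G in sG fG.
have tot : forall x, exists y, H (x, y).
  move=> b; apply: contrapT => nb.
  pose I : set R := [set r | exists y, H (r *: b, y)].
  have hI : ideal I.
    split=> [|c r r' [y Hy] [y' Hy']].
      by exists 0; rewrite scale0r; case: sG.
    by exists (c *: y + y'); rewrite scalerDl -scalerA; apply: (proj2 sG _ (_,_) (_,_)).
  have Hu x y y' : H (x, y) -> H (x, y') -> y = y'.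
    move=> Hy Hy'; apply/eqP; rewrite -subr_eq0; apply/eqP/fG.
    by rewrite -[X in (X, _)](subrr x); apply: (submodB sG Hy Hy').
  have [|h' h'P] := @choice R Y (fun r y => I r -> H (r *: b, y)).
    by move=> r; have [[y Hy]|nI] := pselect (I r); [exists y|exists 0].
  have [|y0 y0P] := ext hI (h := h').
    move=> c r r' Ir Ir'; have Ic : I (c * r + r') by apply: (proj2 hI).
    apply: Hu (h'P _ Ic) _; rewrite scalerDl -scalerA.
    exact: (proj2 sG _ (_,_) (_,_) (h'P _ Ir) (h'P _ Ir')).
  pose G' : set (M * Y) := [set t | exists p r, H p /\ t = p + (r *: b, r *: y0)].
  have HG' : H `<=` G'.
    move=> p Hp; exists p, 0; split=> //.
    by rewrite !scale0r; case: (p) => ??; apply: injective_projections; rewrite /= addr0.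
  have gG' : graph `|` G' = G'.
    by apply/seteqP; split=> t; [case=> // gt; apply: HG'; left|right].
  apply: (maxG G').
    split; first by move=> t Gt; apply: HG'; right.
    move=> /(_ (b, y0)) G'G; apply: nb; exists y0; right; apply: G'G.
    exists 0, 1; split; first by case: sG.
    by rewrite add0r !scale1r.
  rewrite /good gG'; split.
    split=> [|c _ _ [p [r [Hp ->]]] [p' [r' [Hp' ->]]]].
      by apply: HG'; case: sG.
    exists (c *: p + p'), (c * r + r'); split; first exact: (proj2 sG).
    apply: injective_projections; rewrite /= !scalerDr scalerDl -scalerA;
      by rewrite addrACA.
  move=> y [[x y'] [r [Hp e]]]; move: (congr1 fst e) (congr1 snd e) => /= e1 ->.
  have Hr : H (r *: b, - y').
    have -> : r *: b = - x by apply/eqP; rewrite -addr_eq0 addrC -e1.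
    exact: (submodN sG Hp).
  have Ir : I r by exists (- y').
  by rewrite -y0P // -(Hu _ _ _ Hr (h'P _ Ir)) subrr.
have [|c x y x' y' Hy Hy'|g gP] := @linear_of_rel R M Y (fun x y => H (x, y)) tot.
- exact: fG.
- exact: (proj2 sG _ (_,_) (_,_) Hy Hy').
exists g => x Sx; apply/eqP; rewrite -subr_eq0; apply/eqP/fG.
rewrite -[X in (X, _)](subrr x); apply: (submodB sG (gP x) (_ : H (x, h x))).
by left.
Qed.

End Extension.

Lemma baer Y : (forall I, ideal I -> extI I Y) -> injective_module Y.
Proof.
move=> ext A B i f ii.
have [|h hP] := @choice B Y (fun x y => forall a, i a = x -> y = f a).
  move=> x; have [[a <-]|n] := pselect (exists a, i a = x).
    by exists (f a) => a' /ii ->.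
  by exists 0 => a e; case: n; exists a.
have hi a : h (i a) = f a by apply: hP.
have [|g gP] := baer_extension (im_submod i) (h := h) _ ext.
  by move=> c _ _ [a <-] [a' <-]; rewrite -linearP !hi linearP.
by exists g => x; rewrite gP ?hi //; exists x.
Qed.

Lemma injective_extI Y I : ideal I -> injective_module Y -> extI I Y.
Proof.
move=> hI iY h lh.
have [K [k [ik kP]]] := exists_submodule (ideal_submod hI).
have Ik y : I (k y) by apply/kP; exists y.
have lhk : linear (h \o k) by move=> c x y; rewrite /= linearP lh.
have [g gP] := iY _ _ k (mk_linear lhk) ik.
exists (g 1) => a Ia; have [y ya] := (kP a).1 Ia.
by rewrite -linearZ /= -[a *: 1]/(a * 1) mulr1 -ya gP.
Qed.

End Baer.

(** * Divisible abelian groups and an injective cogenerator *)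

Section Divisible.
Implicit Type Y : lmodType int.

Lemma int_ideal (I : set int) : ideal I ->
  exists n : nat, I n%:Z /\ forall a, I a -> exists q, a = q * n%:Z.
Proof.
move=> hI; have IZ c x : I x -> I (c * x).
  by move=> Ix; rewrite -[_ * _]addr0; apply: (proj2 hI) => //; case: hI.
have [[n0 [n0P In0]]|none] := pselect (exists n : nat, (0 < n)%N /\ I n%:Z).
  pose Q := [pred n : nat | (0 < n)%N && `[< I n%:Z >]].
  have exQ : exists n, Q n by exists n0; rewrite /= n0P; apply/asboolP.
  case: (ex_minnP exQ) => n /andP[n_gt0 /asboolP In] nmin.
  exists n; split=> // a Ia; exists (a %/ n%:Z)%Z.
  have n0' : n%:Z != 0 by rewrite eqz_nat -lt0n.
  have Ir : I (a %% n%:Z)%Z.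
    rewrite /modz addrC -mulNr; exact: (proj2 hI).
  have := ltz_mod a n0'; have := modz_ge0 a n0'.
  case: (a %% n)%Z Ir (divz_eq a n%:Z) => // r Ir aE _.
  rewrite ger0_norm // ltz_nat => rn.
  have [r0|r0] := posnP r; first by rewrite aE r0 addr0 mulzK.
  have /nmin : Q r by rewrite /= r0; apply/asboolP.
  by rewrite leqNgt rn.
exists 0%N; split; first by case: hI.
move=> a Ia; exists 0; rewrite mul0r; apply/eqP; apply: contrapT => /negP a0.
apply: none; exists `|a|%N; split; first by rewrite absz_gt0.
rewrite abszE normrEsg; exact: IZ.
Qed.

Lemma divisible_injective Y :
    (forall (n : nat) (y : Y), (0 < n)%N -> exists y', n%:Z *: y' = y) ->
  injective_module Y.
Proof.
move=> div; apply: baer => I hI h lh.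
have [n [In nP]] := int_ideal hI.
have hZ c x : I x -> h (c * x) = c *: h x.
  move=> Ix; have := lh c x 0 Ix (proj1 hI).
  by rewrite addr0 (lin_on0 (ideal_submod hI) lh) addr0.
have [n0|n0] := posnP n.
  exists 0 => a /nP[q ->]; rewrite n0 mulr0 scale0r.
  exact: lin_on0 (ideal_submod hI) lh.
have [y yP] := div n (h n%:Z) n0.
by exists y => a /nP[q ->]; rewrite hZ // -yP scalerA.
Qed.

(** D is Q/Z. A character of the cyclic group generated by m sends m to 1/d, and extends because D
    is injective. *)
Lemma exists_cogenerator : exists D : lmodType int,
  injective_module D /\
  forall (M : lmodType int) (m : M), m <> 0 ->
    exists f : {linear M -> D}, f m <> 0.
Proof.
pose Z : set (zmodule rat) := [set x : rat | x \is a Num.int].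
have hZ : submod Z.
  split=> [|c x y /= hx hy]; first exact: rpred0.
  by apply: rpredD => //; apply: rpredMz.
have [D [q [sq qP]]] := exists_quotient hZ.
have iD : injective_module D.
  apply: divisible_injective => n y n0; have [x <-] := sq y.
  exists (q ((x : rat) / n%:R : rat)); rewrite -linearZ; congr (q _).
  have n0' : n%:R != 0 :> rat by rewrite pnatr_eq0 -lt0n.
  suff : ((x : rat) / n%:R) *~ n%:Z = x :> rat by [].
  by rewrite -pmulrn -[(_ / _) *+ _]mulr_natr divfK.
exists D; split=> // M m m0.
have hI : ideal [set k : int | k *: m = 0].
  split=> [|c x y /= ex ey] /=; first by rewrite scale0r.
  by rewrite scalerDl -scalerA ex ey scaler0 addr0.
have [n [nm nP]] := int_ideal hI.
(* If m has infinite order, [n] is 0 and any d > 1 serves; 2 is taken. *)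
have [d [d1 dP]] : exists d : nat, (1 < d)%N /\
    forall a : int, a *: m = 0 -> exists q, a = q * d%:Z.
  case: (n) nm nP => [|[|d]] /= nm nP; last by exists d.+2.
  - exists 2%N; split=> // a /nP[p ->]; exists 0; by rewrite mulr0 mul0r.
  - by case: m0; rewrite -[m]scale1r.
have d0 : d%:R != 0 :> rat by rewrite pnatr_eq0 -lt0n ltnW.
pose chi (k : int) : D := q (k%:~R / d%:R : rat).
have chiP c k l : chi (c * k + l) = c *: chi k + chi l.
  rewrite /chi -linearP /=; congr (q _).
  suff : ((c * k + l)%:~R / d%:R = (k%:~R / d%:R) *~ c + l%:~R / d%:R :> rat) by [].
  by rewrite rmorphD rmorphM mulrDl /= -mulrA mulrzl.
have chi0 k : k *: m = 0 -> chi k = 0.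
  move=> /dP[p ->]; apply/qP; rewrite /Z /= rmorphM /= mulfK //.
have chi1 : chi 1 <> 0.
  move=> /(qP _).1 /=; rewrite mul1r; case/intrP=> p pE.
  have : p * d%:Z = 1.
    by apply/eqP; rewrite -(eqr_int rat) rmorphM /= -pE mulVf.
  move=> /(congr1 absz); rewrite abszM /= => /eqP; rewrite muln_eq1 => /andP[_ /eqP e].
  by rewrite e in d1.
have [|h hP] := @choice M D (fun x y => forall k : int, k *: m = x -> y = chi k).
  move=> x; have [[k <-]|n'] := pselect (exists k : int, k *: m = x); last first.
    by exists 0 => k e; case: n'; exists k.
  exists (chi k) => l lk; apply/eqP; rewrite -subr_eq0; apply/eqP.
  have := chi0 (k - l); rewrite scalerBl lk subrr => /(_ erefl).
  by have := chiP (-1) l k; rewrite mulN1r scaleN1r addrC => ->; rewrite addrC.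
have hk k : h (k *: m) = chi k by apply: hP.
have [|||g gP] := @baer_extension _ M D [set x | exists k : int, k *: m = x] h.
- split=> [|c _ _ [k <-] [l <-]]; first by exists 0; rewrite scale0r.
  by exists (c * k + l); rewrite scalerDl scalerA.
- by move=> c _ _ [k <-] [l <-]; rewrite !hk -chiP scalerA -scalerDl hk.
- by move=> I hI'; apply: injective_extI.
exists g; rewrite gP -[m]scale1r ?hk //; by exists 1; rewrite scale1r.
Qed.

End Divisible.

Section Coextension.
Variables (R : comNzRingType) (D : lmodType int) (S : Type).

Let F : lmodType int := S -> R -> D.
Let addS : set F := [set f | forall s x y, f s (x + y) = f s x + f s y].

Let addSP : submod addS.
Proof.
split=> [s x y|c f g hf hg s x y]; first by rewrite -[RHS]/((0 : D) + 0) addr0.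
rewrite -![(c *: f + g) _ _]/(c *: f _ _ + g _ _) hf hg scalerDr.
exact: addrACA.
Qed.

(* The coextension Hom_Z(R, D)^S with R acting through the source. *)
Lemma exists_coextension : exists (J : lmodType R) (k : J -> S -> R -> D),
  [/\ injective k,
      forall x y s r, k (x + y) s r = k x s r + k y s r,
      forall a x s r, k (a *: x) s r = k x s (r * a),
      forall x s, {morph k x s : a b / a + b}
    & forall f : S -> R -> D, (forall s, {morph f s : a b / a + b}) ->
        exists x, k x = f].
Proof.
have [K [k [ik kP]]] := exists_submodule addSP.
have kD x s a b : k x s (a + b) = k x s a + k x s b.
  by have /kP : exists y, k y = k x by exists x.
have [sc scP] : exists sc : R -> K -> K,
    forall a x s r, k (sc a x) s r = k x s (r * a).
  have [|sc scP] := @choice (R * K)%type K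
      (fun ax y => forall s r, k y s r = k ax.2 s (r * ax.1)).
    move=> [a x] /=; have /kP[y yP] : addS (fun s r => k x s (r * a)).
      by move=> s r r'; rewrite /= mulrDl kD.
    by exists y => s r; rewrite yP.
  by exists (fun a x => sc (a, x)) => a x s r; rewrite scP.
have kadd x y s r : k (x + y) s r = k x s r + k y s r by rewrite linearD.
have kext x y : (forall s r, k x s r = k y s r) -> x = y.
  by move=> e; apply: ik; apply/funext => s; apply/funext => r.
have scA a b x : sc a (sc b x) = sc (a * b) x.
  by apply: kext => s r; rewrite !scP mulrA.
have sc1 : left_id 1 sc by move=> x; apply: kext => s r; rewrite scP mulr1.
have scDr : right_distributive sc +%R.
  by move=> a x y; apply: kext => s r; rewrite !(scP, kadd).
have scDl x : {morph sc^~ x : a b / a + b}.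
  by move=> a b; apply: kext => s r; rewrite kadd !scP mulrDr kD.
pose zK : zmodType := K.
pose J : lmodType R := HB.pack (GRing.Zmodule.sort zK) zK
  (GRing.Zmodule_isLmodule.Build R zK scA sc1 scDr scDl).
exists J, k; split=> // [f fD].
have /kP[y yP] : addS f by move=> s x y; apply: fD.
by exists y.
Qed.

End Coextension.

(** * Embedding a module into an injective one *)

Section EnoughInjectives.
Variable R : comNzRingType.

Lemma additive_linear_int (U : zmodType) (V : lmodType int) (f : zmodule U -> V) :
  {morph f : x y / x + y} -> linear f.
Proof.
move=> fD c x y.
have f0 : f 0 = 0 by apply: (addIr (f 0)); rewrite -fD !add0r.
have fM : zmod_morphism (f : U -> V).
  move=> u v; apply: (addIr (f v)); rewrite -fD (subrK v u).
  exact/esym/(@subrK V).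
pose g : {additive U -> V} := HB.pack (f : U -> V) (GRing.isZmodMorphism.Build U V f fM).
have gZ n (u : U) : g (u *~ n) = n *: g u by rewrite raddfMz -scaler_int intz.
rewrite fD; congr (_ + _); exact: gZ.
Qed.

Lemma linear_int_scale (M : lmodType R) (D : lmodType int)
    (s : {linear zmodule M -> D}) (m : M) :
  {morph (fun r : R => s (r *: m)) : a b / a + b}.
Proof. by move=> a b; rewrite scalerDl; apply: linearD. Qed.

(** J is Hom_Z(R, D)^S with S the set of all characters M -> D, and m goes to the functions r |-> s
    (r m). Evaluation at 1 identifies R-linear maps into J with families of additive maps into D, so
    J inherits injectivity from D; the characters separate points. *)
Lemma enough_injectives (M : lmodType R) :
  exists (J : lmodType R) (j : {linear M -> J}), injective_module J /\ injective j.
Proof.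
have [D [iD cogD]] := exists_cogenerator.
pose S := {linear zmodule M -> D}.
have [J [k [ik kadd ksc kD kP]]] := exists_coextension R D S.
have kext x y : (forall s r, k x s r = k y s r) -> x = y.
  by move=> e; apply: ik; apply/funext => s; apply/funext => r.
exists J.
have [j0 j0P] := choice (fun m : M => kP _ (fun s => linear_int_scale s m)).
have lj : linear j0.
  move=> c x y; apply: kext => s r.
  by rewrite kadd ksc !j0P scalerDr scalerA linearD.
exists (mk_linear lj); split.
  move=> A B i f ii.
  have [|g gP] := @choice S {linear zmodule B -> D}
      (fun s g => forall a, g (i a) = k (f a) s 1).
    move=> s.
    have li : linear (i : zmodule A -> zmodule B).
      by apply: additive_linear_int => x y; rewrite -linearD.
    have lf : linear (fun a : zmodule A => k (f a) s 1).
      by apply: additive_linear_int => x y; rewrite -kadd -linearD.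
    exact: (iD _ _ (mk_linear li) (mk_linear lf) ii).
  have [u uP] := choice (fun b : B => kP _ (fun s => linear_int_scale (g s) b)).
  have lu : linear u.
    move=> c x y; apply: kext => s r.
    by rewrite kadd ksc !uP scalerDr scalerA linearD.
  exists (mk_linear lu) => a; apply: kext => s r /=.
  by rewrite uP -linearZ gP linearZ ksc mul1r.
apply: inj0P => m /= jm; apply: contrapT => m0.
have [s sm] := cogD (zmodule M) m m0; apply: sm.
have := congr1 (fun h => h s 1) (j0P m); rewrite scale1r => <-.
rewrite jm; apply: (addIr (k 0 s 1)).
by rewrite -kadd !add0r.
Qed.

(** As with [projective_cover], the embedding need not be essential, but trivial modules stay
    trivial. *)
Lemma injective_hull (M : lmodType R) :
  exists (J : lmodType R) (j : {linear M -> J}),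
    [/\ injective_module J, injective j & trivial_module M -> trivial_module J].
Proof.
have [tM|ntM] := pselect (trivial_module M).
  exists (zero_module R), \0; split=> [A B p f sp|x y _|_].
  - by exists \0 => x; rewrite [RHS]zero_module_trivial.
  - by rewrite [x]tM [y]tM.
  - exact: zero_module_trivial.
have [J [j [iJ ij]]] := enough_injectives M.
by exists J, j.
Qed.

End EnoughInjectives.

(** * Noetherian rings *)

Section Noetherian.
Variable R : comNzRingType.
Hypothesis R_noetherian : noetherian R.
Implicit Types I J P Q : set R.

Definition adjoin I (a : R) : set R := [set x | exists g r, I g /\ x = g + r * a].
Definition colon I (a : R) : set R := [set r | I (r * a)].
Definition primeI P := [/\ ideal P, ~ P 1 & forall a b, P (a * b) -> P a \/ P b].

Lemma idealZ I c x : ideal I -> I x -> I (c * x).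
Proof. by move=> [I0 h] Ix; rewrite -[_ * _]addr0; apply: h. Qed.
Lemma idealD I x y : ideal I -> I x -> I y -> I (x + y).
Proof. by move=> [I0 h] Ix Iy; rewrite -[x]mul1r; apply: h. Qed.
Lemma idealN I x : ideal I -> I x -> I (- x).
Proof. by move=> hI Ix; rewrite -mulN1r; apply: idealZ. Qed.
Lemma idealB I x y : ideal I -> I x -> I y -> I (x - y).
Proof. by move=> hI Ix Iy; apply: idealD => //; apply: idealN. Qed.

Lemma adjoin_ideal I a : ideal I -> ideal (adjoin I a).
Proof.
move=> hI; split=> [|c _ _ [g [r [Ig ->]]] [g' [r' [Ig' ->]]]].
  by exists 0, 0; rewrite mul0r addr0; split=> //; case: hI.
exists (c * g + g'), (c * r + r'); split; first exact: (proj2 hI).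
by rewrite mulrDr mulrDl mulrA addrACA.
Qed.

Lemma adjoin_sub I a : I `<=` adjoin I a.
Proof. by move=> x Ix; exists x, 0; rewrite mul0r addr0. Qed.

Lemma adjoin_gen I a : ideal I -> adjoin I a a.
Proof. by move=> [I0 _]; exists 0, 1; rewrite mul1r add0r. Qed.

Lemma colon_ideal I a : ideal I -> ideal (colon I a).
Proof.
move=> hI; split=> [|c x y]; rewrite /colon /=; first by rewrite mul0r; case: hI.
by rewrite mulrDl -mulrA; apply: (proj2 hI).
Qed.

Lemma colon_sub I a : ideal I -> I `<=` colon I a.
Proof. by move=> hI x Ix; rewrite /colon /= mulrC; apply: idealZ. Qed.

Lemma idealr_closed_asbool I :
  ideal I -> ~ I 1 -> idealr_closed ([pred x | `[< I x >]] : {pred R}).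
Proof.
move=> [I0 hI] I1; split; first exact/asboolP.
  by apply/negP => /asboolP.
by move=> a u v /asboolP Iu /asboolP Iv; apply/asboolP/hI.
Qed.

Lemma ideal_idealr_closed (S : {pred R}) : idealr_closed S -> ideal [set x | x \in S].
Proof. by case=> S0 _ h; split=> // c x y; apply: h. Qed.

Lemma ideal_fg I : ideal I -> exists n (g : 'I_n -> R),
  forall x, I x <-> exists c : 'I_n -> R, x = \sum_i c i * g i.
Proof.
move=> hI; have [I1|I1] := pselect (I 1).
  exists 1%N, (fun _ => 1) => x; split=> [_|_].
    by exists (fun _ => x); rewrite big_ord1 mulr1.
  by rewrite -[x]mulr1; apply: idealZ.
have [n [g gP]] := R_noetherian (idealr_closed_asbool hI I1).
exists n, g => x; apply: iff_trans (gP x).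
by split=> [Ix|]; [apply/asboolP|move/asboolP].
Qed.

Lemma noetherian_max (F : set (set R)) :
    (exists I, F I) -> (forall I, F I -> ideal I) ->
  exists I, F I /\ forall I', F I' -> I `<=` I' -> I' `<=` I.
Proof.
move=> [I0 FI0] Fid.
have [|I [[I_0|FI] Imax]] := @Zorn_bigcup R [set I | I = set0 \/ F I].
- move=> X XF tot.
  have [[I1 [XI1 FI1]]|none] := pselect (exists I, X I /\ F I); last first.
    left; apply/seteqP; split=> // x [I XI Ix].
    have [I_0|FI] := XF _ XI; first by rewrite I_0 in Ix.
    by case: none; exists I.
  right.
  pose U := \bigcup_(I in X) I.
  have two x y : U x -> U y -> exists I, [/\ X I, I x & I y].
    move=> [I XI Ix] [J XJ Jy]; have [IJ|JI] := tot _ _ XI XJ.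
      by exists J; split=> //; apply: IJ.
    by exists I; split=> //; apply: JI.
  have XFx I x : X I -> I x -> F I.
    by move=> /XF[->|].
  have hU : ideal U.
    split=> [|c x y Ux Uy]; first by exists I1 => //; case: (Fid _ FI1).
    have [I [XI Ix Iy]] := two _ _ Ux Uy; exists I => //.
    exact: (proj2 (Fid _ (XFx _ _ XI Ix))).
  have [n [g gP]] := ideal_fg hU.
  have [I [XI FI gI]] : exists I, [/\ X I, F I & forall i, I (g i)].
    have Ug i : U (g i).
      apply/gP; exists (fun j => (j == i)%:R); rewrite (bigD1 i) //= eqxx mul1r.
      by rewrite big1 ?addr0 // => j /negPf ->; rewrite mul0r.
    (* The union is finitely generated, and its generators enter the chain one by one, so a single
       member contains them all. *)
    have : forall k : nat, exists I, [/\ X I, F I & forall i : 'I_n, (i < k)%N -> I (g i)].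
      elim=> [|k [I [XI FI IP]]]; first by exists I1.
      have [kn|nk] := ltnP k n; last first.
        exists I; split=> // i _; apply: IP; exact: leq_trans (ltn_ord i) nk.
      have [J XJ Jg] := Ug (Ordinal kn).
      have [IJ|JI] := tot _ _ XI XJ.
        exists J; split=> //; first exact: XFx XJ Jg.
        move=> i; rewrite ltnS leq_eqVlt => /orP[/eqP ik|/IP /IJ //].
        by have -> : i = Ordinal kn by apply: val_inj.
      exists I; split=> // i; rewrite ltnS leq_eqVlt => /orP[/eqP ik|/IP //].
      by apply: JI; have -> : i = Ordinal kn by apply: val_inj.
    by move=> /(_ n)[I [XI FI IP]]; exists I; split=> // i; apply: IP.
  suff UI : U = I by rewrite -/U UI.
  apply/seteqP; split=> [x /gP[c ->]|x Ix]; last by exists I.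
  elim/big_rec: _ => [|i y _ Iy]; first by case: (Fid _ FI).
  exact: (proj2 (Fid _ FI)).
- case: (Imax I0); last by right.
  by rewrite I_0; split=> // /(_ 0) /(_ (proj1 (Fid _ FI0))).
- exists I; split=> // I' FI' II'; apply: contrapT => nI'I.
  by apply: (Imax I'); [split|right].
Qed.

Lemma noetherian_ind (P : set R -> Prop) :
    (forall I, ideal I -> (forall I', ideal I' -> I `<` I' -> P I') -> P I) ->
  forall I, ideal I -> P I.
Proof.
move=> step I hI; apply: contrapT => nPI.
have [||J [[hJ nPJ] Jmax]] := @noetherian_max [set J | ideal J /\ ~ P J].
- by exists I; split.
- by move=> J [].
- apply: nPJ; apply: step => // J' hJ' [JJ' nJ'J]; apply: contrapT => nPJ'.
  by apply: nJ'J; apply: Jmax.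
Qed.

(** An ideal maximal among those that contain I and miss S is prime: for a and b outside, both
    enlarged ideals meet S, and the product of the two elements would put a b outside as well. *)
Lemma exists_prime_disjoint I (S : set R) :
    ideal I -> S 1 -> (forall a b, S a -> S b -> S (a * b)) ->
    (forall x, I x -> ~ S x) ->
  exists Q, [/\ primeI Q, I `<=` Q & forall x, Q x -> ~ S x].
Proof.
move=> hI S1 SM IS.
have [||Q [[hQ IQ QS] Qmax]] :=
  @noetherian_max [set Q | [/\ ideal Q, I `<=` Q & forall x, Q x -> ~ S x]].
- by exists I; split.
- by move=> J [].
exists Q; split=> //; split=> // [/QS //|a b Qab].
apply: contrapT => /not_orP[na nb].
have meet c : ~ Q c -> exists g r, Q g /\ S (g + r * c).
  move=> nc; apply: contrapT => no; apply: nc.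
  apply: (Qmax (adjoin Q c)); last exact: adjoin_gen.
    split; first exact: adjoin_ideal.
      by move=> x Ix; apply: adjoin_sub; apply: IQ.
    by move=> x [g [r [Qg ->]]] Sx; apply: no; exists g, r.
  exact: adjoin_sub.
have [g [r [Qg Sa]]] := meet _ na; have [g' [r' [Qg' Sb]]] := meet _ nb.
apply: QS (SM _ _ Sa Sb); rewrite mulrDl !mulrDr.
apply: idealD => //; apply: idealD => //.
- exact: idealZ.
- by rewrite mulrC; apply: idealZ.
- exact: idealZ.
- by rewrite mulrACA; apply: idealZ.
Qed.

Lemma not_prime_witness I : ideal I -> ~ I 1 -> ~ primeI I ->
  exists a b, [/\ I (a * b), ~ I a & ~ I b].
Proof.
move=> hI I1 nP; apply: contrapT => no; apply: nP; split=> // a b Iab.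
by apply: contrapT => /not_orP[na nb]; apply: no; exists a, b.
Qed.

Section Avoidance.
Variables (P : R -> set R) (m : set R).
Hypothesis hm : ideal m.

Lemma prime_meet (s : seq R) Q : primeI Q ->
    (forall y, y \in s -> ideal (P y) /\ exists2 e, P y e & ~ Q e) ->
  exists2 e, (forall y, y \in s -> P y e) & ~ Q e.
Proof.
move=> [hQ Q1 Qp]; elim: s => [|y s IH] h; first by exists 1.
have [|e es Qe] := IH; first by move=> z zs; apply: h; rewrite inE zs orbT.
have [hy [f yf Qf]] := h y (mem_head _ _).
exists (e * f); last by move=> /Qp[].
move=> z; rewrite inE => /orP[/eqP ->|zs]; first exact: idealZ.
have zys : z \in y :: s by rewrite inE zs orbT.
by rewrite mulrC; apply: idealZ; [case: (h z zys)|apply: es].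
Qed.

(** The primes are incomparable unless equal. So if x falls into P z, some e lies in all the other P
    y but not in P z, and x + f e with f in m outside P z avoids them all. *)
Lemma prime_avoidance (s : seq R) :
    (forall y, y \in s -> primeI (P y)) ->
    (forall y z, y \in s -> z \in s -> P y `<=` P z -> P z `<=` P y) ->
    (forall y, y \in s -> exists2 e, m e & ~ P y e) ->
  exists2 x, m x & forall y, y \in s -> ~ P y x.
Proof.
elim: s => [|z s IH] ps incomp nm; first by exists 0 => //; case: hm.
have [|||x mx xs] := IH.
- by move=> y ys; apply: ps; rewrite inE ys orbT.
- by move=> y y' ys ys'; apply: incomp; rewrite inE ?ys ?ys' orbT.
- by move=> y ys; apply: nm; rewrite inE ys orbT.
have hz : primeI (P z) by apply: ps; apply: mem_head.
have [Pzx|nPzx] := pselect (P z x); last first.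
  by exists x => // y; rewrite inE => /orP[/eqP ->|/xs].
have [[y ys yz]|none] := pselect (exists2 y, y \in s & P y `<=` P z).
  have zy := incomp y z; case: (xs y ys); apply: zy => //; rewrite inE ?eqxx //.
  by rewrite ys orbT.
have [|e es Pze] := prime_meet (s := s) hz.
  move=> y ys; split; first by case: (ps y); rewrite // inE ys orbT.
  apply: contrapT => no; apply: none; exists y => // t Pyt.
  by apply: contrapT => nt; apply: no; exists t.
have [f mf Pzf] := nm z (mem_head _ _).
exists (x + f * e); first by apply: idealD => //; rewrite mulrC; apply: idealZ.
have [hPz _ pz] := hz.
move=> y; rewrite inE => /orP[/eqP ->|ys] h.
  have : P z (f * e) by rewrite -[f * e](addKr x); apply: idealD => //; apply: idealN.
  by case/pz.
apply: (xs y ys); rewrite -[x](addrK (f * e)); have [hPy _ _] : primeI (P y).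
  by apply: ps; rewrite inE ys orbT.
by apply: idealB => //; apply: idealZ => //; apply: es.
Qed.

End Avoidance.

Lemma colonM I a b : ideal I -> colon I b `<=` colon I (a * b).
Proof.
by move=> hI r; rewrite /colon /= mulrCA => h; apply: idealZ.
Qed.

(* Depth zero is detected by a single element: finitely many maximal
   annihilators cover the zero divisors, so prime avoidance applies. *)
Lemma socle_element J (m : set R) : ideal J -> ideal m ->
    (forall x, m x -> exists2 y, ~ J y & J (x * y)) ->
  exists2 y, ~ J y & m `<=` colon J y.
Proof.
move=> hJ hm zd.
pose Mx y := ~ J y /\ forall y', ~ J y' -> colon J y `<=` colon J y' ->
  colon J y' `<=` colon J y.
have Mprime y : Mx y -> primeI (colon J y).
  move=> [nJy ymax]; split; first exact: colon_ideal.
    by rewrite /colon /= mul1r.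
  move=> a b ab; have [Jb|Jb] := pselect (colon J y b); first by right.
  left; apply: (ymax (b * y) Jb (colonM _ hJ)).
  by rewrite /colon /= mulrA.
have Mabove y : ~ J y -> exists2 z, Mx z & colon J y `<=` colon J z.
  move=> nJy; have [||_ [[z [nJz yz] ->] zmax]] := @noetherian_max
      [set K | exists2 z, (~ J z /\ colon J y `<=` colon J z) & K = colon J z].
  - by exists (colon J y), y; [split|].
  - by move=> _ [z _ ->]; apply: colon_ideal.
  exists z => //; split=> // y' nJy' zy'; apply: zmax => //.
  by exists y' => //; split=> // t /yz/zy'.
pose gen (s : seq R) := foldr (fun y I => adjoin I y) J s.
have hgen s : ideal (gen s) by elim: s => //= y s; apply: adjoin_ideal.
(* Among the ideals generated by J and finitely many elements with maximal annihilator modulo J, a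
   maximal one contains all such elements. *)
have [||_ [[s sM ->] smax]] := @noetherian_max
    [set K | exists2 s : seq R, (forall y, y \in s -> Mx y) & K = gen s].
- by exists J, [::].
- by move=> _ [s _ ->].
(* Otherwise primality of [colon J y] yields an e that multiplies all of s into J but not y,
   although y lies in the ideal generated by J and s. *)
have cover y : Mx y -> exists2 z, z \in s & colon J z `<=` colon J y.
  move=> My; apply: contrapT => no.
  have [|e es ney] := prime_meet (P := colon J) (s := s) (Mprime y My).
    move=> z zs; split; first exact: colon_ideal.
    apply: contrapT => no'; apply: no; exists z => // t zt.
    by apply: contrapT => nt; apply: no'; exists t.
  apply: ney; have : gen s y.
    apply: (smax (gen (y :: s))); last exact: adjoin_gen.
      by exists (y :: s) => // z; rewrite inE => /orP[/eqP ->|/sM].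
    exact: adjoin_sub.
  rewrite /colon /=; elim: (s) es (y) => [|z t IH] es x /=; first exact: idealZ.
  move=> [g [r [gt ->]]]; rewrite mulrDr; apply: idealD => //.
    by apply: IH => // u ut; apply: es; rewrite inE ut orbT.
  by rewrite mulrCA; apply: idealZ => //; apply: (es z (mem_head _ _)).
apply: contrapT => no.
have [|||x mx xs] := @prime_avoidance (colon J) m hm s.
- by move=> y /sM/Mprime.
- by move=> y z ys zs; have [_ h] := sM _ ys; apply: h; case: (sM _ zs).
- move=> y /sM[nJy _]; apply: contrapT => no'; apply: no; exists y => // t mt.
  by apply: contrapT => nt; apply: no'; exists t.
have [y nJy xy] := zd x mx; have [z Mz yz] := Mabove y nJy.
have [w ws wz] := cover z Mz; apply: (xs w ws).
have [_ h] := sM w ws; apply: (h z _ wz); first by case: Mz.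
exact: yz.
Qed.

End Noetherian.

(** * Free resolutions by matrices *)

Section Matrices.
Variable R : comNzRingType.
Implicit Types A C E J K M X Y : lmodType R.

Fixpoint span M (s : seq M) : set M :=
  if s is v :: s' then [set x | exists c y, span s' y /\ x = c *: v + y]
  else [set 0].

Lemma span_submod M (s : seq M) : submod (span s).
Proof.
elim: s => [|v s IH]; first by split=> // c x y /= -> ->; rewrite scaler0 addr0.
split=> [|c _ _ [k [y [sy ->]]] [k' [y' [sy' ->]]]].
  by exists 0, 0; rewrite scale0r addr0; split=> //; case: IH.
exists (c * k + k'), (c *: y + y'); split; first exact: (proj2 IH).
by rewrite scalerDr scalerDl scalerA addrACA.
Qed.

Lemma span_min M (s : seq M) (S : set M) :
  submod S -> (forall v, v \in s -> S v) -> span s `<=` S.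
Proof.
move=> hS; elim: s => [|v s IH] h x /=; first by move=> ->; case: hS.
move=> [c [y [sy ->]]]; apply: (proj2 hS); first by apply: h; apply: mem_head.
by apply: IH => // w ws; apply: h; rewrite inE ws orbT.
Qed.

Lemma span_mem M (s : seq M) v : v \in s -> span s v.
Proof.
elim: s => //= w s IH; rewrite inE => /orP[/eqP <-|/IH sv].
  by exists 1, 0; rewrite scale1r addr0; split=> //; case: (span_submod s).
by exists 0, v; rewrite scale0r add0r.
Qed.

Lemma span_sum n M (g : 'I_n -> M) x :
  span [seq g i | i <- enum 'I_n] x -> exists c : 'I_n -> R, x = \sum_i c i *: g i.
Proof.
pose S : set M := [set x | exists c : 'I_n -> R, x = \sum_i c i *: g i].
apply: (@span_min _ _ S) => [|_ /mapP[i _ ->]].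
  split=> [|c _ _ [k ->] [l ->]].
    by exists (fun=> 0); rewrite big1 // => i _; rewrite scale0r.
  exists (fun i => c * k i + l i); rewrite scaler_sumr -big_split /=.
  by apply: eq_bigr => i _; rewrite scalerDl scalerA.
exists (fun j => (j == i)%:R); rewrite (bigD1 i) //= eqxx scale1r big1 ?addr0 //.
by move=> j /negPf ->; rewrite scale0r.
Qed.

Definition noetherian_module M : Prop :=
  forall S : set M, submod S -> exists s : seq M, S = span s.

Lemma noetherian_module_ses K X A (k : {linear K -> X}) (p : {linear X -> A}) :
    ses k p -> noetherian_module K -> noetherian_module A ->
  noetherian_module X.
Proof.
move=> [ik sp kerp] nK nA S hS.
have [|s sE] := nK [set y | S (k y)].
  split=> [|c x y /=]; first by rewrite /= linear0; case: hS.
  by rewrite linearP; apply: (proj2 hS).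
have [|t tE] := nA [set a | exists x, S x /\ p x = a].
  split=> [|c _ _ [x [Sx <-]] [y [Sy <-]]].
    by exists 0; rewrite linear0; split=> //; case: hS.
  by exists (c *: x + y); rewrite linearP; split=> //; apply: (proj2 hS).
have [|l lP] := @choice A X (fun a x => a \in t -> S x /\ p x = a).
  move=> a; have [at_|nt] := boolP (a \in t); last by exists 0.
  have [x xa] : [set a | exists x, S x /\ p x = a] a by rewrite tE; apply: span_mem.
  by exists x.
exists (map l t ++ map k s); apply/seteqP; split=> [x Sx|x]; last first.
  apply: (span_min hS) => v; rewrite mem_cat => /orP[] /mapP[w ws ->].
    by have [] := lP _ ws.
  have : span s w by apply: span_mem.
  by rewrite -sE.
have : span t (p x) by rewrite -tE; exists x.
elim: (t) lP x Sx => [|a r IH] lP x Sx /=.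
  move=> /kerp[y yx]; rewrite -yx in Sx *.
  have : span s y by rewrite -sE.
  elim: (s) y {yx Sx} => [|v q IH] y /=; first by move=> ->; rewrite linear0.
  by move=> [c [z [/IH kz ->]]]; exists c, (k z); rewrite linearP.
move=> [c [b [rb pxE]]].
have [Sl pl] := lP a (mem_head _ _).
exists c, (x - c *: l a); split; last by rewrite addrC subrK.
apply: IH; first by move=> u ur; apply: lP; rewrite inE ur orbT.
  by apply: submodB => //; apply: submodZ.
by rewrite linearB linearZ pl pxE addrC addKr.
Qed.

Lemma noetherian_vectors n : noetherian R -> noetherian_module ('I_n -> R^o : lmodType R).
Proof.
move=> nR; elim: n => [|n IH].
  move=> S [S0 _]; exists [::]; apply/seteqP; split=> [x _|x /= ->//].
  by rewrite /=; apply/funext => -[].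
have nR1 : noetherian_module R^o.
  move=> S hS; have [k [g gP]] := ideal_fg nR hS.
  exists [seq g i | i <- enum 'I_k]; apply/seteqP; split=> x.
    move=> /gP[c ->].
    apply: (@submod_sum R R^o _ _ _ _ (fun i => c i *: (g i : R^o))) => [|i _].
      exact: span_submod.
    apply: (submodZ (c i) (span_submod _)); apply: span_mem.
    by apply: map_f; rewrite mem_enum.
  by move=> /span_sum[c cE]; apply/gP; exists c.
have l1 : linear (fun (f : 'I_n -> R^o) (i : 'I_n.+1) => oapp f 0 (unlift ord0 i)).
  move=> c f g; apply/funext => i.
  rewrite -[RHS]/(c *: oapp f 0 _ + oapp g 0 _).
  by case: (unlift ord0 i) => //=; rewrite scaler0 addr0.
have l2 : linear (fun f : 'I_n.+1 -> R^o => f ord0) by [].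
apply: (noetherian_module_ses (k := mk_linear l1) (p := mk_linear l2)) => //.
split=> [f g /= e|c|f].
- apply/funext => i; have := congr1 (fun h => h (lift ord0 i)) e.
  by rewrite /= liftK.
- by exists (fun=> c).
- split=> [/= f0|[g <-]]; last by rewrite /= unlift_none.
  exists (fun i => f (lift ord0 i)); apply/funext => i /=.
  by case: unliftP => [j ->|->].
Qed.

(** With an arbitrary module X of coefficients, the matrices of a complex give its tensor product
    with X, and their transposes give Hom into X. *)
Definition act X m n (A : 'M[R]_(m, n)) (x : 'I_n -> X) : 'I_m -> X :=
  fun i => \sum_j A i j *: x j.

Lemma act_linear X m n (A : 'M[R]_(m, n)) : linear (act A : ('I_n -> X) -> ('I_m -> X)).
Proof.
move=> c x y; apply/funext => i.
rewrite -[RHS]/(c *: (\sum_j A i j *: x j) + \sum_j A i j *: y j).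
rewrite scaler_sumr -big_split; apply: eq_bigr => j _ /=.
by rewrite -[(c *: x + y) j]/(c *: x j + y j) scalerDr !scalerA mulrC.
Qed.

Lemma actP X m n (A : 'M[R]_(m, n)) c (x y : 'I_n -> X) :
  act A (c *: x + y) = c *: act A x + act A y.
Proof. exact: act_linear. Qed.

Lemma act0 X m n (A : 'M[R]_(m, n)) : act A (0 : 'I_n -> X) = 0.
Proof.
by apply/funext => i; apply: big1 => j _; apply: scaler0.
Qed.

Lemma actB X m n (A : 'M[R]_(m, n)) (x y : 'I_n -> X) :
  act A (x - y) = act A x - act A y.
Proof. by rewrite addrC -scaleN1r actP scaleN1r addrC. Qed.

Lemma actM X m n p (A : 'M[R]_(m, n)) (B : 'M[R]_(n, p)) (x : 'I_p -> X) :
  act (A *m B) x = act A (act B x).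
Proof.
apply/funext => i; rewrite /act.
under eq_bigr do rewrite mxE scaler_suml.
rewrite exchange_big; apply: eq_bigr => j _ /=; rewrite scaler_sumr.
by apply: eq_bigr => k _; rewrite scalerA.
Qed.

Lemma act_mx0 X m n (x : 'I_n -> X) : act (0 : 'M[R]_(m, n)) x = 0.
Proof. by apply/funext => i; apply: big1 => j _; rewrite mxE scale0r. Qed.

Lemma act_map X Y m n (A : 'M[R]_(m, n)) (f : {linear X -> Y}) (x : 'I_n -> X) :
  act A (f \o x) = f \o act A x.
Proof.
apply/funext => i; rewrite /= linear_sum.
by apply: eq_bigr => j _; rewrite linearZ.
Qed.

(* x kills the homology of X^p -B-> X^q -A-> X^s; exactness is the case x = 0. *)
Definition divx (x : R) X s q p (A : 'M[R]_(s, q)) (B : 'M[R]_(q, p)) : Prop :=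
  forall v : 'I_q -> X, act A v = 0 ->
    exists v' w, act A v' = 0 /\ v = x *: v' + act B w.

Definition exact_at X s q p (A : 'M[R]_(s, q)) (B : 'M[R]_(q, p)) : Prop :=
  forall v : 'I_q -> X, act A v = 0 -> exists w, v = act B w.

Lemma exact_divx X s q p (A : 'M[R]_(s, q)) (B : 'M[R]_(q, p)) :
  divx 0 X A B <-> exact_at X A B.
Proof.
split=> h v Av.
  by have [v' [w [_ ->]]] := h v Av; exists w; rewrite scale0r add0r.
by have [w ->] := h v Av; exists 0, w; rewrite act0 scale0r add0r.
Qed.

Lemma lift_fun n X Y (f : {linear X -> Y}) (y : 'I_n -> Y) :
  surj f -> exists x : 'I_n -> X, f \o x = y.
Proof.
move=> sf; have [x xP] := choice (fun i => sf (y i)).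
by exists x; apply/funext => i /=.
Qed.

Lemma factor_fun n X Y A (f : {linear X -> Y}) (g : {linear Y -> A}) (y : 'I_n -> Y) :
  ses f g -> g \o y = 0 -> exists x, f \o x = y.
Proof.
move=> [_ _ kerg] gy; have [|x xP] := @choice 'I_n X (fun i x => f x = y i).
  by move=> i; apply/kerg; apply: (congr1 (fun h => h i) gy).
by exists x; apply/funext => i /=.
Qed.

(** * Matrix complexes along a short exact sequence of coefficients *)

Section Snake.
Variables (C J Y : lmodType R) (i : {linear C -> J}) (q : {linear J -> Y}).
Hypothesis iq : ses i q.
Variables (s t p o : nat).
Variables (A : 'M[R]_(s, t)) (B : 'M[R]_(t, p)) (D : 'M[R]_(p, o)).
Hypothesis AB0 : A *m B = 0.
Hypothesis BD0 : B *m D = 0.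

Let comp_inj n (u v : 'I_n -> C) : i \o u = i \o v -> u = v.
Proof.
case: iq => ii _ _ e; apply/funext => k; apply: ii.
exact: (congr1 (fun h => h k) e).
Qed.
Let comp0 n : i \o (0 : 'I_n -> C) = 0.
Proof. by apply/funext => k; apply: linear0. Qed.
Let qcomp0 n (u : 'I_n -> C) : q \o (i \o u) = 0.
Proof. by apply/funext => k; apply: (sesK _ iq). Qed.

(** As J is exact, the connecting map from the homology of Y between B and D to that of C between A
    and B is onto. It commutes with x, and so carries surjectivity of multiplication by x along. *)
Lemma snake_divx x : exact_at J A B -> divx x Y B D -> divx x C A B.
Proof.
move=> exJ divY v Av.
have [y yE] : exists y : 'I_p -> J, i \o v = act B y.
  by apply: exJ; rewrite act_map Av comp0.
have [y' [w [By' qy]]] : exists y' w, act B y' = 0 /\ q \o y = x *: y' + act D w.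
  by apply: divY; rewrite act_map -yE qcomp0.
have [_ sq _] := iq.
have [ly ly'] := lift_fun y' sq; have [lw lw'] := lift_fun w sq.
have [c cE] : exists c, i \o c = y - (x *: ly + act D lw).
  apply: (factor_fun iq); apply/funext => k.
  rewrite -[LHS]/(q (y k - (x *: ly k + act D lw k))).
  rewrite linearB linearD linearZ -[q (y k)]/((q \o y) k) qy -ly' -lw' act_map.
  by rewrite -[X in X - _]/(x *: q (ly k) + q (act D lw k)) subrr.
have [c' c'E] : exists c', i \o c' = act B ly.
  by apply: (factor_fun iq); rewrite -act_map ly'.
exists c', c; split.
  by apply: comp_inj; rewrite -act_map c'E -actM AB0 act_mx0 comp0.
apply: comp_inj; rewrite yE.
have -> : i \o (x *: c' + act B c) = x *: (i \o c') + (i \o act B c).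
  apply/funext => k; exact: linearP.
rewrite -act_map c'E cE -actP [X in _ = act B X](_ : _ = y - act D lw).
  by rewrite actB -[act B (act D lw)]actM BD0 act_mx0 subr0.
by rewrite opprD addrCA [X in _ + X]addrA subrr add0r.
Qed.

Lemma snake_exact : exact_at J A B -> exact_at Y B D -> exact_at C A B.
Proof. by move=> exJ /exact_divx exY; apply/exact_divx; apply: snake_divx. Qed.

Lemma snake_exact_rev : exact_at C A B -> exact_at J B D -> exact_at Y B D.
Proof.
move=> exC exJ y By; have [_ sq _] := iq.
have [u uE] := lift_fun y sq.
have [c cE] : exists c, i \o c = act B u.
  by apply: (factor_fun iq); rewrite -act_map uE.
have [c' c'E] : exists c', c = act B c'.
  by apply: exC; apply: comp_inj; rewrite -act_map cE -actM AB0 act_mx0 comp0.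
have [z zE] : exists z, u - (i \o c') = act D z.
  by apply: exJ; rewrite actB act_map -c'E cE subrr.
exists (q \o z); rewrite act_map -zE -uE; apply/funext => k.
by rewrite -[RHS]/(q (u k - i (c' k))) linearB (sesK _ iq) subr0.
Qed.

End Snake.

Definition unit_vec n (i : 'I_n) : 'I_n -> R^o := fun j => (j == i)%:R.

Lemma unit_vec_sum n (v : 'I_n -> R^o) : v = \sum_i v i *: unit_vec i.
Proof.
apply/funext => j.
have -> : (\sum_i v i *: unit_vec i) j = \sum_i v i * (j == i)%:R.
  elim/big_ind2: _ => // f a g b <- <- //.
rewrite (bigD1 j) //= eqxx mulr1 big1 ?addr0 // => i /negPf.
by rewrite eq_sym => ->; rewrite mulr0.
Qed.

(* Hom(-, E) is exact and turns B into its transpose. *)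
Lemma dual_exact E s q p (A : 'M[R]_(s, q)) (B : 'M[R]_(q, p)) :
  injective_module E -> exact_at R^o A B -> exact_at E B^T A^T.
Proof.
move=> iE ex x Bx.
have lphi : linear (fun v : 'I_q -> R^o => \sum_i v i *: x i).
  move=> c v w; rewrite scaler_sumr -big_split; apply: eq_bigr => i _ /=.
  by rewrite -[(c *: v + w) i]/(c * v i + w i) scalerDl scalerA.
pose phi := mk_linear lphi; pose a := mk_linear (@act_linear R^o _ _ A).
have [K [k [ik kP]]] := exists_submodule (im_submod a).
have [|r rP] := linear_factor_inj (f := a) ik.
  by move=> v; apply/kP; exists v.
have sr : surj r.
  move=> y; have [|v vy] := (kP (k y)).2; first by exists y.
  by exists v; apply: ik; rewrite rP.
have [|psi psiP] := linear_factor_surj (f := phi) sr.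
  move=> v rv; have [|w ->] := ex v.
    by rewrite -[act A v]/(a v) -rP rv linear0.
  rewrite /phi /= /act.
  under eq_bigr do rewrite scaler_suml.
  rewrite exchange_big big1 // => j _ /=.
  have := congr1 (fun h => w j *: h j) Bx; rewrite scaler0; apply: etrans.
  rewrite /act scaler_sumr; apply: eq_bigr => i _.
  by rewrite mxE scalerA mulrC.
have [g gP] := iE _ _ k psi ik.
exists (fun j => g (unit_vec j)); apply/funext => i; rewrite /act.
have -> : x i = phi (unit_vec i).
  rewrite /phi /= (bigD1 i) //= /unit_vec eqxx scale1r big1 ?addr0 // => j /negPf ->.
  by rewrite scale0r.
rewrite -psiP -gP rP [a _]unit_vec_sum linear_sum; apply: eq_bigr => j _.
rewrite linearZ /= mxE; congr (_ *: _).
rewrite /act (bigD1 i) //= /unit_vec eqxx big1 ?addr0; first by rewrite -[LHS]/(_ * _) mulr1.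
by move=> l /negPf ->; rewrite -[LHS]/(_ * _) mulr0.
Qed.

(** The resolved module is the cokernel of [dmx 0]; it is determined by the matrix and not
    recorded. *)
Record resolution := Resolution {
  rank_ : nat -> nat;
  dmx : forall i, 'M[R]_(rank_ i, rank_ i.+1);
  dmxK : forall i, dmx i *m dmx i.+1 = 0;
  dmx_exact : forall i, exact_at R^o (dmx i) (dmx i.+1) }.

Lemma exists_relations s q (A : 'M[R]_(s, q)) : noetherian R ->
  exists p (B : 'M[R]_(q, p)), A *m B = 0 /\ exact_at R^o A B.
Proof.
move=> nR.
have [r rE] := noetherian_vectors nR (ker_submod (mk_linear (@act_linear R^o _ _ A))).
pose B : 'M[R]_(q, size r) := \matrix_(i, j) nth 0 r j i.
have Bw (w : 'I_(size r) -> R^o) :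
    act B w = \sum_(j < size r) w j *: (nth 0 r j : 'I_q -> R^o).
  apply/funext => i.
  have -> : (\sum_(j < size r) w j *: (nth 0 r j : 'I_q -> R^o)) i = \sum_j w j * nth 0 r j i.
    by elim/big_ind2: _ => // f a g b <- <-.
  by apply: eq_bigr => j _; rewrite mxE -[LHS]/(_ * _) mulrC.
exists (size r), B; split.
  apply/matrixP => i j; rewrite !mxE.
  have : [set x | act A x = 0] (nth 0 r j).
    by rewrite [X in X _]rE; apply: span_mem; apply: mem_nth.
  move=> /(congr1 (fun h => h i)); apply: etrans; apply: eq_bigr => l _.
  by rewrite mxE.
have rmap : [seq nth 0 r (i : 'I_(size r)) | i <- enum 'I_(size r)] = r.
  by rewrite (map_comp (nth 0 r) val) val_enum_ord -[RHS](mkseq_nth 0).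
move=> v Av; have sv : span r v by rewrite -[span r]rE.
by rewrite -rmap in sv; have [c ->] := span_sum sv; exists c; rewrite Bw.
Qed.

(** Every matrix begins a resolution. As an induction principle this replaces a matrix by [dmx D 0]
    without casts between equal ranks. *)
Lemma resolution_ind (P : forall s q, 'M[R]_(s, q) -> Prop) : noetherian R ->
  (forall D, P _ _ (dmx D 0)) -> forall s q (A : 'M[R]_(s, q)), P s q A.
Proof.
move=> nR h s q A.
have ex (t : {s : nat & {q : nat & 'M[R]_(s, q)}}) : exists p (B : 'M[R]_(_, p)),
    tagged (tagged t) *m B = 0 /\ exact_at R^o (tagged (tagged t)) B.
  exact: exists_relations.
pose next t := Tagged (fun s => {q : nat & 'M[R]_(s, q)})
  (Tagged (fun q => 'M[R]_(_, q)) (sval (cid (svalP (cid (ex t)))))).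
pose st i := iter i next (Tagged (fun s => {q : nat & 'M[R]_(s, q)})
  (Tagged (fun q => 'M[R]_(s, q)) A)).
exact: (h (@Resolution (fun i => tag (st i))
  (fun i => tagged (tagged (st i)))
  (fun i => proj1 (svalP (cid (svalP (cid (ex (st i)))))))
  (fun i => proj2 (svalP (cid (svalP (cid (ex (st i))))))))).
Qed.

Lemma ideal_resolution (I : set R) : noetherian R -> ideal I ->
  exists (D : resolution) (i0 : 'I_(rank_ D 0)), (forall i, i = i0) /\
    forall x, I x <-> exists c : 'I_(rank_ D 1) -> R, x = \sum_j c j * dmx D 0 i0 j.
Proof.
move=> nR /(ideal_fg nR)[p [g gP]].
(* That there is a single row is expressed by a unique index, as an equation on the rank would
   require a transport of the matrix. *)
suff H : forall s t (A : 'M[R]_(s, t)) (i0 : 'I_s), (forall k, k = i0) ->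
    (forall x, I x <-> exists c : 'I_t -> R, x = \sum_j c j * A i0 j) ->
    exists (D : resolution) (i0 : 'I_(rank_ D 0)), (forall i, i = i0) /\
      forall x, I x <-> exists c : 'I_(rank_ D 1) -> R, x = \sum_j c j * dmx D 0 i0 j.
  apply: (H _ _ (\row_j g j) ord0) => [k|y]; first by rewrite [k]ord1.
  by rewrite gP; split=> -[c ->]; exists c; apply: eq_bigr => j _; rewrite mxE.
by apply: (resolution_ind nR) => D i0 uni IP; exists D, i0.
Qed.

(* Ext^(i+1)(coker (dmx D 0), X) = 0: the complex Hom(D, X) is given by the
   transposed matrices. *)
Definition ext_vanish (D : resolution) i X : Prop :=
  exact_at X (dmx D i.+1)^T (dmx D i)^T.

Lemma dmxTK D i : (dmx D i.+1)^T *m (dmx D i)^T = 0.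
Proof. by rewrite -trmx_mul dmxK trmx0. Qed.

Lemma ext_vanish_injective D i E : injective_module E -> ext_vanish D i E.
Proof. by move=> iE; apply: (dual_exact iE); apply: dmx_exact. Qed.

Lemma ext_vanish_shift D n C J Y (i : {linear C -> J}) (q : {linear J -> Y}) :
    ses i q -> injective_module J ->
  ext_vanish D n.+1 C <-> ext_vanish D n Y.
Proof.
move=> iq iJ; split=> h.
  exact: (@snake_exact_rev _ _ _ _ _ iq _ _ _ _ _ _ _ (dmxTK D n.+1) h
    (@ext_vanish_injective D n J iJ)).
exact: (@snake_exact _ _ _ _ _ iq _ _ _ _ _ _ _ (dmxTK D n.+1) (dmxTK D n)
  (@ext_vanish_injective D n.+1 J iJ) h).
Qed.

Lemma divx_shift x D n C J Y (i : {linear C -> J}) (q : {linear J -> Y}) :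
    ses i q -> injective_module J ->
    divx x Y (dmx D n.+1)^T (dmx D n)^T ->
  divx x C (dmx D n.+2)^T (dmx D n.+1)^T.
Proof.
move=> iq iJ h; exact: (@snake_divx _ _ _ _ _ iq _ _ _ _ _ _ _ (dmxTK D n.+1) (dmxTK D n) x
  (@ext_vanish_injective D n.+1 J iJ) h).
Qed.

(** The matrix without columns stands for the absent differential before degree 0. With M the
    cokernel of [dmx D 0], the hypothesis concerns Hom(M, Y) and the conclusion Ext^1(M, C). *)
Lemma divx_shift0 x D C J Y (i : {linear C -> J}) (q : {linear J -> Y}) :
    ses i q -> injective_module J ->
    divx x Y (dmx D 0)^T (0 : 'M_(_, 0)) ->
  divx x C (dmx D 1)^T (dmx D 0)^T.
Proof.
move=> iq iJ h; exact: (@snake_divx _ _ _ _ _ iq _ _ _ _ _ _ _ (dmxTK D 0) (mulmx0 _ _) x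
  (@ext_vanish_injective D 0 J iJ) h).
Qed.

Lemma lin_on_sum (I : set R) Y (h : R^o -> Y) n (c g : 'I_n -> R) :
    ideal I -> lin_on (I : set R^o) h -> (forall i, I (g i)) ->
  h (\sum_i c i * g i) = \sum_i c i *: h (g i).
Proof.
move=> hI lh Ig.
suff [] : I (\sum_i c i * g i) /\ h (\sum_i c i * g i) = \sum_i c i *: h (g i) by [].
elim/big_ind2: _ => [|a b y z [Ia ha] [Ib hb]|i _].
- by split; [case: hI|exact: (lin_on0 (ideal_submod hI) lh)].
- split; first exact: idealD.
  by have := lh 1 b z Ia Ib; rewrite !scale1r ha hb.
- split; first exact: idealZ.
  have := lh (c i) (g i) 0 (Ig i) (proj1 hI); rewrite !addr0.
  by rewrite (lin_on0 (ideal_submod hI) lh) addr0.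
Qed.

(* The cokernel of the first differential is R/I when the matrix has one row. *)
Lemma ext_vanish_ideal (D : resolution) (i0 : 'I_(rank_ D 0)) (I : set R) Y :
    (forall i, i = i0) -> ideal I ->
    (forall x, I x <-> exists c : 'I_(rank_ D 1) -> R, x = \sum_j c j * dmx D 0 i0 j) ->
  ext_vanish D 0 Y -> extI I Y.
Proof.
move=> uni hI IP ex h lh.
have Ig j : I (dmx D 0 i0 j).
  apply/IP; exists (fun k => (k == j)%:R); rewrite (bigD1 j) //= eqxx mul1r.
  by rewrite big1 ?addr0 // => k /negPf ->; rewrite mul0r.
have [|w wE] := ex (fun j => h (dmx D 0 i0 j)).
  apply/funext => j; rewrite /act.
  under eq_bigr do rewrite mxE.
  rewrite -(lin_on_sum (I := I)) //.
  rewrite (_ : \sum_i _ = (dmx D 0 *m dmx D 1) i0 j).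
    by rewrite dmxK mxE; apply: (lin_on0 (ideal_submod hI) lh).
  by rewrite mxE; apply: eq_bigr => k _; rewrite mulrC.
exists (w i0) => _ /IP[c ->]; rewrite (lin_on_sum (I := I)) // scaler_suml.
apply: eq_bigr => j _; rewrite -scalerA; congr (_ *: _).
rewrite (congr1 (fun h => h j) wE) /act (bigD1 i0) //= mxE big1 ?addr0 // => i.
by rewrite (uni i) eqxx.
Qed.

End Matrices.

(** * Injective dimension of a local Gorenstein ring *)

Section Bass.
Variables (R : comNzRingType) (m : {pred R}).
Hypotheses (R_noetherian : noetherian R) (R_local : local_ring m).
Implicit Types (I P : set R) (Y M : lmodType R).

Let mm : set R := [set x | x \in m].

Lemma max_ideal : ideal mm.
Proof. by case: R_local => -[/ideal_idealr_closed]. Qed.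

Lemma max_proper : ~ mm 1.
Proof. by case: R_local => -[[_ /negP]]. Qed.

Lemma proper_sub_max I : ideal I -> ~ I 1 -> I `<=` mm.
Proof.
move=> hI I1.
have [||M [[hM M1 IM] Mmax]] := @noetherian_max R R_noetherian
    [set M | [/\ ideal M, ~ M 1 & I `<=` M]].
- by exists I; split.
- by move=> K [].
have [_ uniq_m] := R_local.
have maxM : maximal_ideal ([pred x | `[< M x >]] : {pred R}).
  split; first exact: idealr_closed_asbool.
  move=> K hK MK x; apply/idP/idP; last exact: MK.
  move=> xK; apply/asboolP; apply: (Mmax [set x | x \in K]) => //.
    split; first exact: ideal_idealr_closed.
      by case: hK => _ /negP.
    by move=> y /IM My; apply: MK; apply/asboolP.
  by move=> y My; apply: MK; apply/asboolP.
move=> x /IM Mx; rewrite /mm /= -(uniq_m _ maxM); exact/asboolP.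
Qed.

Lemma unit_not_max c : ~ mm c -> exists u, u * c = 1.
Proof.
move=> nc; apply: contrapT => no; apply: nc.
apply: (proper_sub_max (I := adjoin [set 0] c)).
- by apply: adjoin_ideal; split=> // k y z /= -> ->; rewrite mulr0 addr0.
- by move=> [g [r [-> e]]]; apply: no; exists r; rewrite -[LHS]add0r -e.
- by exists 0, 1; rewrite mul1r add0r.
Qed.

Lemma one_sub_unit x : mm x -> exists u, u * (1 - x) = 1.
Proof.
move=> mx; apply: unit_not_max => mx1; apply: max_proper.
by rewrite -(subrK x 1); apply: idealD; first exact: max_ideal.
Qed.

(** Modulo W, the module V is finitely generated and divisible by x. No quotient is formed: a
    generator u satisfies (1 - x c) u in span s + W with 1 - x c invertible, and is dropped. *)
Lemma nakayama M (V W : set M) x : mm x -> submod V -> submod W ->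
    (forall v, V v -> exists v' w, [/\ V v', W w & v = x *: v' + w]) ->
    (exists2 s : seq M, (forall v, v \in s -> V v) &
       forall v, V v -> exists y w, [/\ span s y, W w & v = y + w]) ->
  V `<=` W.
Proof.
move=> mx hV hW div [s]; elim: s => [_ h v /h[y [w [-> Ww ->]]]|u s IH sV gen].
  by rewrite add0r.
have Vu : V u by apply: sV; apply: mem_head.
apply: IH; first by move=> v vs; apply: sV; rewrite inE vs orbT.
have sp := span_submod s.
suff [y0 [w0 [sy0 Ww0 u0]]] : exists y w, [/\ span s y, W w & u = y + w].
  move=> v /gen[_ [w [[c [y [sy ->]]] Ww ->]]].
  exists (c *: y0 + y), (c *: w0 + w); split.
  - exact: (proj2 sp).
  - exact: (proj2 hW).
  - by rewrite u0 scalerDr -!addrA [y + (_ + _)]addrCA.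
have [v' [w [Vv' Ww uE]]] := div u Vu.
have [_ [w' [[c [y [sy ->]]] Ww' v'E]]] := gen v' Vv'.
have [r rE] : exists r, r * (1 - x * c) = 1.
  by apply: one_sub_unit; rewrite mulrC; apply: idealZ => //; apply: max_ideal.
exists (r *: (x *: y)), (r *: (x *: w' + w)); split.
- by do 2!apply: submodZ => //.
- by apply: submodZ => //; apply: (proj2 hW).
- rewrite -scalerDr -{1}[u]scale1r -rE -scalerA; congr (_ *: _).
  rewrite scalerBl scale1r {1}uE v'E !scalerDr !scalerA.
  by rewrite -!addrA addrC !addrA addrNK.
Qed.

(** With coefficients R the cycles are finitely generated, so Nakayama's lemma turns divisibility of
    the homology by x into its vanishing. *)
Lemma divx_exact x s t p (A : 'M[R]_(s, t)) (B : 'M[R]_(t, p)) :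
  mm x -> divx x R^o A B -> exact_at R^o A B.
Proof.
move=> mx div.
pose V : set ('I_t -> R^o) := [set v | act A v = 0].
pose W : set ('I_t -> R^o) := [set v | exists w, act B w = v].
have hV : submod V.
  split=> [|c u v /= Au Av]; first exact: act0.
  by rewrite /V /= actP Au Av scaler0 addr0.
have hW : submod W.
  split=> [|c _ _ [u <-] [v <-]]; first by exists 0; rewrite act0.
  by exists (c *: u + v); rewrite actP.
suff h : V `<=` V `&` W by move=> v /h[_ [w <-]]; exists w.
have hVW : submod (V `&` W).
  split=> [|c u v [Vu Wu] [Vv Wv]]; first by split; [case: hV|case: hW].
  by split; [apply: (proj2 hV)|apply: (proj2 hW)].
apply: (nakayama mx hV hVW) => [v Vv|].
  have [v' [w [Av' vE]]] := div v Vv.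
  exists v', (act B w); split=> //; split; last by exists w.
  rewrite -(addKr (x *: v') (act B w)) -vE addrC.
  by apply: submodB => //; apply: submodZ.
have [r rE] := noetherian_vectors R_noetherian hV.
exists r => [v vr|v Vv]; first by rewrite rE; apply: span_mem.
exists v, 0; rewrite addr0 -rE; split=> //; exact: (proj1 hVW).
Qed.

Lemma extI_full Y I : I 1 -> ideal I -> extI I Y.
Proof.
move=> I1 hI h lh; exists (h 1) => a Ia.
have := lh a 1 0 I1 (proj1 hI).
rewrite !addr0 (lin_on0 (ideal_submod hI) lh) addr0 => <-.
by rewrite -[a *: _]/(a * 1) mulr1.
Qed.

(** Multiplication by a gives 0 -> R/(I : a) -> R/I -> R/(I + Ra) -> 0, and Ext^1(-, Y) is exact in
    the middle. *)
Lemma extI_colon Y I a : ideal I -> extI (colon I a) Y -> extI (adjoin I a) Y ->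
  extI I Y.
Proof.
move=> hI ext1 ext2 h lh.
have [|y1 y1P] := ext1 (fun s => h (s * a)).
  move=> c s t Is It; rewrite -lh //; congr h.
  by rewrite -[c *: s]/(c * s) mulrDl -mulrA.
have [|h' h'P] := @choice R^o Y (fun x y => forall g r, I g -> x = g + r * a ->
    y = h g + r *: y1).
  move=> x; have [[g [r [Ig ->]]]|no] := pselect (adjoin I a x); last first.
    by exists 0 => g r Ig xE; case: no; exists g, r.
  exists (h g + r *: y1) => g' r' Ig' e.
  have Ir : colon I a (r' - r).
    rewrite /colon /= mulrBl.
    suff -> : r' * a - r * a = g - g' by apply: idealB.
    by apply/eqP; rewrite subr_eq addrAC e addrC addKr.
  have gE : g = 1 *: (g' : R^o) + (r' - r) * a.
    by rewrite scale1r mulrBl addrA -e addrK.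
  by rewrite gE lh // scale1r y1P // scalerBl -addrA subrK.
have h'E g r : I g -> h' (g + r * a) = h g + r *: y1 by move=> Ig; apply: h'P.
have [|y yP] := ext2 h'.
  move=> c _ _ [g [r [Ig ->]]] [g' [r' [Ig' ->]]].
  rewrite -[c *: _]/(c * _) mulrDr addrACA mulrA -mulrDl !h'E //; last exact: (proj2 hI).
  by rewrite lh // scalerDl -scalerA scalerDr addrACA.
exists y => g Ig; rewrite -yP; last exact: adjoin_sub.
by have := h'E g 0 Ig; rewrite mul0r addr0 scale0r addr0.
Qed.

(* A map from (I + Rx)/I = R/(I : x) to Y extends to R/I. *)
Lemma extI_adjoin Y I x (c : Y) : ideal I -> extI (adjoin I x) Y ->
    (forall r, colon I x r -> r *: c = 0) ->
  exists2 c', forall g, I g -> g *: c' = 0 & c = x *: c'.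
Proof.
move=> hI ext Ic.
have [|h hP] := @choice R^o Y (fun z y => forall g r, I g -> z = g + r * x -> y = r *: c).
  move=> z; have [[g [r [Ig ->]]]|no] := pselect (adjoin I x z); last first.
    by exists 0 => g r Ig zE; case: no; exists g, r.
  exists (r *: c) => g' r' Ig' e; apply/eqP; rewrite -subr_eq0 -scalerBl.
  apply/eqP/Ic; rewrite /colon /= mulrBl.
  suff -> : r * x - r' * x = g' - g by apply: idealB.
  by apply/eqP; rewrite subr_eq addrAC -e addrC addKr.
have hE g r : I g -> h (g + r * x) = r *: c by move=> Ig; apply: (hP _ g).
have [|y yP] := ext h.
  move=> k _ _ [g [r [Ig ->]]] [g' [r' [Ig' ->]]].
  rewrite -[k *: _]/(k * _) mulrDr addrACA mulrA -mulrDl !hE //; last exact: (proj2 hI).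
  by rewrite scalerDl scalerA.
exists y => [g Ig|].
  rewrite -yP; last exact: adjoin_sub.
  by have := hE g 0 Ig; rewrite mul0r addr0 scale0r.
rewrite -yP; last exact: adjoin_gen.
by have := hE 0 1 (proj1 hI); rewrite mul1r add0r scale1r.
Qed.

Section Cosyzygies.
Variables (C J : nat -> lmodType R).
Variables (i : forall n, {linear C n -> J n}) (q : forall n, {linear J n -> C n.+1}).
Hypotheses (iq : forall n, ses (i n) (q n)) (iJ : forall n, injective_module (J n)).

Lemma ext_vanish_cosyzygy D n k : ext_vanish D (n + k) (C 0) <-> ext_vanish D k (C n).
Proof.
elim: n k => [|n IH] k //.
rewrite addSnnS; apply: iff_trans (IH k.+1) _.
exact: (ext_vanish_shift D k (iq n) (@iJ n)).
Qed.

Lemma divx_cosyzygy x D n k :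
  divx x (C n) (dmx D k.+1)^T (dmx D k)^T ->
  divx x (C 0) (dmx D (n + k).+1)^T (dmx D (n + k))^T.
Proof.
elim: n k => [|n IH] k // h.
rewrite addSnnS; apply: IH; exact: (divx_shift (iq n) (@iJ n) h).
Qed.

Hypothesis C0 : C 0 = R^o :> lmodType R.

(** As x is regular on R/I, vanishing of Ext^(n+2)(R/(I + Rx), R) makes Ext^(n+1)(R/I, R) divisible
    by x. The divisibility is seen on Hom(R/I, C (n+1)) and moved along the cosyzygies back to C 0 =
    R, where Nakayama's lemma applies. *)
Lemma ext_prime n I x : primeI I -> mm x -> ~ I x ->
  extI (adjoin I x) (C n.+1) -> extI I (C n).
Proof.
move=> Ip mx nIx ext; have [hI _ _] := Ip.
have [D [i0 [uni IP]]] := ideal_resolution R_noetherian hI.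
apply: (ext_vanish_ideal uni hI IP).
apply/(ext_vanish_cosyzygy D n 0).
have IA j : I (dmx D 0 i0 j).
  apply/IP; exists (fun k => (k == j)%:R); rewrite (bigD1 j) //= eqxx mul1r.
  by rewrite big1 ?addr0 // => k /negPf ->; rewrite mul0r.
rewrite /ext_vanish.
have : divx x (C 0) (dmx D (n + 0).+1)^T (dmx D (n + 0))^T; last first.
  by rewrite C0; apply: divx_exact.
apply: divx_cosyzygy; apply: (divx_shift0 (iq n) (@iJ n)) => v Av.
have actE (u : 'I_(rank_ D 0) -> C n.+1) j : act (dmx D 0)^T u j = dmx D 0 i0 j *: u i0.
  rewrite /act (bigD1 i0) //= mxE big1 ?addr0 // => k.
  by rewrite (uni k) eqxx.
have [|c cI vE] := extI_adjoin (c := v i0) hI ext.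
  move=> r Irx; have /IP[c ->] : I r by case: Ip => _ _ /(_ _ _ Irx)[].
  rewrite scaler_suml big1 // => j _.
  by rewrite -scalerA -actE Av scaler0.
exists (fun=> c), 0; rewrite act0 addr0; split; apply/funext => k.
  by rewrite actE cI.
by rewrite (uni k) vE.
Qed.

(** Noetherian induction on I. A prime other than m is traded for a larger ideal in degree k + 1,
    which is why all k from n on are treated together; a proper ideal that is not prime is handled
    by [extI_colon]. *)
Lemma ext_all n : (forall k, (n <= k)%N -> extI mm (C k)) ->
  forall I, ideal I -> forall k, (n <= k)%N -> extI I (C k).
Proof.
move=> extm; apply: (noetherian_ind R_noetherian) => I hI IH k nk.
have [I1|I1] := pselect (I 1); first exact: extI_full.
have [Ip|nIp] := pselect (primeI I); last first.
  have [a [b [Iab nIa nIb]]] := not_prime_witness hI I1 nIp.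
  apply: (@extI_colon _ _ a) => //; apply: IH => //.
  - exact: colon_ideal.
  - split; first exact: colon_sub.
    by move=> h; apply: nIb; apply: h; rewrite /colon /= mulrC.
  - exact: adjoin_ideal.
  - split; first exact: adjoin_sub.
    by move=> h; apply: nIa; apply: h; apply: adjoin_gen.
have Im := proper_sub_max hI I1.
have [mI|] := pselect (mm `<=` I).
  by have -> : I = mm by [apply/seteqP]; apply: extm.
move=> /existsNP[x /not_implyP[mx nIx]].
apply: (ext_prime Ip mx nIx); apply: IH => //; last exact: leq_trans nk _.
  exact: adjoin_ideal.
split; first exact: adjoin_sub.
by move=> h; apply: nIx; apply: h; apply: adjoin_gen.
Qed.

Fixpoint regular_ideal (r : nat) (I : set R) : Prop :=
  if r is r'.+1 then exists I' x, [/\ regular_ideal r' I', mm x,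
    (forall a, I' (a * x) -> I' a) & I = adjoin I' x]
  else I = [set 0].

Lemma regular_ideal_ideal r I : regular_ideal r I -> ideal I.
Proof.
elim: r I => [|r IH] I /=; last by move=> [I' [x [/IH hI' _ _ ->]]]; apply: adjoin_ideal.
by move=> ->; split=> // c x y /= -> ->; rewrite mulr0 addr0.
Qed.

Lemma regular_ideal_sub r I : regular_ideal r I -> I `<=` mm.
Proof.
have hm := max_ideal.
elim: r I => [|r IH] I /=; first by move=> -> _ /= ->; case: hm.
move=> [I' [x [/IH I'm mx _ ->]]] _ [g [s [/I'm mg ->]]].
by apply: idealD => //; apply: idealZ.
Qed.

(** R/I has projective dimension at most r, so Ext^(n+1)(R/I, C 0) vanishes for n >= r. Induction on
    r takes the place of the Koszul complex. *)
Lemma extI_regular r I n : regular_ideal r I -> (r <= n)%N -> extI I (C n).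
Proof.
elim: r I n => [|r IH] I n /=.
  move=> -> _ h lh; exists 0 => a /= ->; rewrite scaler0.
  have h0 : ideal [set 0 : R] by split=> // c x y /= -> ->; rewrite mulr0 addr0.
  exact: (lin_on0 (ideal_submod h0) lh).
move=> [I' [x [rI' mx xreg ->]]]; case: n => // n; rewrite ltnS => rn h lh.
have hI' := regular_ideal_ideal rI'.
have hI := adjoin_ideal x hI'.
have [|u uP] := IH I' n.+1 rI' (leqW rn) h.
  by move=> c a b Ia Ib; apply: lh; apply: adjoin_sub.
(* The element u represents h on I' but misses it at x by c; a correction must be killed by I' and
   become c when multiplied by x. *)
pose c := h x - x *: u.
have hx : adjoin I' x x by apply: adjoin_gen.
have h0 := lin_on0 (ideal_submod hI) lh.
have hZ r' a : adjoin I' x a -> h (r' * a) = r' *: h a.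
  by move=> Ia; have := lh r' a 0 Ia (proj1 hI); rewrite !addr0 h0 addr0.
have Ic g : I' g -> g *: c = 0.
  move=> Ig; rewrite scalerBr -hZ // mulrC hZ; last exact: adjoin_sub.
  by rewrite uP // !scalerA mulrC subrr.
have [ii sq kerq] := iq n.
have [e qe] := sq c.
have [w wP] : exists w : R^o -> C n, forall g, I' g -> i n (w g) = g *: e.
  have [|w wP] := @choice R^o (C n) (fun g w => I' g -> i n w = g *: e).
    move=> g; have [Ig|nIg] := pselect (I' g); last by exists 0.
    by have /kerq[y ye] : q n (g *: e) = 0 by [rewrite linearZ /= qe Ic]; exists y.
  by exists w.
have [|b bP] := IH I' n rI' rn w.
  move=> k a a' Ia Ia'; apply: ii; rewrite linearP !wP //; last exact: (proj2 hI').
  by rewrite scalerDl scalerA.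
(* A preimage of c in [J n] that is killed by I' as well; it is divisible by x because x is regular
   modulo I' and [J n] is injective. *)
pose e' := e - i n b.
have Ie g : I' g -> g *: e' = 0.
  by move=> Ig; rewrite scalerBr -wP // bP // linearZ subrr.
have [|f fI fx] := extI_adjoin (c := e') hI' (injective_extI hI (@iJ n)).
  by move=> s /xreg/Ie.
have cE : c = x *: q n f.
  by rewrite -linearZ -fx linearB (sesK _ (iq n)) subr0.
exists (u + q n f) => _ [g [s [Ig ->]]].
have hgs : h (g + s * x) = s *: h x + h g.
  by rewrite [g + _]addrC; apply: lh hx (adjoin_sub x Ig).
rewrite hgs (uP g Ig) -[h x](subrK (x *: u)) -/c cE.
have gf : g *: q n f = 0 by rewrite -linearZ /= fI // linear0.
by rewrite [RHS]scalerDl !scalerDr gf addr0 !scalerA [LHS]addrC [X in _ + X = _]addrC.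
Qed.

(** The element y embeds R/m into R/I. So Ext^1(R/I, C n) maps onto Ext^1(R/m, C n), as the next
    term, an Ext^2 into C n, is an Ext^1 into the injective C (n+1). *)
Lemma extI_socle n I y : ideal I -> extI I (C n) -> injective_module (C n.+1) ->
  ~ I y -> mm `<=` colon I y -> extI mm (C n).
Proof.
move=> hI ext iC nIy ym h lh.
have hm := max_ideal.
have colm : colon I y `<=` mm.
  by apply: proper_sub_max; [exact: colon_ideal|rewrite /colon /= mul1r].
have [ii sq kerq] := iq n.
have [w wP] : exists w, forall s, mm s -> i n (h s) = s *: w.
  apply: (injective_extI hm (@iJ n) (h := i n \o h)) => c a b ma mb.
  by rewrite /= lh // linearP.
have qw s : mm s -> s *: q n w = 0.
  by move=> ms; rewrite -linearZ -wP // (sesK _ (iq n)).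
have [|c cI cy] :=
    extI_adjoin (c := q n w) hI (injective_extI (adjoin_ideal y hI) iC).
  by move=> r /colm/qw.
have [v qv] := sq c.
have [k kP] : exists k : R^o -> C n, forall g, I g -> i n (k g) = g *: v.
  have [|k kP] := @choice R^o (C n) (fun g k => I g -> i n k = g *: v).
    move=> g; have [Ig|nIg] := pselect (I g); last by exists 0.
    by have /kerq[z zv] : q n (g *: v) = 0 by [rewrite linearZ /= qv cI]; exists z.
  by exists k.
have [|u uP] := ext k.
  move=> r a a' Ia Ia'; apply: ii; rewrite linearP !kP //; last exact: (proj2 hI).
  by rewrite scalerDl scalerA.
have /kerq[z zE] : q n (w - y *: (v - i n u)) = 0.
  by rewrite linearB linearZ linearB (sesK _ (iq n)) subr0 qv cy subrr.
exists z => s ms; apply: ii; rewrite linearZ /= zE scalerBr wP //.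
have Isy : I (s * y) by apply: ym.
by rewrite scalerA scalerBr -kP // -linearZ -uP // subrr subr0.
Qed.

End Cosyzygies.

Definition prime_chain_to (n : nat) (P : set R) : Prop :=
  exists Q : nat -> set R, [/\ Q n = P, forall k, (k <= n)%N -> primeI (Q k) &
    forall k, (k < n)%N -> Q k `<=` Q k.+1 /\ exists2 x, Q k.+1 x & ~ Q k x].

(** A prime Q that contains I' and misses all s x^k with s outside P lies strictly inside P. These
    products avoid I' because x is regular modulo I' and I' lies in P. *)
Lemma regular_chain r I P :
  regular_ideal r I -> primeI P -> I `<=` P -> prime_chain_to r P.
Proof.
elim: r I P => [|r IH] I P /=; first by move=> _ hP _; exists (fun=> P).
move=> [I' [x [rI' mx xreg ->]]] hP IP; have hI' := regular_ideal_ideal rI'.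
have [hPi P1 Pp] := hP.
pose S : set R := [set z | exists s k, ~ P s /\ z = s * x ^+ k].
have [||z Iz|Q [hQ IQ QS]] := @exists_prime_disjoint R R_noetherian I' S hI'.
- by exists 1, 0%N; rewrite mulr1.
- move=> _ _ [s [k [Ps ->]]] [s' [k' [Ps' ->]]]; exists (s * s'), (k + k')%N.
  by split; [case/Pp|rewrite exprD mulrACA].
- move=> [s [k [Ps zE]]]; apply: Ps; apply: IP; apply: adjoin_sub.
  rewrite zE in Iz; elim: k Iz {zE} => [|k IHk]; first by rewrite mulr1.
  by rewrite exprSr mulrA => /xreg/IHk.
have QP : Q `<=` P.
  move=> z Qz; apply: contrapT => nPz; apply: (QS z) => //.
  by exists z, 0%N; rewrite mulr1.
have nQx : ~ Q x.
  by move=> /QS; apply; exists 1, 1%N; rewrite mul1r.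
have [F [Fr Fp Fs]] := IH I' Q rI' hQ IQ.
exists (fun k => if (k <= r)%N then F k else P); split.
- by rewrite ltnn.
- by move=> k _; case: ifP => // kr; apply: Fp.
- move=> k; rewrite ltnS => kr; rewrite kr.
  case: (ltngtP k r) kr => // [kr _|-> _]; first exact: Fs.
  rewrite Fr; split=> //; exists x => //.
  by apply: IP; apply: adjoin_gen.
Qed.

Lemma prime_chain_of n P : prime_chain_to n P ->
  exists Q : nat -> {pred R}, prime_chain n Q.
Proof.
move=> [Q [_ Qp Qs]]; exists (fun k x => `[< Q k x >]); split.
  move=> k /Qp[hQ Q1 Qpr]; split; first exact: idealr_closed_asbool.
  move=> u v /asboolP/Qpr[Qu|Qv]; apply/orP; [left|right]; exact/asboolP.
move=> k /Qs[sub [x Qx nQx]]; split.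
  by move=> y /asboolP Qy; apply/asboolP; apply: sub.
by exists x; [apply/asboolP|apply/negP => /asboolP].
Qed.

Lemma max_prime : primeI mm.
Proof.
have hm := max_ideal; split; [exact: hm|exact: max_proper|move=> a b mab].
apply: contrapT => /not_orP[na nb].
have [u ua] := unit_not_max na; apply: nb.
by rewrite -[b]mul1r -ua -mulrA; apply: idealZ.
Qed.

(** A regular sequence of length r yields a chain of r + 1 primes ending in m, which bounds r by d;
    modulo a sequence that cannot be prolonged, m consists of zero divisors. *)
Lemma exists_max_regular d : krull_dim R d -> exists r I,
  [/\ (r <= d)%N, regular_ideal r I &
      forall x, mm x -> exists2 y, ~ I y & I (x * y)].
Proof.
move=> [_ dmax]; apply: contrapT => no.
have grow r : exists I, regular_ideal r I.
  have bound k I : regular_ideal k I -> (k <= d)%N.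
    move=> rI; have [Q cQ] := prime_chain_of
      (regular_chain rI max_prime (regular_ideal_sub rI)).
    exact: dmax cQ.
  elim: r => [|r [I rI]]; first by exists [set 0].
  apply: contrapT => stop; apply: no; exists r, I; split=> //; first exact: bound rI.
  move=> x mx; apply: contrapT => no; apply: stop; exists (adjoin I x), I, x.
  split=> // a Iax; apply: contrapT => nIa; apply: no; exists a => //.
  by rewrite mulrC.
have [I rI] := grow d.+1.
have [Q cQ] := prime_chain_of
  (regular_chain rI max_prime (regular_ideal_sub rI)).
by have := dmax _ _ cQ; rewrite ltnn.
Qed.

Lemma trivial_injective M : trivial_module M -> injective_module M.
Proof. by move=> tM A B k f ik; exists \0 => x; rewrite [LHS]tM [RHS]tM. Qed.

(* Bass: a local Gorenstein ring of dimension d has injective dimension at most d. *)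
Theorem gorenstein_cosyzygy d : gorenstein R -> krull_dim R d ->
  exists (C J : nat -> lmodType R) (i : forall n, {linear C n -> J n})
    (q : forall n, {linear J n -> C n.+1}),
    [/\ C 0 = R^o :> lmodType R, forall n, ses (i n) (q n),
        forall n, injective_module (J n) & injective_module (C d)].
Proof.
move=> [J [e [delta [iJ ie ker0 kerS [N JN]]]]] dimR.
have sub n : exists (K : lmodType R) (k : {linear K -> J n}),
    injective k /\ forall x, delta n x = 0 <-> exists y, k y = x.
  exact: (exists_submodule (ker_submod (delta n))).
pose C n : lmodType R := if n is n'.+1 then sval (cid (sub n'.+1)) else R^o.
have exi n : exists i : {linear C n -> J n},
    injective i /\ forall x, delta n x = 0 <-> exists y, i y = x.
  case: n => [|n]; first by exists e.
  exact: (svalP (cid (sub n.+1))).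
have [i iP] := dep_choice exi.
have exq n : exists q : {linear J n -> C n.+1}, forall x, i n.+1 (q x) = delta n x.
  have [ii iE] := iP n.+1.
  by apply: linear_factor_inj ii _ => b; apply/iE/kerS; exists b.
have [q qP] := dep_choice exq.
have iq n : ses (i n) (q n).
  have [ii iE] := iP n; have [ii' iE'] := iP n.+1; split=> // [y|x].
    have /kerS[x xE] : delta n.+1 (i n.+1 y) = 0 by apply/iE'; exists y.
    by exists x; apply: ii'; rewrite qP.
  rewrite -iE -qP; split=> [->|]; first exact: linear0.
  exact: inj0.
exists C, J, i, q; split=> //.
(* The given injective resolution has an unknown finite length. The least degree n from which all
   cosyzygies are injective is compared with d. *)
have late : exists n, `[< forall k, (n <= k)%N -> injective_module (C k) >].
  exists N.+1; apply/asboolP => k Nk; apply: trivial_injective => x.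
  have [ii _] := iP k; apply: ii; rewrite [LHS](JN k) // linear0 //.
case: (ex_minnP late) => n /asboolP nP nmin.
have [nd|dn] := leqP n d; first exact: nP.
case: n => [|n] // in nP nmin dn *.
suff : (n.+1 <= n)%N by rewrite ltnn.
apply: nmin; apply/asboolP => k nk; apply: baer => I hI.
apply: (ext_all iq iJ erefl (n := n)) => // l.
rewrite leq_eqVlt => /orP[/eqP <-|nl]; last first.
  by apply: injective_extI (nP l nl); apply: max_ideal.
(* Since d <= n, the sequence has length at most n and Ext^1(R/K, C n) = 0, while C (n+1) is
   injective. The socle of R/K then gives Ext^1(R/m, C n) = 0, which contradicts the minimality of n
   + 1. *)
have [r [K [rd rK zd]]] := exists_max_regular dimR.
have hK := regular_ideal_ideal rK.
have [y nKy ym] := socle_element R_noetherian hK max_ideal zd.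
apply: (extI_socle iq iJ hK _ (nP n.+1 (leqnn _)) nKy ym).
by apply: (extI_regular iq iJ rK); apply: leq_trans rd _.
Qed.

End Bass.

(** * Syzygies and cosyzygies *)

Section Syzygies.
Variable R : comNzRingType.
Implicit Types A B C E G J K M N P X Y : lmodType R.

Fixpoint syzygy (n : nat) N G : Prop :=
  if n is n'.+1 then exists P K (k : {linear K -> P}) (p : {linear P -> N}),
    [/\ projective P, ses k p & syzygy n' K G]
  else N = G.

Fixpoint cosyzygy (n : nat) N G : Prop :=
  if n is n'.+1 then exists J C (i : {linear N -> J}) (q : {linear J -> C}),
    [/\ injective_module J, ses i q & cosyzygy n' C G]
  else N = G.

Lemma syzygy_exists n N : exists G, syzygy n N G.
Proof.
elim: n N => [|n IH] N; first by exists N.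
have [P [p [pP sp _]]] := projective_cover N.
have [K [k kp]] := ses_of_surj sp.
by have [G KG] := IH K; exists G, P, K, k, p.
Qed.

Lemma cosyzygy_exists n N : exists G, cosyzygy n N G.
Proof.
elim: n N => [|n IH] N; first by exists N.
have [J [i [iJ ii]]] := enough_injectives N.
have [C [q iq]] := ses_of_inj ii.
by have [G CG] := IH C; exists G, J, C, i, q.
Qed.

Lemma syzygy_rcons n N G G' P (k : {linear G' -> P}) (p : {linear P -> G}) :
  syzygy n N G -> ses k p -> projective P -> syzygy n.+1 N G'.
Proof.
elim: n N => [|n IH] N /=.
  by move=> NG; move: k p; rewrite -NG => k p kp pP; exists P, G', k, p.
move=> [P1 [K [k1 [p1 [pP1 kp1 KG]]]]] kp pP.
by exists P1, K, k1, p1; split=> //; apply: IH.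
Qed.

Lemma cosyzygy_rcons n N G G' J (i : {linear G -> J}) (q : {linear J -> G'}) :
  cosyzygy n N G -> ses i q -> injective_module J -> cosyzygy n.+1 N G'.
Proof.
elim: n N => [|n IH] N /=.
  by move=> NG; move: i q; rewrite -NG => i q iq iJ; exists J, G', i, q.
move=> [J1 [C [i1 [q1 [iJ1 iq1 CG]]]]] iq iJ.
by exists J1, C, i1, q1; split=> //; apply: IH.
Qed.

Lemma cosyzygy_unrcons n N G : cosyzygy n.+1 N G ->
  exists G' J (i : {linear G' -> J}) (q : {linear J -> G}),
    [/\ cosyzygy n N G', ses i q & injective_module J].
Proof.
elim: n N => [|n IH] N.
  by move=> [J [C [i [q [iJ iq /= CG]]]]]; move: q iq; rewrite CG => q iq; exists N, J, i, q.
move=> [J [C [i [q [iJ iq /IH [G' [J' [i' [q' [CG' iq' iJ']]]]]]]]]].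
by exists G', J', i', q'; split=> //; exists J, C, i, q.
Qed.

(* Both sides are Ext^(n+1)(A, B). *)
Lemma ext1_syzygy n A K B Y :
  syzygy n A K -> cosyzygy n B Y -> (ext1 K B <-> ext1 A Y).
Proof.
elim: n A Y => [|n IH] A Y; first by move=> /= -> ->.
move=> [P [K1 [k [p [pP kp sK]]]]] /cosyzygy_unrcons[Y' [J [i [q [cY iq iJ]]]]].
apply: iff_trans (IH _ _ sK cY) _.
exact: (ext1_shift kp iq pP iJ).
Qed.

(** The syzygy of A is prescribed and those of B and C are adapted to it, so that a given syzygy
    acquires an embedding. *)
Lemma horseshoe_syzygy n A B C A' (f : {linear A -> B}) (g : {linear B -> C}) :
    ses f g -> syzygy n A A' ->
  exists B' C' (f' : {linear A' -> B'}) (g' : {linear B' -> C'}),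
    [/\ ses f' g', syzygy n B B' & syzygy n C C'].
Proof.
elim: n A B C f g => [|n IH] A B C f g fg.
  by move=> /= AA'; move: f fg; rewrite AA' => f fg; exists B, C, f, g.
move=> [P [K [k [p [pP kp sK]]]]].
have [Q [r [pQ sr _]]] := projective_cover C.
have [L [l lr]] := ses_of_surj sr.
have [fi sg kerg] := fg; have [ki sp kerp] := kp; have [li _ kerr] := lr.
have [t tP] := pQ _ _ g r sg.
have [u uP] := copair_linear (f \o p) t.
have su : surj u.
  move=> b; have [y yP] := sr (g b).
  have /kerg[a ab] : g (b - t y) = 0 by rewrite linearB tP yP subrr.
  have [x xa] := sp a; exists (x, y).
  by rewrite uP /= xa ab subrK.
have [M [v vu]] := ses_of_surj su; have [vi _ keru] := vu.
have gu z : g (u z) = r z.2 by rewrite uP linearD /= (sesK _ fg) tP add0r.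
have [|w wP] := @linear_factor_inj R Q M L l (snd \o v) li.
  by move=> x; apply/kerr; rewrite /= -gu (sesK x vu) linear0.
have [h hP] : exists h : {linear K -> (P * Q)%type}, forall x, h x = (k x, 0).
  by have [h hP] := pair_linear k (\0 : {linear K -> Q}); exists h => x; rewrite hP.
have [|s sP] := linear_factor_inj (f := h) vi.
  by move=> x; apply/keru; rewrite hP uP /= (sesK _ kp) !linear0 addr0.
have sw : ses s w.
  split=> [x y e|y|z].
  - by have := congr1 v e; rewrite !sP !hP => -[/ki].
  - have /kerg[a ab] : g (t (l y)) = 0 by rewrite tP (sesK _ lr).
    have [x xa] := sp a.
    have /keru[z zP] : u (- x, l y) = 0 by rewrite uP /= linearN xa linearN ab addNr.
    by exists z; apply: li; rewrite (wP z) /= zP.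
  - split=> [wz|[x <-]]; last by apply: li; rewrite wP /= sP hP linear0.
    have vz2 : (v z).2 = 0 by rewrite -[LHS]/((snd \o v) z) -wP wz linear0.
    have /kerp[x xE] : p (v z).1 = 0.
      apply: (inj0 fi); have := sesK z vu.
      by rewrite uP vz2 linear0 addr0.
    by exists x; apply: vi; rewrite sP hP xE -vz2 -surjective_pairing.
have [B' [C' [f' [g' [fg' sB sC]]]]] := IH _ _ _ _ _ sw sK.
exists B', C', f', g'; split=> //.
  by exists (P * Q)%type, M, v, u; split=> //; apply: projective_prod.
by exists Q, L, l, r.
Qed.

Lemma horseshoe_cosyzygy n A B C C' (f : {linear A -> B}) (g : {linear B -> C}) :
    ses f g -> cosyzygy n C C' ->
  exists A' B' (f' : {linear A' -> B'}) (g' : {linear B' -> C'}),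
    [/\ ses f' g', cosyzygy n A A' & cosyzygy n B B'].
Proof.
elim: n A B C f g => [|n IH] A B C f g fg.
  by move=> /= CC'; move: g fg; rewrite CC' => g fg; exists A, B, f, g.
move=> [J [D [j [q [iJ jq cD]]]]].
have [I [i [iI ii]]] := enough_injectives A.
have [E [r ir]] := ses_of_inj ii.
have [fi sg kerg] := fg; have [ji sq kerq] := jq; have [_ sr kerr] := ir.
have [t tP] := iI _ _ f i fi.
have [u uP] := pair_linear t (j \o g).
have ui : injective u.
  apply: inj0P => b; rewrite uP => -[tb /= jgb].
  have /kerg[a ab] : g b = 0 by apply: inj0 ji jgb.
  by move: tb; rewrite -ab tP => /(inj0 ii) ->; rewrite linear0.
have [M [v uv]] := ses_of_inj ui; have [_ sv kerv] := uv.
have [|w wP] := linear_factor_surj (f := q \o snd) sv.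
  by move=> z /kerv[b <-]; rewrite uP /= (sesK _ jq).
have [h hP] : exists h : {linear I -> (I * J)%type}, forall x, h x = (x, 0).
  by have [h hP] := pair_linear idfun (\0 : {linear I -> J}); exists h => x; rewrite hP.
have [|s sP] := linear_factor_surj (f := v \o h) sr.
  move=> x /kerr[a <-] /=; apply/kerv; exists (f a).
  by rewrite uP hP tP /= (sesK _ fg) linear0.
have sw : ses s w.
  split=> [|y|z].
  - apply: inj0P => y; have [x <-] := sr y; rewrite sP /= => /kerv[b].
    rewrite uP hP => -[tb /= jgb].
    have /kerg[a ab] : g b = 0 by apply: inj0 ji jgb.
    by apply/kerr; exists a; rewrite -tP ab.
  - by have [x <-] := sq y; exists (v (0, x)); rewrite wP.
  - split=> [wz|[x <-]]; last first.
      by have [y <-] := sr x; rewrite sP /= wP /= hP linear0.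
    have [[x y] xyz] := sv z.
    have /kerq[c cy] : q y = 0 by rewrite -wz -xyz wP.
    have [b bc] := sg c.
    exists (r (x - t b)); rewrite sP /= -xyz; apply/eqP; rewrite -subr_eq0 -linearB.
    apply/eqP/kerv; exists (- b); rewrite hP linearN uP /= bc cy.
    by apply: injective_projections; rewrite /= ?sub0r // addrC addKr.
have [A' [B' [f' [g' [fg' cA cB]]]]] := IH _ _ _ _ _ sw cD.
exists A', B', f', g'; split=> //; first by exists I, E, i, r.
by exists (I * J)%type, M, u, v; split=> //; apply: injective_prod.
Qed.

(* The equational criterion of flatness. *)
Definition mx_flat X : Prop :=
  forall s q p (A : 'M[R]_(s, q)) (B : 'M[R]_(q, p)),
    A *m B = 0 -> exact_at R^o A B -> exact_at X A B.

Lemma projective_flat P : projective P -> mx_flat P.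
Proof.
move=> /projective_dbasis[S [e [c bas]]] s q p A B _ ex x Ax.
have [t [ut t0 xE]] := dbasis_support x bas.
have [|y yP] := @choice S ('I_p -> R^o) (fun z y => c z \o x = act B y).
  by move=> z; apply: ex; rewrite act_map Ax; apply/funext => i; apply: linear0.
exists (fun k => \sum_(z <- t) y z k *: e z); apply/funext => j.
rewrite {1}xE /act.
under [RHS]eq_bigr do rewrite scaler_sumr.
rewrite exchange_big; apply: eq_bigr => z _ /=.
rewrite -[c z (x j)]/((c z \o x) j) yP /act scaler_suml.
by apply: eq_bigr => k _; rewrite scalerA.
Qed.

Hypothesis R_noetherian : noetherian R.

(** The relations D of B prolong the complex by one term: exactness for P at one place and for X at
    the next gives it for K. *)
Lemma mx_flat_syzygy K P X (k : {linear K -> P}) (p : {linear P -> X}) :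
  ses k p -> projective P -> mx_flat X -> mx_flat K.
Proof.
move=> kp pP fX s q t A B AB ex.
have [u [D [BD exD]]] := exists_relations B R_noetherian.
apply: (@snake_exact _ _ _ _ _ _ kp _ _ _ _ _ _ _ AB BD).
  exact: projective_flat.
exact: fX.
Qed.

(** Exactness at i says that Tor_(i+1) of the resolved module with X is 0, and each syzygy of X
    lowers the range of vanishing by one. *)
Lemma tor_syzygy e n X G :
    (forall D i, (e <= i)%N -> exact_at X (dmx D i) (dmx D i.+1)) ->
    syzygy n X G ->
  forall D i, (e <= n + i)%N -> exact_at G (dmx D i) (dmx D i.+1).
Proof.
elim: n e X => [|n IH] e X tX; first by move=> /= <-.
move=> [P [K [k [p [pP kp sK]]]]] D i ei.
(* The truncated predecessor covers e = 0, where the range is already complete. *)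
apply: (IH e.-1 K) => //; last by rewrite -ltnS -addSn; case: (e) ei.
move=> D' l el.
apply: (@snake_exact _ _ _ _ _ _ kp _ _ _ _ _ _ _ (dmxK D' l) (dmxK D' l.+1)).
  apply: projective_flat pP _ _ _ _ _ _ _; [exact: dmxK|exact: dmx_exact].
by apply: tX; case: (e) el.
Qed.

(** Vanishing of Tor_1 gives exactness for the relations [dmx D 1] chosen in the resolution; their
    columns are combinations of the columns of any other exact B. *)
Lemma mx_flat_tor X :
  (forall D, exact_at X (dmx D 0) (dmx D 1)) -> mx_flat X.
Proof.
move=> tX s q p A B; move: s q A p B.
apply: (resolution_ind R_noetherian) => D p B _ ex x Dx.
have [y ->] := tX D x Dx.
have [|N NP] := @choice 'I_(rank_ D 2) ('I_p -> R^o)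
    (fun j v => (fun i => dmx D 1 i j : R^o) = act B v).
  move=> j; apply: ex; apply/funext => i.
  have := congr1 (fun M : 'M[R]_(_, _) => M i j) (dmxK D 0).
  by rewrite !mxE.
exists (act (\matrix_(i, j) N j i) y); rewrite -actM; congr act.
apply/matrixP => i j; rewrite mxE.
rewrite -[LHS]/((fun i => dmx D 1 i j : R^o) i) NP; apply: eq_bigr => l _.
by rewrite mxE.
Qed.

Lemma extI_of_ext_vanish Y : (forall D, ext_vanish D 0 Y) -> injective_module Y.
Proof.
move=> ext; apply: baer => I hI.
have [D [i0 [uni IP]]] := ideal_resolution R_noetherian hI.
exact: (ext_vanish_ideal uni hI IP).
Qed.

(** * Flat, injective and projective modules when R has injective dimension at most d *)

Section FiniteInjectiveDimension.
Variables (C J : nat -> lmodType R) (i : forall n, {linear C n -> J n})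
  (q : forall n, {linear J n -> C n.+1}) (d : nat).
Hypotheses (C0 : C 0 = R^o :> lmodType R) (iq : forall n, ses (i n) (q n))
  (iJ : forall n, injective_module (J n)) (iC : injective_module (C d)).

Lemma ext_vanish_ring D k : (d <= k)%N -> ext_vanish D k R^o.
Proof.
move=> dk; rewrite -C0 -(subnKC dk).
apply/(ext_vanish_cosyzygy iq iJ); exact: ext_vanish_injective.
Qed.

(** Hom(-, E) turns the complex for Ext into R, made of transposes, into the complex for Tor with E;
    hence the double transposition. *)
Lemma injective_tor E D k : injective_module E -> (d <= k)%N ->
  exact_at E (dmx D k) (dmx D k.+1).
Proof.
move=> iE dk; rewrite -[dmx D k]trmxK -[dmx D k.+1]trmxK.
by apply: (dual_exact iE); apply: ext_vanish_ring.
Qed.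

(** Flatness of X, applied to the transposed matrices, carries the vanishing of Ext(M, R) above
    degree d to Ext(M, X) for finitely generated M, and the modules R/I are enough for
    injectivity. *)
Lemma flat_cosyzygy X Y : mx_flat X -> cosyzygy d X Y -> injective_module Y.
Proof.
move=> fX cY.
have ext : forall n Z, cosyzygy n X Z -> forall D k, (d <= n + k)%N -> ext_vanish D k Z.
  elim=> [|n IH] Z.
    move=> /= <- D k dk; apply: fX; first exact: dmxTK.
    exact: ext_vanish_ring.
  move=> /cosyzygy_unrcons[Z' [I [j [r [cZ' jr iI]]]]] D k dk.
  apply/(ext_vanish_shift D k jr iI); apply: IH => //.
  by rewrite addnS.
by apply: extI_of_ext_vanish => D; apply: ext cY _ _ _; rewrite addn0.
Qed.

Lemma projective_cosyzygy P Y : projective P -> cosyzygy d P Y -> injective_module Y.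
Proof. by move=> /projective_flat; apply: flat_cosyzygy. Qed.

(* A d-th syzygy G of E is flat, hence so is its syzygy K, which has injective
   dimension at most d; so Ext^1(G, K) = Ext^(d+1)(E, K) = 0. *)
Lemma injective_syzygy E G : injective_module E -> syzygy d E G -> projective G.
Proof.
move=> iE sG.
have fG : mx_flat G.
  apply: mx_flat_tor => D; apply: (tor_syzygy _ sG (e := d)); last by rewrite addn0.
  by move=> D' k; apply: injective_tor.
have [P [p [pP sp _]]] := projective_cover G.
have [K [k kp]] := ses_of_surj sp.
apply: (ext1_projective kp pP).
have [Y cY] := cosyzygy_exists d K.
apply/(ext1_syzygy sG cY); apply: ext1_inj.
exact: flat_cosyzygy (mx_flat_syzygy kp pP fG) cY.
Qed.

End FiniteInjectiveDimension.

End Syzygies.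

(** * Gorenstein projective and injective modules *)

Section Splice.
Variables (R : comNzRingType) (Q : lmodType R -> Prop).
Implicit Types G X Y : lmodType R.

Definition link X Y : Prop :=
  exists (P : lmodType R) (k : {linear X -> P}) (p : {linear P -> Y}),
    Q P /\ ses k p.

Section Construction.
Variable T : lmodType R -> Prop.
Hypotheses (next : forall G, T G -> exists2 G', T G' & link G G')
  (prev : forall G, T G -> exists2 G', T G' & link G' G).

Lemma splice_chain G0 : T G0 -> exists G : int -> lmodType R,
  [/\ G 0 = G0, forall i, T (G i) & forall i, link (G i) (G (i - 1))].
Proof.
move=> T0.
have [|s sP] := @choice (lmodType R) (lmodType R) (fun G G' => T G -> T G' /\ link G G').
  by move=> G; have [/next[G' TG' l]|nT] := pselect (T G); [exists G'|exists G].
have [|r rP] := @choice (lmodType R) (lmodType R) (fun G G' => T G -> T G' /\ link G' G).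
  by move=> G; have [/prev[G' TG' l]|nT] := pselect (T G); [exists G'|exists G].
have Ts n : T (iter n s G0) by elim: n => //= n /sP[].
have Tr n : T (iter n r G0) by elim: n => //= n /rP[].
(* A link leads from degree i to i - 1, so [prev] fills the positive degrees and [next] the negative
   ones. *)
exists (fun i => match i with Posz n => iter n r G0 | Negz n => iter n.+1 s G0 end).
split=> [|[n|n]|[[|n]|n]] //.
- by have [] := sP _ T0.
- have -> : n.+1%:Z - 1 = n%:Z by rewrite -addn1 PoszD addrK.
  by have [] := rP _ (Tr n).
- have -> : Negz n - 1 = Negz n.+1 by rewrite !NegzE -opprD -[in RHS]addn1 PoszD.
  by have [] := sP _ (Ts n.+1).
Qed.

Lemma splice G0 : T G0 -> exists (G P : int -> lmodType R)
    (k : forall i, {linear G i -> P (i - 1)}) (p : forall i, {linear P i -> G i}),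
  [/\ G 0 = G0, forall i, T (G i), forall i, Q (P i) &
      forall i, ses (k i) (p (i - 1))].
Proof.
move=> /splice_chain[G [G0E TG lG]].
have lG' j : link (G (j + 1)) (G j).
  by have := lG (j + 1); rewrite addrK.
have [P [k /dep_choice[p PP]]] := dep_choice2 lG'.
have ex i : exists k : {linear G i -> P (i - 1)}, ses k (p (i - 1)).
  (* The map is generalized so that i - 1 + 1 can be rewritten in its type. *)
  have [_] := PP (i - 1); move: (k (i - 1)); rewrite subrK => k' ?.
  by exists k'.
have [k' kp] := dep_choice ex.
by exists G, P, k', p; split=> // i; have [] := PP i.
Qed.

End Construction.

Section SplicedComplex.
Variables (G P : int -> lmodType R) (k : forall i, {linear G i -> P (i - 1)})
  (p : forall i, {linear P i -> G i}).
Hypothesis kp : forall i, ses (k i) (p (i - 1)).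

Let spliced_diffK i x : (k (i - 1) \o p (i - 1)) ((k i \o p i) x) = 0.
Proof. by rewrite /= (sesK _ (kp i)) linear0. Qed.

Definition spliced : complex R :=
  @Complex R P (fun i => k i \o p i) spliced_diffK.

Lemma spliced_ses i : exists k' : {linear G (i + 1) -> P i}, ses k' (p i).
Proof. by have := kp (i + 1); move: (k (i + 1)); rewrite addrK => k' ?; exists k'. Qed.

Lemma spliced_surj i : surj (p i).
Proof. by have [k' []] := spliced_ses i. Qed.

Lemma spliced_acyclic : acyclic spliced.
Proof.
move=> i z /= kpz; have [ik _ _] := kp (i - 1).
have [_ _ h] := kp i; have /h[y <-] := inj0 ik kpz.
by have [x <-] := spliced_surj y; exists x.
Qed.

Lemma spliced_cokernel j : exists i (c : {linear spliced (i - 1) -> G j}),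
  is_cokernel (diff spliced i) c.
Proof.
have -> : j = j + 1 - 1 by rewrite addrK.
exists (j + 1), (p (j + 1 - 1)); split; first exact: spliced_surj.
move=> x; have [_ _ h] := kp (j + 1); rewrite h; split=> [[y <-]|[y <-]].
  by have [z <-] := spliced_surj y; exists z.
by exists (p _ y).
Qed.

Lemma spliced_kernel j : exists i (c : {linear G j -> spliced i}),
  is_kernel (diff spliced i) c.
Proof.
exists (j - 1), (k j); have [ik _ h] := kp j; split=> // x.
have [ik' _ _] := kp (j - 1); rewrite -h /=; split=> [|->]; first exact: inj0.
exact: linear0.
Qed.

End SplicedComplex.
End Splice.

Section Gorenstein.
Variable R : comNzRingType.
Implicit Types G E N Q X Y : lmodType R.

(** Links on both sides splice to an acyclic complex of projectives whose cycles all lie in T, and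
    Ext^1(T, Q) = 0 at these cycles is acyclicity of Hom into Q. Hence only one step in each
    direction has to be supplied. *)
Lemma gorenstein_projective_of_class (T : lmodType R -> Prop) :
    (forall G, T G -> exists2 G', T G' & link (@projective R) G G') ->
    (forall G, T G -> exists2 G', T G' & link (@projective R) G' G) ->
    (forall G Q, T G -> projective Q -> ext1 G Q) ->
  forall G, T G -> gorenstein_projective G.
Proof.
move=> next prev ext G0 TG0.
have [G [P [k [p [GE TG pP kp]]]]] := splice next prev TG0.
exists (spliced kp); split.
- exact: spliced_acyclic.
- exact: pP.
- move=> Q pQ i phi phi0.
  have [_ sp ker] := kp i.
  have [|f fP] := linear_factor_surj (f := phi) sp.
    move=> x /ker[y <-]; have [z <-] := spliced_surj kp y.
    exact: (phi0 z).
  have [u uP] := ext _ _ (TG _) pQ _ _ _ _ (kp (i - 1)) f.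
  by exists u => x; rewrite /= uP fP.
- by rewrite -GE; apply: spliced_cokernel.
Qed.

Lemma gorenstein_injective_of_class (T : lmodType R -> Prop) :
    (forall G, T G -> exists2 G', T G' & link (@injective_module R) G G') ->
    (forall G, T G -> exists2 G', T G' & link (@injective_module R) G' G) ->
    (forall E G, injective_module E -> T G -> ext1 E G) ->
  forall G, T G -> gorenstein_injective G.
Proof.
move=> next prev ext G0 TG0.
have [G [P [k [p [GE TG iP kp]]]]] := splice next prev TG0.
exists (spliced kp); split.
- exact: spliced_acyclic.
- exact: iP.
- move=> E iE i phi phi0.
  have [ik _ ker] := kp i; have [ik' _ _] := kp (i - 1).
  have [|f fP] := linear_factor_inj (f := phi) ik.
    by move=> x; apply/ker; apply: (inj0 ik' (phi0 x)).
  have [k' kp'] := spliced_ses kp i.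
  have [g gP] := ext1_lift (ext _ _ iE (TG _)) kp' f.
  by exists g => x; rewrite /= gP fP.
- by rewrite -GE; apply: spliced_kernel.
Qed.

(** The split sequence makes a projective or injective module its own neighbour on both sides. *)
Lemma link_self (S : lmodType R -> Prop) X : S (X * X)%type -> link S X X.
Proof.
move=> SX; have [h hP] := pair_linear (idfun : {linear X -> X}) (\0 : {linear X -> X}).
exists (X * X)%type, h, snd; split=> //; split=> [x y|y|[x y]].
- by rewrite !hP => -[].
- by exists (0, y).
- by split=> [/= ->|[z <-]]; [exists x; rewrite hP|rewrite hP].
Qed.

Lemma projective_gorenstein G : projective G -> gorenstein_projective G.
Proof.
apply: gorenstein_projective_of_class => {}G => [pG|pG|Q pG _]; last exact: ext1_proj.
- by exists G => //; apply: link_self; apply: projective_prod.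
- by exists G => //; apply: link_self; apply: projective_prod.
Qed.

Lemma injective_gorenstein G : injective_module G -> gorenstein_injective G.
Proof.
apply: gorenstein_injective_of_class => [{}G iG|{}G iG|E {}G _]; last exact: ext1_inj.
- by exists G => //; apply: link_self; apply: injective_prod.
- by exists G => //; apply: link_self; apply: injective_prod.
Qed.

Variable d : nat.
Hypotheses
  (inj_syz : forall E G, injective_module E -> syzygy d E G -> projective G)
  (proj_cosyz : forall Q Y, projective Q -> cosyzygy d Q Y -> injective_module Y).

Lemma syzygy_gorenstein N G : syzygy d N G -> gorenstein_projective G.
Proof.
move=> sG.
apply: (@gorenstein_projective_of_class (fun G => exists N, syzygy d N G)); last by exists N.
- move=> {N sG}G [N sG].
  have [I [i [iI ii]]] := enough_injectives N.
  have [N' [q iq]] := ses_of_inj ii.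
  have [B [C [f [g [fg sB sC]]]]] := horseshoe_syzygy iq sG.
  by exists C; [exists N'|exists B, f, g; split=> //; apply: inj_syz sB].
- move=> {N sG}G [N sG].
  have [P [p [pP sp _]]] := projective_cover G.
  have [K [k kp]] := ses_of_surj sp.
  (* A syzygy of G is a (d+1)-th syzygy of N, that is a d-th syzygy of the first syzygy K' of N. *)
  have [P' [K' [k' [p' [_ _ sK]]]]] := syzygy_rcons sG kp pP.
  by exists K; [exists K'|exists P, k, p].
- move=> {N sG}G Q [N sG] pQ.
  have [Y cY] := cosyzygy_exists d Q.
  by apply/(ext1_syzygy sG cY); apply: ext1_inj; apply: proj_cosyz cY.
Qed.

Lemma cosyzygy_gorenstein N G : cosyzygy d N G -> gorenstein_injective G.
Proof.
move=> cG.
apply: (@gorenstein_injective_of_class (fun G => exists N, cosyzygy d N G)); last by exists N.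
- move=> {N cG}G [N cG].
  have [I [i [iI ii]]] := enough_injectives G.
  have [C [q iq]] := ses_of_inj ii.
  have [I' [C' [i' [q' [_ _ cC]]]]] := cosyzygy_rcons cG iq iI.
  by exists C; [exists C'|exists I, i, q].
- move=> {N cG}G [N cG].
  have [P [p [pP sp _]]] := projective_cover N.
  have [K [k kp]] := ses_of_surj sp.
  have [A [B [f [g [fg cA cB]]]]] := horseshoe_cosyzygy kp cG.
  by exists A; [exists K|exists B, f, g; split=> //; apply: proj_cosyz cB].
- move=> E {N cG}G iE [N cG].
  have [K sK] := syzygy_exists d E.
  by apply/(ext1_syzygy sK cG); apply: ext1_proj; apply: inj_syz sK.
Qed.

End Gorenstein.

(** * Tensor products and Gorenstein flat modules *)

Section TensorTheory.
Variable R : comNzRingType.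
Implicit Types A B E F G K P Q : lmodType R.

Definition pure E F (e : E) (f : F) : tensor E F := tensor_class [:: (e, f)].

Lemma tensor_class_sum E F (s : seq (E * F)) :
  tensor_class s = \sum_(p <- s) pure p.1 p.2.
Proof.
elim: s => [|[e f] s IH]; first by rewrite big_nil.
by rewrite big_cons -IH -[RHS]/(tensor_add _ _) /pure tensor_addE.
Qed.

Lemma tensor_ind E F (S : tensor E F -> Prop) :
    S 0 -> (forall e f, S (pure e f)) -> (forall x y, S x -> S y -> S (x + y)) ->
  forall x, S x.
Proof.
move=> S0 Sp SD x; rewrite -[x]tensor_reprK tensor_class_sum.
by elim/big_ind: _.
Qed.

Lemma tensor_lift E F A (b : E -> F -> A) :
    (forall f, linear (b^~ f)) -> (forall e, linear (b e)) ->
  exists g : {linear tensor E F -> A}, forall e f, g (pure e f) = b e f.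
Proof.
move=> bl br.
pose S (s : seq (E * F)) := \sum_(p <- s) b p.1 p.2.
have bDl e e' f : b (e + e') f = b e f + b e' f.
  by have := bl f 1 e e'; rewrite !scale1r.
have bDr e f f' : b e (f + f') = b e f + b e f'.
  by have := br e 1 f f'; rewrite !scale1r.
have b0 f : b 0 f = 0 by apply: (addrI (b 0 f)); rewrite -bDl !addr0.
have b0' e : b e 0 = 0 by apply: (addrI (b e 0)); rewrite -bDr !addr0.
have bZl a e f : b (a *: e) f = a *: b e f.
  by have := bl f a e 0; rewrite b0 !addr0.
have bZr a e f : b e (a *: f) = a *: b e f.
  by have := br e a f 0; rewrite b0' !addr0.
have Srel s t : tensor_rel s t -> S s = S t.
  elim=> {s t} [s|s t _ ->|s t u _ -> _ ->|s s' t t' _ e _ e'|s t|f|e e' f|e f f'|a e f] //.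
  - by rewrite /S !big_cat /= -!/(S _) e e'.
  - by rewrite /S !big_cat /= addrC.
  - by rewrite /S big_seq1 big_nil b0.
  - by rewrite /S !big_cons !big_nil !addr0 bDl.
  - by rewrite /S !big_cons !big_nil !addr0 bDr.
  - by rewrite /S !big_seq1 /= bZl bZr.
have Sclass s : S (repr (tensor_class s)) = S s by apply/Srel/tensor_repr_class.
have lg : linear (fun x : tensor E F => S (repr x)).
  move=> c x y; rewrite -[x]tensor_reprK -[y]tensor_reprK.
  rewrite -![_ + _]/(tensor_add _ _) -![_ *: _]/(tensor_scale _ _).
  rewrite tensor_scaleE tensor_addE !Sclass /S big_cat /=; congr (_ + _).
  rewrite /scale_sum big_map scaler_sumr; apply: eq_bigr => p _ /=.
  exact: bZl.
by exists (mk_linear lg) => e f; rewrite /= Sclass /S big_seq1.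
Qed.

Lemma pureDl E F (e e' : E) (f : F) : pure (e + e') f = pure e f + pure e' f.
Proof.
rewrite -[RHS]/(tensor_add _ _) tensor_addE; apply/tensor_classP; exact: tr_addl.
Qed.

Lemma pureDr E F (e : E) (f f' : F) : pure e (f + f') = pure e f + pure e f'.
Proof.
rewrite -[RHS]/(tensor_add _ _) tensor_addE; apply/tensor_classP; exact: tr_addr.
Qed.

Lemma pureZl E F a (e : E) (f : F) : pure (a *: e) f = a *: pure e f.
Proof. by rewrite -[RHS]/(tensor_scale _ _) tensor_scaleE. Qed.

Lemma pureZr E F a (e : E) (f : F) : pure e (a *: f) = a *: pure e f.
Proof.
rewrite -pureZl; apply/tensor_classP/tr_sym; exact: tr_scale.
Qed.

Lemma pure_linearl E F (f : F) : linear (fun e : E => pure e f).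
Proof. by move=> c x y; rewrite pureDl pureZl. Qed.

Lemma pure_linearr E F (e : E) : linear (fun f : F => pure e f).
Proof. by move=> c x y; rewrite pureDr pureZr. Qed.

Lemma pure0l E F (f : F) : pure (0 : E) f = 0.
Proof. by apply/tensor_classP/tr_zero. Qed.

Lemma pure0r E F (e : E) : pure e (0 : F) = 0.
Proof. by rewrite -(scale0r 0) pureZr scale0r. Qed.

Lemma tensor_map_pure E F F' (g : {linear F -> F'}) (e : E) (f : F) :
  tensor_map E g (pure e f) = pure e (g f).
Proof. exact: tensor_mapE. Qed.

Lemma tensor_eq E F A (g h : {linear tensor E F -> A}) :
  (forall e f, g (pure e f) = h (pure e f)) -> g =1 h.
Proof.
move=> gh; elim/tensor_ind => [|//|x y gx gy]; first by rewrite !linear0.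
by rewrite !linearD gx gy.
Qed.

Lemma tensor_lmap E E' F (h : {linear E -> E'}) :
  exists g : {linear tensor E F -> tensor E' F}, forall e f, g (pure e f) = pure (h e) f.
Proof.
apply: tensor_lift => [f c x y|e]; last exact: pure_linearr.
by rewrite linearP; apply: pure_linearl.
Qed.

(** A dual basis of P gives coordinates on [tensor P F] with values in F, so exactness of tensoring
    with P is checked coordinatewise. *)
Lemma tensor_coordl (S : eqType) P (e : S -> P) (c : S -> {linear P -> R^o}) F :
    dbasis e c ->
  exists psi : S -> {linear tensor P F -> F},
    (forall s p f, psi s (pure p f) = c s p *: f) /\
    forall x, finsum (fun s => pure (e s) (psi s x)) x.
Proof.
move=> bas.
have [|psi psiP] := @choice S {linear tensor P F -> F}
    (fun s g => forall p f, g (pure p f) = c s p *: f).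
  move=> s; apply: tensor_lift => [f k x y|p k x y].
    by rewrite linearP scalerDl scalerA.
  by rewrite scalerDr !scalerA mulrC.
exists psi; split=> //; elim/tensor_ind => [|p f|x y fx fy].
- by exists [::]; split=> [//|s _|]; rewrite ?big_nil // linear0 pure0r.
- have [t [ut t0 pE]] := db_sum bas p; exists t; split=> // [s /t0 cs|].
    by rewrite psiP cs scale0r pure0r.
  rewrite {1}pE -[LHS]/(mk_linear (@pure_linearl P F f) _) linear_sum /=.
  by apply: eq_bigr => s _; rewrite psiP pureZl pureZr.
- have := finsumP 1 fx fy; rewrite scale1r; congr (finsum _ _).
  by apply/funext => s; rewrite scale1r linearD pureDr.
Qed.

Lemma tensor_coordr (S : eqType) P (e : S -> P) (c : S -> {linear P -> R^o}) E :
    dbasis e c ->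
  exists psi : S -> {linear tensor E P -> E},
    (forall s p f, psi s (pure f p) = c s p *: f) /\
    forall x, finsum (fun s => pure (psi s x) (e s)) x.
Proof.
move=> bas.
have [|psi psiP] := @choice S {linear tensor E P -> E}
    (fun s g => forall p f, g (pure f p) = c s p *: f).
  move=> s; have [||g gP] := @tensor_lift E P E (fun f p => c s p *: f).
  - by move=> p k x y; rewrite scalerDr !scalerA mulrC.
  - by move=> f k x y; rewrite linearP scalerDl scalerA.
  - by exists g.
exists psi; split=> //; elim/tensor_ind => [|f p|x y fx fy].
- by exists [::]; split=> [//|s _|]; rewrite ?big_nil // linear0 pure0l.
- have [t [ut t0 pE]] := db_sum bas p; exists t; split=> // [s /t0 cs|].
    by rewrite psiP cs scale0r pure0l.
  rewrite {1}pE -[LHS]/(mk_linear (@pure_linearr E P f) _) linear_sum /=.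
  by apply: eq_bigr => s _; rewrite psiP pureZl pureZr.
- have := finsumP 1 fx fy; rewrite scale1r; congr (finsum _ _).
  by apply/funext => s; rewrite scale1r linearD pureDl.
Qed.

Lemma flat_projective P : projective P -> flat P.
Proof.
move=> /projective_dbasis[S [e [c bas]]] A B i ii.
have [psiA [psiAE coordA]] := tensor_coordl A bas.
have [psiB [psiBE _]] := tensor_coordl B bas.
apply: inj0P => x ix; apply: finsum0 (coordA x) => s.
suff -> : psiA s x = 0 by rewrite pure0r.
apply: (inj0 ii).
have nat := tensor_eq (g := i \o psiA s) (h := psiB s \o tensor_map P i).
rewrite -[LHS]/((i \o psiA s) x) nat /= ?ix ?linear0 // => p a.
by rewrite tensor_map_pure psiAE psiBE linearZ.
Qed.

Lemma tensor_acyclic_projective E (X : complex R) :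
  projective E -> acyclic X -> acyclic (tensor_complex E X).
Proof.
move=> /projective_dbasis[S [e [c bas]]] aX i z /= dz.
have [psi [psiE coord]] := tensor_coordl (X (i - 1)) bas.
have [psi' [psi'E _]] := tensor_coordl (X (i - 1 - 1)) bas.
have [|y yP] := @choice S (X i) (fun s y => diff X i y = psi s z).
  move=> s; apply: aX.
  have nat := tensor_eq (g := diff X (i - 1) \o psi s)
    (h := psi' s \o tensor_map E (diff X (i - 1))).
  rewrite -[LHS]/((diff X (i - 1) \o psi s) z) nat /= ?dz ?linear0 // => p a.
  by rewrite tensor_map_pure psiE psi'E linearZ.
have [t [_ _ zE]] := coord z.
exists (\sum_(s <- t) pure (e s) (y s)); rewrite linear_sum zE.
by apply: eq_bigr => s _; rewrite /= tensor_map_pure yP.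
Qed.

(** Tensoring K -> Q -> E with the projective modules X i keeps it short exact, and two acyclic
    complexes in a short exact sequence make the third acyclic. *)
Lemma tensor_acyclic_cokernel K Q E (k : {linear K -> Q}) (p : {linear Q -> E})
    (X : complex R) :
    ses k p -> (forall i, projective (X i)) ->
    acyclic (tensor_complex K X) -> acyclic (tensor_complex Q X) ->
  acyclic (tensor_complex E X).
Proof.
move=> kp pX aK aQ i z /= dz.
have [ik sp kerp] := kp.
have nat (A B : lmodType R) (f : {linear A -> B}) j l (g : {linear X j -> X l})
    (fj : {linear tensor A (X j) -> tensor B (X j)})
    (fl : {linear tensor A (X l) -> tensor B (X l)}) :
    (forall e x, fj (pure e x) = pure (f e) x) ->
    (forall e x, fl (pure e x) = pure (f e) x) ->
    forall x, fl (tensor_map A g x) = tensor_map B g (fj x).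
  move=> fjP flP; apply: (tensor_eq (g := fl \o tensor_map A g) (h := tensor_map B g \o fj)).
  by move=> e x /=; rewrite tensor_map_pure fjP flP tensor_map_pure.
have inj j (f : {linear tensor K (X j) -> tensor Q (X j)}) :
    (forall e x, f (pure e x) = pure (k e) x) -> injective f.
  move=> fP; have [S [e [c bas]]] := projective_dbasis (pX j).
  have [psi [psiE coord]] := tensor_coordr K bas.
  have [psi' [psi'E _]] := tensor_coordr Q bas.
  apply: inj0P => x fx; apply: finsum0 (coord x) => s.
  suff -> : psi s x = 0 by rewrite pure0l.
  apply: (inj0 ik).
  have h := tensor_eq (g := k \o psi s) (h := psi' s \o f).
  rewrite -[LHS]/((k \o psi s) x) h /= ?fx ?linear0 // => u v.
  by rewrite fP psiE psi'E linearZ.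
have ker j (f : {linear tensor K (X j) -> tensor Q (X j)})
    (g : {linear tensor Q (X j) -> tensor E (X j)}) :
    (forall e x, f (pure e x) = pure (k e) x) ->
    (forall e x, g (pure e x) = pure (p e) x) ->
    forall x, g x = 0 -> exists y, f y = x.
  move=> fP gP x gx; have [S [e [c bas]]] := projective_dbasis (pX j).
  have [psi [psiE coord]] := tensor_coordr Q bas.
  have [psi' [psi'E _]] := tensor_coordr E bas.
  have [|y yP] := @choice S K (fun s y => k y = psi s x).
    move=> s; apply/kerp.
    have h := tensor_eq (g := p \o psi s) (h := psi' s \o g).
    rewrite -[LHS]/((p \o psi s) x) h /= ?gx ?linear0 // => u v.
    by rewrite gP psiE psi'E linearZ.
  have [t [_ _ xE]] := coord x.
  exists (\sum_(s <- t) pure (y s) (e s)); rewrite linear_sum xE.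
  by apply: eq_bigr => s _; rewrite fP yP.
have [kj kjP] := tensor_lmap (X (i - 1)) k.
have [kl klP] := tensor_lmap (X (i - 1 - 1)) k.
have [km kmP] := tensor_lmap (X (i - 1 - 1 - 1)) k.
have [ph phP] := tensor_lmap (X i) p.
have [pj pjP] := tensor_lmap (X (i - 1)) p.
have [pl plP] := tensor_lmap (X (i - 1 - 1)) p.
have [y yz] : exists y, pj y = z.
  elim/tensor_ind: (z) => [|e x|u v [u' <-] [v' <-]].
  - by exists 0; rewrite linear0.
  - by have [e' <-] := sp e; exists (pure e' x).
  - by exists (u' + v'); rewrite linearD.
have pk j (f : {linear tensor K (X j) -> tensor Q (X j)})
    (g : {linear tensor Q (X j) -> tensor E (X j)}) :
    (forall e x, f (pure e x) = pure (k e) x) ->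
    (forall e x, g (pure e x) = pure (p e) x) -> forall x, g (f x) = 0.
  move=> fP gP; elim/tensor_ind => [|e x|u v gu gv]; first by rewrite !linear0.
    by rewrite fP gP (sesK _ kp) pure0l.
  by rewrite !linearD gu gv addr0.
have [u uE] : exists u, kl u = tensor_map Q (diff X (i - 1)) y.
  by apply: (ker _ _ _ klP plP); rewrite (nat _ _ _ _ _ _ _ _ pjP plP) yz.
have [w wE] : exists w, tensor_map K (diff X (i - 1)) w = u.
  apply: (aK (i - 1)); apply: (inj0 (inj _ _ kmP)) => /=.
  rewrite (nat _ _ _ _ _ _ _ _ klP kmP) uE.
  exact: tensor_diffK.
have [v vE] : exists v, tensor_map Q (diff X i) v = y - kj w.
  have e := nat _ _ k _ _ (diff X (i - 1)) kj kl kjP klP w.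
  apply: (aQ i); rewrite -[LHS]/(tensor_map Q (diff X (i - 1)) (y - kj w)).
  by rewrite linearB /= -e wE uE subrr.
exists (ph v).
rewrite -[LHS]/(tensor_map E (diff X i) (ph v)).
rewrite -(nat _ _ p _ _ (diff X i) ph pj phP pjP) vE linearB /= yz.
by rewrite (pk _ _ _ kjP pjP) subr0.
Qed.

(** Acyclicity climbs from the projective n-th syzygy back to E, one cokernel at a time. Finite
    projective dimension of E replaces boundedness of X. *)
Lemma tensor_acyclic_syzygy n E G (X : complex R) :
    syzygy n E G -> projective G -> (forall i, projective (X i)) -> acyclic X ->
  acyclic (tensor_complex E X).
Proof.
move=> sG pG pX aX; elim: n E sG => [|n IH] E /=.
  by move=> ->; apply: tensor_acyclic_projective.
move=> [P [K [k [p [pP kp /IH aK]]]]].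
by apply: (tensor_acyclic_cokernel kp) => //; apply: tensor_acyclic_projective.
Qed.

Lemma gorenstein_projective_flat d G :
    (forall E G, injective_module E -> syzygy d E G -> projective G) ->
  gorenstein_projective G -> gorenstein_flat G.
Proof.
move=> inj_syz [P [aP pP _ cok]]; exists P; split=> // [i|E iE].
  exact: flat_projective.
have [K sK] := syzygy_exists d E.
exact: tensor_acyclic_syzygy sK (inj_syz _ _ iE sK) pP aP.
Qed.

End TensorTheory.

(** * Derived category and mapping cones *)

Section DerivedCategory.
Variable R : comNzRingType.
Implicit Types X Y Z M N K F : complex R.

Lemma is_diso_inv X Y (f : dmor X Y) : is_diso f -> exists g : dmor Y X,
  [/\ is_diso g, deq (dcomp g f) (did X) & deq (dcomp f g) (did Y)].
Proof. by move=> [g [gf fg]]; exists g; split=> //; exists f. Qed.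

Lemma deq_cancel X Y Z (g : dmor Y X) (f : dmor X Y) (h : dmor Z X) :
  deq (dcomp g f) (did X) -> deq (dcomp g (dcomp f h)) h.
Proof.
move=> gf; apply: deq_trans (deq_assoc _ _ _) _.
exact: deq_trans (deq_comp gf (deq_refl _)) (deq_idl _).
Qed.

Lemma is_diso_comp X Y Z (g : dmor Y Z) (f : dmor X Y) :
  is_diso g -> is_diso f -> is_diso (dcomp g f).
Proof.
move=> [g' [gl gr]] [f' [fl fr]]; exists (dcomp f' g'); split.
- apply: deq_trans (deq_sym (deq_assoc _ _ _)) _.
  exact: deq_trans (deq_comp (deq_refl _) (deq_cancel f gl)) fl.
- apply: deq_trans (deq_sym (deq_assoc _ _ _)) _.
  exact: deq_trans (deq_comp (deq_refl _) (deq_cancel g' fr)) gr.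
Qed.

Lemma is_diso_id X : is_diso (did X).
Proof. by exists (did X); split; apply: deq_idl. Qed.

Lemma is_diso_quasi_iso X Y (f : chain_map X Y) : quasi_iso f -> is_diso (dmap f).
Proof. by move=> qf; exists (dinv qf); split; [apply: deq_invl|apply: deq_invr]. Qed.

Lemma disomorphic_refl X : disomorphic X X.
Proof. by exists (did X); apply: is_diso_id. Qed.

Lemma disomorphic_sym X Y : disomorphic X Y -> disomorphic Y X.
Proof. by move=> [f /is_diso_inv[g [dg _ _]]]; exists g. Qed.

Lemma disomorphic_trans X Y Z : disomorphic X Y -> disomorphic Y Z -> disomorphic X Z.
Proof. by move=> [f df] [g dg]; exists (dcomp g f); apply: is_diso_comp. Qed.

Lemma quasi_iso_disomorphic X Y (f : chain_map X Y) : quasi_iso f -> disomorphic X Y.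
Proof. by move=> qf; exists (dmap f); apply: is_diso_quasi_iso. Qed.

Definition chain_iso X Y (f : chain_map X Y) : Prop :=
  forall i, injective (f i) /\ surj (f i).

Lemma boundary0 X i : @boundary R X i 0.
Proof. by exists 0; rewrite linear0. Qed.

Lemma chain_iso_quasi_iso X Y (f : chain_map X Y) : chain_iso f -> quasi_iso f.
Proof.
move=> isof i; split=> [z dz [y yE]|z dz].
  have [x xy] := (isof i).2 y; exists x; apply: (isof (i - 1)).1.
  by rewrite chain_mapP xy.
have [x xz] := (isof (i - 1)).2 z; exists x.
  by apply: (inj0 (isof (i - 1 - 1)).1); rewrite chain_mapP xz.
by rewrite xz subrr; apply: boundary0.
Qed.

Definition comp_map X Y Z (g : chain_map Y Z) (f : chain_map X Y) : chain_map X Z.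
Proof.
by exists (fun i => g i \o f i) => i x; rewrite /= !chain_mapP.
Defined.

Lemma comp_quasi_iso X Y Z (g : chain_map Y Z) (f : chain_map X Y) :
  quasi_iso g -> quasi_iso f -> quasi_iso (comp_map g f).
Proof.
move=> qg qf i; have [gi gs] := qg i; have [fi fs] := qf i; split=> z dz.
  move=> bz; apply: fi => //; apply: gi => //.
  by rewrite -chain_mapP dz linear0.
have [y dy [b bE]] := gs z dz; have [x dx [c cE]] := fs y dy.
exists x => //; exists (b + g i c).
by rewrite linearD bE -chain_mapP cE linearB addrA subrK.
Qed.

Lemma deq_dmap X Y (f g : chain_map X Y) :
  (forall i x, f i x = g i x) -> deq (dmap f) (dmap g).
Proof.
move=> fg; apply: deq_trans (deq_sym (deq_idl (dmap f))) _.
by apply: deq_map_comp => i x /=; rewrite fg.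
Qed.

(** The triangle F -> M' -> cone f is transported along the isomorphisms, with the zero complex as
    the complement L in [thick]. *)
Lemma thick_extend (T : complex R -> Prop) n F M N M' (f : chain_map F M') :
    thick1 T F -> disomorphic M M' -> disomorphic N (cone f) -> thick T n.+1 N ->
  thick T n.+2 M.
Proof.
move=> tF [a da] [c dc] tN.
pose pr : chain_map (direct_sum (zero_complex R) M) M :=
  @ChainMap R (direct_sum (zero_complex R) M) M
    (fun i => (snd : {linear _ -> _})) (fun i x => erefl).
have qp : quasi_iso pr.
  apply: chain_iso_quasi_iso => i; split=> [[x y] [x' y'] /= ->|y].
    congr (_, _); rewrite /zero_complex /in_degree0 /= in x x' *.
    by case: (i == 0) x x' => x x'; rewrite [x]thinmx0 [x']thinmx0.
  by exists (0, y).
pose b := dcomp a (dmap pr); have db : is_diso b.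
  by apply: is_diso_comp da _; apply: is_diso_quasi_iso qp.
have [b' [_ b'b bb']] := is_diso_inv db.
have [c' [_ c'c cc']] := is_diso_inv dc.
exists F, (zero_complex R), N, (dcomp b' (dmap f)),
  (dcomp c' (dcomp (dmap (cone_in f)) b)), (dcomp (dmap (cone_out f)) c).
split=> //; exists F, M', f, (did F), b, c; split; first by split=> //; apply: is_diso_id.
split.
- exact: deq_trans (deq_cancel _ bb') (deq_sym (deq_idr _)).
- exact: deq_cancel.
- apply: deq_trans (deq_comp (_ : deq _ (did _)) (deq_refl _)) (deq_idl _).
  exact: deq_dmap.
Qed.

Definition cses X Y Z (f : chain_map X Y) (g : chain_map Y Z) : Prop :=
  forall i, ses (f i) (g i).

Lemma sub_cancel (V : zmodType) (a b c : V) : a - b + (b + c - a) = c.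
Proof. by rewrite !addrA subrK addrAC subrr add0r. Qed.

(** * Cones built on a short exact sequence of complexes *)

Section ConeSub.
Variables (X K F M : complex R) (k : chain_map K F) (p : chain_map F M)
  (q : chain_map X K).
Hypotheses (kp : cses k p) (qq : quasi_iso q).

Lemma cone_projP i (x : cone (comp_map k q) i) :
  (p (i - 1) \o snd) (diff (cone (comp_map k q)) i x) = diff M i ((p i \o snd) x).
Proof. by rewrite /= linearD /= (sesK _ (kp _)) add0r chain_mapP. Qed.

Definition cone_proj : chain_map (cone (comp_map k q)) M :=
  @ChainMap R (cone (comp_map k q)) M
    (fun i => (p i \o (snd : {linear (X (i - 1) * F i)%type -> F i})))
    cone_projP.

(** A resolution X of the kernel K yields one of M: the cone of X -> F, an extension of [shift X] by
    F. Thus M costs one layer more than K. *)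
Lemma cone_proj_quasi_iso : quasi_iso cone_proj.
Proof.
move=> i; split=> [[x f] /= dz [m mE]|m dm].
  case: dz => /eqP; rewrite oppr_eq0 => /eqP dx df.
  have [_ sp _] := kp i; have [f' f'm] := sp m.
  have [ki1 _ kerp] := kp (i - 1).
  have [|y yE] := (kerp (f - diff F i f')).1.
    by rewrite linearB chain_mapP f'm mE subrr.
  have [ki2 _ _] := kp (i - 1 - 1).
  have dy : diff K (i - 1) y = - q (i - 1 - 1) x.
    apply: ki2; rewrite chain_mapP yE linearB diffK subr0 linearN.
    exact/esym/addr0_eq.
  have [x' x'E] : boundary x.
    by apply: (qq (i - 1)).1 => //; exists (- y); rewrite linearN dy opprK.
  (* The element y need not be a cycle, but its sum with q x' is one, and so comes from a cycle x''
     of X up to a boundary. *)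
  have [|x'' dx'' [y' y'E]] := (qq i).2 (q (i - 1) x' + y).
    by rewrite linearD -chain_mapP x'E dy subrr.
  exists (x'' - x', k i y' + f'); rewrite /= /cone_diff /=; congr (_, _).
    by rewrite linearB dx'' sub0r opprK.
  have e : q (i - 1) (x'' - x') + (q (i - 1) x' + y - q (i - 1) x'') = y.
    by rewrite linearB sub_cancel.
  by rewrite [diff F i _]linearD -chain_mapP y'E addrA -linearD e yE subrK.
have [_ sp _] := kp (i - 1); have [f fm] := sp m.
have [ki2 _ kerp] := kp (i - 1 - 1).
have [|y yE] := (kerp (diff F (i - 1) f)).1; first by rewrite chain_mapP fm.
have [ki3 _ _] := kp (i - 1 - 1 - 1).
have [|x dx [y' y'E]] := (qq (i - 1)).2 y.
  by apply: (inj0 ki3); rewrite chain_mapP yE diffK.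
exists (- x, f - k (i - 1) y'); last first.
  rewrite /= linearB /= (sesK _ (kp _)) subr0 fm subrr; exact: boundary0.
apply: injective_projections => /=; first by rewrite linearN dx !oppr0.
have e : q (i - 1 - 1) (- x) = diff K (i - 1) y' - y.
  by rewrite linearN y'E [RHS]addrAC subrr add0r.
by rewrite e !linearB /= yE chain_mapP addrA subrK subrr.
Qed.

End ConeSub.

Section ConeQuotient.
Variables (M F C X : complex R) (j : chain_map M F) (p : chain_map F C)
  (q : chain_map C X).
Hypotheses (jp : cses j p) (qq : quasi_iso q).

Lemma cone_incl_exists : exists psi : chain_map (shift M) (cone (comp_map q p)),
  forall i x, psi i x = (j (i - 1) x, 0).
Proof.
have ex i : exists psi : {linear shift M i -> cone (comp_map q p) i},
    forall x, psi x = (j (i - 1) x, 0).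
  have [h hP] := pair_linear (j (i - 1)) (\0 : {linear M (i - 1) -> X i}).
  by exists h => x; rewrite hP.
have [psi psiE] := dep_choice ex.
have ch i (x : shift M i) : psi (i - 1) (diff (shift M) i x) =
    diff (cone (comp_map q p)) i (psi i x).
  rewrite !psiE /= /cone_diff /=.
  by rewrite linearN chain_mapP (sesK _ (jp _)) !linear0 addr0.
by exists (ChainMap ch).
Qed.

(** Dual to [cone_proj_quasi_iso]: a coresolution X of the cokernel C yields one of [shift M]. *)
Lemma cone_incl_quasi_iso (psi : chain_map (shift M) (cone (comp_map q p))) :
  (forall i x, psi i x = (j (i - 1) x, 0)) -> quasi_iso psi.
Proof.
move=> psiE a; split=> [z _ [[al be]]|[al be]].
  rewrite psiE => -[/= dal e].
  have [c cE] : boundary (p (a - 1) al).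
    apply: (qq a).1.
      by rewrite -chain_mapP -[diff F _ al]opprK dal linearN (sesK _ (jp _)) oppr0.
    by exists (- be); rewrite linearN; apply: addr0_eq; rewrite [LHS]addrC.
  have [_ sp _] := jp a; have [c' c'E] := sp c.
  have [ji1 _ kerp] := jp (a - 1).
  have [|m mE] := (kerp (al - diff F a c')).1.
    by rewrite linearB chain_mapP c'E cE subrr.
  have [ji2 _ _] := jp (a - 1 - 1).
  exists m; apply: ji2; rewrite /= linearN chain_mapP mE linearB diffK subr0.
  exact: dal.
rewrite /= => -[/eqP]; rewrite oppr_eq0 => /eqP dal e.
have [c cE] : boundary (p (a - 1 - 1) al).
  apply: (qq (a - 1)).1; first by rewrite -chain_mapP dal linear0.
  by exists (- be); rewrite linearN; apply: addr0_eq; rewrite [LHS]addrC.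
have [_ sp kerp1] := jp (a - 1); have [c' c'E] := sp c.
have [ji2 _ kerp2] := jp (a - 1 - 1); have [ji3 _ _] := jp (a - 1 - 1 - 1).
have [|m mE] := (kerp2 (al - diff F (a - 1) c')).1.
  by rewrite linearB chain_mapP c'E cE subrr.
have [|c2 dc2 [e' e'E]] := (qq a).2 (be + q (a - 1) c).
  by rewrite linearD -chain_mapP cE [LHS]addrC.
have [c3 c3E] := sp c2.
have [|m' m'E] := (kerp2 (diff F (a - 1) c3)).1.
  by rewrite chain_mapP c3E.
exists (m + m').
  apply: ji3; rewrite /= linear0 !linearN !chain_mapP linearD mE m'E.
  by rewrite linearD linearB !diffK dal subr0 addr0 oppr0.
exists (c3 - c', e'); rewrite psiE /= /cone_diff /=.
apply: injective_projections; rewrite /= ?subr0.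
  by rewrite linearB opprB linearD mE m'E opprD opprB addrA addrCA subrr addr0.
by rewrite e'E !linearB /= c3E c'E [be + _]addrC sub_cancel.
Qed.

End ConeQuotient.

(* n + 1 layers in thick1, glued by short exact sequences of complexes. *)
Fixpoint layered (T : complex R -> Prop) (n : nat) X : Prop :=
  if n is n'.+1 then exists K N (f : chain_map K X) (g : chain_map X N),
    [/\ cses f g, thick1 T K & layered T n' N]
  else thick1 T X.

Lemma cone_in_out_cses X Y (f : chain_map X Y) : cses (cone_in f) (cone_out f).
Proof.
move=> i; split=> [x y [] //|x|[x y]]; first by exists (x, 0).
by split=> [/= ->|[z <-]]; [exists y|].
Qed.

Lemma id_quasi_iso X : quasi_iso (id_map X).
Proof.
apply: chain_iso_quasi_iso => i; split=> [x y //|y]; by exists y.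
Qed.

Lemma cses_cone K X N (f : chain_map K X) (g : chain_map X N) :
  cses f g -> disomorphic N (cone f).
Proof.
move=> fg; apply: disomorphic_sym.
have h := cone_proj_quasi_iso fg (@id_quasi_iso K).
apply: disomorphic_trans (quasi_iso_disomorphic h).
have ch i (x : cone f i) : idfun (diff (cone f) i x) =
  diff (cone (comp_map f (id_map K))) i (idfun x) by [].
apply: (@quasi_iso_disomorphic _ _ (@ChainMap R (cone f) (cone (comp_map f (id_map K)))
  (fun i => idfun) ch)).
by apply: chain_iso_quasi_iso => i; split=> [x y //|y]; exists y.
Qed.

Lemma layered_thick T n X M : layered T n X -> disomorphic X M -> thick T n.+1 M.
Proof.
elim: n X M => [|n IH] X M; first by move=> tX XM; apply: thick1_iso XM.
move=> [K [N [f [g [fg tK lN]]]]] XM.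
apply: (thick_extend tK (disomorphic_sym XM) (cses_cone fg)).
exact: IH lN (disomorphic_refl N).
Qed.

Lemma cses_shift X Y Z (f : chain_map X Y) (g : chain_map Y Z) :
  cses f g -> cses (shift_map f) (shift_map g).
Proof. by move=> fg i; apply: (fg (i - 1)). Qed.

Lemma layered_shift T n X : layered T n X -> layered T n (shift X).
Proof.
elim: n X => [|n IH] X; first exact: thick1_shift.
move=> [K [N [f [g [fg tK /IH lN]]]]].
by exists (shift K), (shift N), (shift_map f), (shift_map g); split=> //;
  [apply: cses_shift|apply: thick1_shift].
Qed.

Lemma exists_quotient_complex X (A : forall i, set (X i)) :
    (forall i, submod (A i)) -> (forall i x, A i x -> A (i - 1) (diff X i x)) ->
  exists (Q : complex R) (q : chain_map X Q), forall i,
    surj (q i) /\ forall x, q i x = 0 <-> A i x.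
Proof.
move=> hA dA.
have [Q [q qP]] := dep_choice2 (fun i => exists_quotient (hA i)).
have exd i : exists d : {linear Q i -> Q (i - 1)},
    forall x, d (q i x) = q (i - 1) (diff X i x).
  have [sq kq] := qP i; apply: (linear_factor_surj (f := q (i - 1) \o diff X i) sq).
  by move=> x /kq /dA /= h; apply/(qP _).2.
have [d dP] := dep_choice exd.
have dK i x : d (i - 1) (d i x) = 0.
  by have [y <-] := (qP i).1 x; rewrite !dP diffK linear0.
exists (Complex dK), (@ChainMap R X (Complex dK) q (fun i x => esym (dP i x))).
exact: qP.
Qed.

Lemma exists_subcomplex X (A : forall i, set (X i)) :
    (forall i, submod (A i)) -> (forall i x, A i x -> A (i - 1) (diff X i x)) ->
  exists (K : complex R) (k : chain_map K X), forall i,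
    injective (k i) /\ forall x, A i x <-> exists y, k i y = x.
Proof.
move=> hA dA.
have [K [k kP]] := dep_choice2 (fun i => exists_submodule (hA i)).
have exd i : exists d : {linear K i -> K (i - 1)},
    forall x, k (i - 1) (d x) = diff X i (k i x).
  apply: (linear_factor_inj (f := diff X i \o k i) (kP (i - 1)).1) => x.
  by apply/(kP _).2/dA/(kP _).2; exists x.
have [d dP] := dep_choice exd.
have dK i x : d (i - 1) (d i x) = 0.
  by apply: (inj0 (kP _).1); rewrite !dP diffK.
exists (Complex dK), (@ChainMap R (Complex dK) X k dP).
exact: kP.
Qed.

Lemma chain_factor_surj X Y Z (q : chain_map X Y) (f : chain_map X Z) :
    (forall i, surj (q i)) -> (forall i x, q i x = 0 -> f i x = 0) ->
  exists g : chain_map Y Z, forall i x, g i (q i x) = f i x.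
Proof.
move=> sq h.
have [g gP] := dep_choice (fun i => linear_factor_surj (sq i) (h i)).
have ch i x : g (i - 1) (diff Y i x) = diff Z i (g i x).
  by have [y <-] := sq i x; rewrite -chain_mapP !gP chain_mapP.
by exists (ChainMap ch).
Qed.

Lemma chain_factor_inj X Y Z (k : chain_map Y X) (f : chain_map Z X) :
    (forall i, injective (k i)) -> (forall i x, exists y, k i y = f i x) ->
  exists g : chain_map Z Y, forall i x, k i (g i x) = f i x.
Proof.
move=> ik h.
have [g gP] := dep_choice (fun i => linear_factor_inj (ik i) (h i)).
have ch i x : g (i - 1) (diff Z i x) = diff Y i (g i x).
  by apply: ik; rewrite chain_mapP !gP chain_mapP.
by exists (ChainMap ch).
Qed.

(* X/K1 is an extension of N by K/K1. *)
Lemma layered_rcons T n K X N (f : chain_map K X) (g : chain_map X N) :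
  cses f g -> layered T n K -> thick1 T N -> layered T n.+1 X.
Proof.
elim: n K X f g => [|n IH] K X f g fg; first by move=> tK tN; exists K, N, f, g.
move=> [K1 [K' [f1 [g1 [fg1 tK1 lK']]]]] tN.
have [||X' [h hP]] := @exists_quotient_complex X
    (fun i => [set x | exists y, f i (f1 i y) = x]).
- by move=> i; apply: (im_submod (f i \o f1 i)).
- by move=> i _ [y <-]; exists (diff K1 i y); rewrite !chain_mapP.
have fg1' : cses (comp_map f f1) h.
  move=> i; have [fi _ _] := fg i; have [f1i _ _] := fg1 i; split.
  - by move=> x y /= /fi /f1i.
  - exact: (hP i).1.
  - exact: (hP i).2.
have [||u uP] := @chain_factor_surj _ _ _ g1 (comp_map h f).
- by move=> i; case: (fg1 i).
- by move=> i x; case: (fg1 i) => _ _ ker /ker[y <-] /=; apply/(hP i).2; exists y.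
have [||v vP] := @chain_factor_surj _ _ _ h g.
- by move=> i; case: (hP i).
- by move=> i x /(hP i).2[y <-]; rewrite (sesK _ (fg i)).
exists K1, X', (comp_map f f1), h; split=> //.
apply: (IH K' X' u v) => // i.
have [fi sg kerg] := fg i; have [_ sg1 kerg1] := fg1 i; have [sh kerh] := hP i.
split.
- apply: inj0P => x; have [y <-] := sg1 x; rewrite uP /= => /kerh[z /fi zy].
  by apply/kerg1; exists z.
- by move=> y; have [x <-] := sg y; exists (h i x); rewrite vP.
- move=> x; have [y <-] := sh x; rewrite vP kerg; split=> [[z <-]|[z]].
    by exists (g1 i z); rewrite uP.
  have [w <-] := sg1 z; rewrite uP /= => e.
  have /kerh[a aE] : h i (y - f i w) = 0 by rewrite linearB e subrr.
  by exists (f1 i a + w); rewrite linearD aE subrK.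
Qed.

End DerivedCategory.

(** * Graded complexes, desuspension and disks *)

Section Graded.
Variable R : comNzRingType.
Implicit Types X Y Z M N K F : complex R.

Definition bounded X : Prop :=
  exists n : nat, forall i, n%:Z < `|i| -> trivial_module (X i).

Definition graded (S : int -> lmodType R) : complex R :=
  @Complex R S (fun i => \0) (fun i x => erefl).

Definition zero_diff X : Prop := forall i x, diff X i x = 0.

Lemma zero_diff_disomorphic X Y : zero_diff X -> zero_diff Y ->
    (forall i, exists phi : {linear X i -> Y i}, injective phi /\ surj phi) ->
  disomorphic X Y.
Proof.
move=> zX zY /dep_choice[phi phiP].
have ch i x : phi (i - 1) (diff X i x) = diff Y i (phi i x).
  by rewrite zX zY linear0.
apply: (@quasi_iso_disomorphic R X Y (ChainMap ch)).
exact: chain_iso_quasi_iso.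
Qed.

Section Thick.
Variable T : lmodType R -> Prop.

(** Induction on the distance of a from 0, by [thick1_shift] above 0 and [thick1_unshift] below. *)
Lemma thick1_sphere a X : (forall i, i <> a -> trivial_module (X i)) -> T (X a) ->
  thick1 (as_complexes T) X.
Proof.
have zd b (Y : complex R) : (forall i, i <> b -> trivial_module (Y i)) -> zero_diff Y.
  move=> tY i x; have [ib|] := pselect (i = b); last by move=> /tY tYi; rewrite [x]tYi linear0.
  apply: tY; rewrite ib => /eqP; rewrite subr_eq -subr_eq0 opprD addNKr oppr_eq0.
  by rewrite oner_eq0.
have base (Y : complex R) : (forall i, i <> 0 -> trivial_module (Y i)) -> T (Y 0) ->
    thick1 (as_complexes T) Y.
  move=> tY TY; apply: (@thick1_iso _ _ (in_degree0 (Y 0))).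
    by apply: thick1_base; exists (Y 0).
  apply: zero_diff_disomorphic => // [|i]; first exact: zd tY.
  rewrite /=; case: eqP => [->|ni].
    by exists idfun; split=> // y; exists y.
  exists \0; split=> [x y _|y]; first by rewrite [x]thinmx0 [y]thinmx0.
  by exists 0; rewrite linear0 [y]tY.
case: a => a.
  elim: a X => [|a IH] X tX TX; first exact: base.
  pose Y := graded (fun i => X (i + 1)).
  have tY i : i <> a%:Z -> trivial_module (Y i) by move=> ia; apply: tX; lia.
  apply: (@thick1_iso _ _ (shift Y)).
    by apply/thick1_shift/IH => //; rewrite /Y /= -PoszD addn1.
  apply: zero_diff_disomorphic => [i x|i x|i]; [exact: oppr0|exact: zd tX _ _|].
  by rewrite /= subrK; exists idfun; split=> // y; exists y.
elim: a X => [|a IH] X tX TX; apply: thick1_unshift.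
  by apply: base => // i i0; apply: tX; lia.
have aE : Negz a - 1 = Negz a.+1 by lia.
by apply: IH => [i ia|]; [apply: tX; lia|rewrite /= aE].
Qed.

(** A zero object is a direct summand of any X, but some X in [thick1] must be at hand. *)
Lemma thick1_trivial X Z : thick1 (as_complexes T) X ->
  (forall i, trivial_module (Z i)) -> thick1 (as_complexes T) Z.
Proof.
move=> tX tZ; apply: (@thick1_summand _ _ X); apply: thick1_iso tX _.
have ex i : exists phi : {linear X i -> direct_sum X Z i}, forall x, phi x = (x, 0).
  by have [h hP] := pair_linear (idfun : {linear X i -> X i}) (\0 : {linear X i -> Z i});
    exists h => x; rewrite hP.
have [phi phiE] := dep_choice ex.
have ch i x : phi (i - 1) (diff X i x) = diff (direct_sum X Z) i (phi i x).
  by rewrite !phiE /= /dsum_diff /= linear0.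
apply: (@quasi_iso_disomorphic R X (direct_sum X Z) (ChainMap ch)).
apply: chain_iso_quasi_iso => i; split=> [x y|[x z]] /=.
  by rewrite !phiE => -[].
by exists x; rewrite phiE [z]tZ.
Qed.

Lemma thick1_graded X : zero_diff X -> bounded X -> (forall i, T (X i)) ->
  thick1 (as_complexes T) X.
Proof.
move=> zX [n nX] TX.
have base := thick1_base (C := as_complexes T) (ex_intro2 _ _ (X 0) (TX 0) erefl).
(* Induction on the length l of a window [a, a + l) outside which Y vanishes, splitting off degree
   a; [base] serves the empty window. *)
suff H : forall (l : nat) (a : int) (Y : complex R), zero_diff Y ->
    (forall i, i < a \/ a + l%:Z <= i -> trivial_module (Y i)) ->
    (forall i, a <= i -> i < a + l%:Z -> T (Y i)) -> thick1 (as_complexes T) Y.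
  by apply: (H (n + n).+1 (- n%:Z)) => // i h; apply: nX; lia.
elim=> [|l IH] a Y zY tY TY.
  by apply: (thick1_trivial base) => i; apply: tY; lia.
pose S := graded (fun i => if i == a then Y i else zero_module R).
pose W := graded (fun i => if i == a then zero_module R else Y i).
have tS : thick1 (as_complexes T) S.
  apply: (@thick1_sphere a) => [i /eqP/negPf ia|].
    by rewrite /= ia; apply: zero_module_trivial.
  by rewrite /= eqxx; apply: TY; lia.
have tW : thick1 (as_complexes T) W.
  apply: (IH (a + 1)) => // i h; rewrite /=; case: eqP => ia.
  - exact: zero_module_trivial.
  - by apply: tY; lia.
  - lia.
  - by move=> ?; apply: TY; lia.
apply: (thick1_iso (thick1_sum tS tW)).
apply: zero_diff_disomorphic => // i; rewrite /=.
case: eqP => [_|_].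
  exists fst; split=> [[x z] [x' z'] /= ->|y]; last by exists (y, 0).
  by rewrite [z]thinmx0 [z']thinmx0.
exists snd; split=> [[x z] [x' z'] /= ->|y]; last by exists (0, y).
by rewrite [x]thinmx0 [x']thinmx0.
Qed.

End Thick.

(** Degrees such as i and i - 1 + 1 are equal without being convertible, so elements have to be
    transported. *)
Definition castob X i j (e : i = j) : {linear X i -> X j} :=
  match e in _ = j0 return {linear X i -> X j0} with erefl => idfun end.

Lemma castob_bij X i j (e : i = j) : injective (castob X e) /\ surj (castob X e).
Proof. by case: j / e; split=> [x y //|y]; exists y. Qed.

Lemma castob_diff X i j (e : i = j) (e' : i - 1 = j - 1) x :
  diff X j (castob X e x) = castob X e' (diff X i x).
Proof. by case: j / e e' => e'; rewrite (eq_irrelevance e' erefl). Qed.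

Lemma castob_comp X i j l (e : i = j) (e' : j = l) (e'' : i = l) x :
  castob X e' (castob X e x) = castob X e'' x.
Proof.
by case: j / e e' => e'; case: l / e' e'' => e''; rewrite (eq_irrelevance e'' erefl).
Qed.

(* The desuspension: Y i = X (i + 1) with the sign absorbed by the shift. *)
Lemma exists_desuspension X : exists (Y : complex R) (f : chain_map X (shift Y)),
  [/\ chain_iso f, forall i, ob Y i = X (i + 1) &
    forall i, exists (a : {linear Y i -> X (i + 1)})
      (b : {linear X (i + 1 - 1) -> Y (i - 1)}),
      [/\ injective a, surj a, injective b, surj b &
          forall x, diff Y i x = b (diff X (i + 1) (a x))]].
Proof.
have e i : i + 1 - 1 = i - 1 + 1 :> int by rewrite addrK subrK.
have [d dE] : exists d : forall i, {linear X (i + 1) -> X (i - 1 + 1)},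
    forall i x, d i x = - castob X (e i) (diff X (i + 1) x).
  by exists (fun i => \- (castob X (e i) \o diff X (i + 1))).
have dK i x : d (i - 1) (d i x) = 0.
  have e' : i + 1 - 1 - 1 = i - 1 + 1 - 1 by rewrite e.
  rewrite dE (dE i) linearN (castob_diff (e i) e') diffK.
  by rewrite linear0 oppr0 linear0 oppr0.
have ei i : i = i - 1 + 1 :> int by rewrite subrK.
pose Y : complex R := @Complex R (fun i => X (i + 1)) d dK.
have ch i x : castob X (ei (i - 1)) (diff X i x) = diff (shift Y) i (castob X (ei i) x).
  have e' : i - 1 = i - 1 + 1 - 1 by rewrite subrK.
  rewrite -[RHS]/(- d (i - 1) (castob X (ei i) x)) dE opprK (castob_diff (ei i) e').
  by rewrite castob_comp.
exists Y, (@ChainMap R X (shift Y) (fun i => castob X (ei i)) ch).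
split=> // [i|i]; first exact: castob_bij.
have [bi bs] := castob_bij X (e i).
exists idfun, (\- castob X (e i)); split=> //.
- by move=> y; exists y.
- by move=> x y /= /oppr_inj /bi.
- by move=> y; have [x xE] := bs (- y); exists x; rewrite /= xE opprK.
- by move=> x; apply: dE.
Qed.

Lemma chain_iso_inv X Y (f : chain_map X Y) : chain_iso f ->
  exists g : chain_map Y X, chain_iso g.
Proof.
move=> isof; have [||g gP] := @chain_factor_inj R _ _ _ f (id_map Y).
- by move=> i; case: (isof i).
- by move=> i y; have [x xy] := (isof i).2 y; exists x.
exists g => i; split=> [x y e|x].
  by have := gP i x; rewrite e gP.
by exists (f i x); apply: (isof i).1; rewrite gP.
Qed.

Lemma bounded_inj X Y : bounded X ->
  (forall i, exists f : {linear Y i -> X i}, injective f) -> bounded Y.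
Proof.
move=> [n nX] h; exists n => i /nX tX x; have [f fi] := h i.
by apply: (inj0 fi); rewrite [LHS]tX.
Qed.

Lemma bounded_surj X Y : bounded X ->
  (forall i, exists f : {linear X i -> Y i}, surj f) -> bounded Y.
Proof.
move=> [n nX] h; exists n => i /nX tX y; have [f sf] := h i.
by have [x <-] := sf y; rewrite [x]tX linear0.
Qed.

Lemma bounded_shift X : bounded X -> bounded (shift X).
Proof. by move=> [n nX]; exists n.+1 => i h; apply: nX; lia. Qed.

Lemma bounded_desuspension X Y : bounded X -> (forall i, ob Y i = X (i + 1)) -> bounded Y.
Proof. by move=> [n nX] YX; exists n.+1 => i h; rewrite YX; apply: nX; lia. Qed.

(** Degree i is S (i - 1) x S i, and the differential carries the first component identically to the
    second: a sum of contractible two-term complexes. *)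
Definition disk (S : int -> lmodType R) : complex R := cone (id_map (graded S)).

Lemma disk_acyclic S : acyclic (disk S).
Proof.
move=> i [a b] [_ /=]; rewrite addr0 => a0; exists (b, 0).
by rewrite /= /cone_diff /= addr0 a0 oppr0.
Qed.

Lemma cone_in_quasi_iso X Y (f : chain_map X Y) : acyclic X -> quasi_iso (cone_in f).
Proof.
move=> aX i; split=> [y dy [[a b] [/eqP]]|[x y] [/eqP]].
  rewrite oppr_eq0 => /eqP da e; have [a' a'E] := aX i a da.
  exists (f i a' + b); rewrite linearD -chain_mapP a'E; exact: e.
rewrite oppr_eq0 => /eqP dx e; have [x' x'E] := aX (i - 1) x dx.
exists (y + f (i - 1) x').
  by rewrite linearD -chain_mapP x'E [LHS]addrC.
exists (- x', 0); apply: injective_projections => /=.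
  by rewrite linearN opprK x'E subr0.
by rewrite linear0 addr0 linearN opprD addrA subrr sub0r.
Qed.

Lemma cone_out_quasi_iso X Y (f : chain_map X Y) : acyclic Y -> quasi_iso (cone_out f).
Proof.
move=> aY i; split=> [[x y] [/= _ e] [x' x'E]|x /= /eqP].
  have [|y' y'E] := aY i (y - f (i - 1) x').
    rewrite linearB -chain_mapP; apply/eqP; rewrite subr_eq0; apply/eqP.
    have -> : diff X (i - 1) x' = - x by rewrite -[LHS]opprK; congr (- _).
    by rewrite linearN; apply/esym/addr0_eq.
  exists (x', y'); apply: injective_projections; rewrite /= ?y'E //.
  by rewrite [LHS]addrC subrK.
rewrite oppr_eq0 => /eqP dx.
have [|y yE] := aY (i - 1) (f (i - 1 - 1) x).
  by rewrite -chain_mapP dx linear0.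
exists (x, - y); last by rewrite subrr; apply: boundary0.
by apply: injective_projections; rewrite /= ?dx ?oppr0 // linearN yE subrr.
Qed.

(** The disk is acyclic and hence zero in the derived category, whatever the modules U are; only S
    must lie in T. *)
Lemma thick1_graded_disk (T : lmodType R -> Prop) S U :
    bounded (graded S) -> (forall i, T (S i)) ->
  thick1 (as_complexes T) (direct_sum (graded S) (disk U)).
Proof.
move=> bS TS; have tS := thick1_graded (X := graded S) (fun i x => erefl) bS TS.
apply: (thick1_iso tS); apply: disomorphic_sym.
pose pr : chain_map (direct_sum (graded S) (disk U)) (graded S) :=
  @ChainMap R (direct_sum (graded S) (disk U)) (graded S)
    (fun i => (fst : {linear (S i * _)%type -> S i})) (fun i x => erefl).
apply: (@quasi_iso_disomorphic R _ _ pr) => i.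
split=> [[s [a b]] dz [x /= s0]|s _].
  have a0 : a + 0 = 0 := congr1 (fun t => t.2.2) dz.
  rewrite addr0 in a0; exists (0, (b, 0)).
  rewrite -s0 a0.
  by congr (_, (_, _)); [exact: oppr0|exact: addr0].
exists (s, 0); last by rewrite subrr; apply: boundary0.
by rewrite /= /dsum_diff /= linear0.
Qed.

End Graded.

(** * Truncation and projective layers *)

Section Truncation.
Variable R : comNzRingType.
Implicit Types X Y M : complex R.

Lemma quasi_iso_homology_zero X Y (f : chain_map X Y) i :
  quasi_iso f -> homology_zero_at Y i -> homology_zero_at X i.
Proof.
move=> qf hY z dz; apply: (qf i).1 => //; apply: hY.
by rewrite -chain_mapP dz linear0.
Qed.

(** In degrees where p holds everything is taken, where q holds the cycles, and elsewhere only 0.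
    Both truncations are of this shape. *)
Lemma truncation_submod X i (p q : Prop) :
  submod [set x | [\/ p, q /\ diff X i x = 0 | x = 0]].
Proof.
split=> [|c x y]; first by apply: Or33.
case=> [h|[h dx]|->]; [by move=> _; apply: Or31| |by rewrite scaler0 add0r].
case=> [h'|[_ dy]|->]; first by apply: Or31.
  by apply: Or32; rewrite linearP dx dy scaler0 addr0.
by apply: Or32; rewrite addr0 linearZ /= dx scaler0.
Qed.

Lemma bounded_homology_bounded M :
  bounded_homology M -> exists M', bounded M' /\ disomorphic M M'.
Proof.
move=> [n hM].
(* Truncation from below: in degree - n - 1 the cycles are kept, which are boundaries because the
   homology vanishes there. *)
have [||U [u uP]] := @exists_subcomplex R M
    (fun i => [set x | [\/ - n%:Z <= i, i = - n%:Z - 1 /\ diff M i x = 0 | x = 0]]).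
- by move=> i; apply: truncation_submod.
- move=> i x; case=> [h|[h ->]|->]; last by apply: Or33; rewrite linear0.
    have [h'|h'] := lerP (- n%:Z) (i - 1); first exact: Or31.
    by apply: Or32; split; [lia|exact: diffK].
  exact: Or33.
have qu : quasi_iso u.
  move=> i; have [ui uS] := uP (i - 1); split=> [z dz [x xE]|z dz].
    have [h|h] := lerP (- n%:Z) i.
      have [y yE] := ((uP i).2 x).1 (Or31 _ _ h).
      by exists y; apply: ui; rewrite chain_mapP yE xE.
    have := (uS (u (i - 1) z)).2 (ex_intro _ z erefl).
    case=> [|[]|z0]; [lia|lia|].
    by rewrite (inj0 ui z0); apply: boundary0.
  have [h|h] := lerP (- n%:Z - 1) (i - 1).
    have [y yE] : exists y, u (i - 1) y = z.
      apply/uS; have [h'|h'] := lerP (- n%:Z) (i - 1); first exact: Or31.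
      by apply: Or32; split=> //; lia.
    exists y; last by rewrite yE subrr; apply: boundary0.
    by apply: (inj0 (uP (i - 1 - 1)).1); rewrite chain_mapP yE.
  exists 0; first exact: linear0.
  by rewrite linear0 subr0; apply: hM => //; lia.
have hU i : n%:Z < `|i - 1| -> homology_zero_at U i.
  by move=> /hM; apply: quasi_iso_homology_zero.
have tU i : i < - n%:Z - 1 -> trivial_module (U i).
  move=> h y; have := ((uP i).2 (u i y)).2 (ex_intro _ y erefl).
  by case=> [|[]|y0]; [lia|lia|exact: inj0 (uP i).1 y0].
(* Truncation from above: degree n + 1 is divided by its cycles, so that it injects into degree n
   and leaves the homology there unchanged. *)
have [||Q [q qP]] := @exists_quotient_complex R U
    (fun i => [set x | [\/ n%:Z + 1 < i, i = n%:Z + 1 /\ diff U i x = 0 | x = 0]]).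
- by move=> i; apply: truncation_submod.
- move=> i x; case=> [h|[h ->]|->]; last by apply: Or33; rewrite linear0.
    have [h'|h'] := ltrP (n%:Z + 1) (i - 1); first exact: Or31.
    by apply: Or32; split; [lia|exact: diffK].
  exact: Or33.
have qq : quasi_iso q.
  move=> i; have [sq kq] := qP (i - 1); split=> [z dz [y yE]|z dz].
    have [x xy] := (qP i).1 y.
    have /kq h : q (i - 1) (z - diff U i x) = 0 by rewrite linearB chain_mapP xy yE subrr.
    have [w wE] : boundary (z - diff U i x).
      have dz' : diff U (i - 1) (z - diff U i x) = 0 by rewrite linearB dz diffK subrr.
      case: h => [h|[h _]|->]; last exact: boundary0.
        by apply: hU dz'; lia.
      by apply: hU dz'; lia.
    by exists (w + x); rewrite linearD wE subrK.
  have [x xz] := sq z.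
  have /(qP _).2 h : q (i - 1 - 1) (diff U (i - 1) x) = 0 by rewrite chain_mapP xz.
  have [h'|h'] := lerP (i - 1) (n%:Z + 1).
    exists x; last by rewrite xz subrr; apply: boundary0.
    by case: h => [|[]|]//; lia.
  exists 0; first exact: linear0.
  rewrite linear0 subr0.
  have -> : z = 0 by rewrite -xz; apply/kq/Or31.
  exact: boundary0.
exists Q; split; last first.
  apply: disomorphic_trans (quasi_iso_disomorphic qq).
  exact: disomorphic_sym (quasi_iso_disomorphic qu).
exists n.+1 => i h y; have [x <-] := (qP i).1 y.
apply/(qP i).2; have [h'|h'] := lerP i 0; last by apply: Or31; lia.
by apply: Or33; apply: tU; lia.
Qed.

End Truncation.

Section Resolving.
Variable R : comNzRingType.
Implicit Types (A B C E G J K N P : lmodType R) (X Y M : complex R)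
  (S U : int -> lmodType R).

(** A copy of the image of f, held as a quotient of its source. For a differential it is the module
    of boundaries one degree lower. *)
Definition coimage A B C (f : {linear A -> B}) (s : {linear A -> C}) : Prop :=
  surj s /\ forall x, s x = 0 <-> f x = 0.

Lemma exists_coimage A B (f : {linear A -> B}) :
  exists C (s : {linear A -> C}), coimage f s.
Proof. exact: exists_quotient (ker_submod f). Qed.

Lemma exists_kernel A B (f : {linear A -> B}) :
  exists K (k : {linear K -> A}), is_kernel f k.
Proof. exact: exists_submodule (ker_submod f). Qed.

Lemma exists_cokernel A B (f : {linear A -> B}) :
  exists C (c : {linear B -> C}), is_cokernel f c.
Proof. exact: exists_quotient (im_submod f). Qed.

Definition disk_pair (S U : int -> lmodType R) : complex R :=
  direct_sum (graded S) (disk U).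

Lemma disk_pair_diff S U i (x : disk_pair S U i) :
  diff (disk_pair S U) i x = (0, (0, x.2.1)).
Proof. by congr (_, (_, _)); [exact: oppr0|exact: addr0]. Qed.

Lemma bounded_disk_pair S U :
  bounded (graded S) -> bounded (graded U) -> bounded (disk_pair S U).
Proof.
move=> [n bS] [l bU]; exists (n + l).+1 => i h [s [a b]].
have -> : s = 0 by apply: (bS i); lia.
have -> : b = 0 by apply: (bU i); lia.
by have -> : a = 0 by apply: (bU (i - 1)); lia.
Qed.

Section Projective.

(** All projective presentations are quantified over, so that the kernels arising in the
    construction are used as they come, without Schanuel's lemma. *)
Fixpoint gpd_le (n : nat) N : Prop :=
  if n is n'.+1 then forall P K (k : {linear K -> P}) (p : {linear P -> N}),
    projective P -> ses k p -> gpd_le n' K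
  else gorenstein_projective N.

Lemma gpd_le_syzygy n N : (forall G, syzygy n N G -> gorenstein_projective G) -> gpd_le n N.
Proof.
elim: n N => [|n IH] N h /=; first exact: h.
by move=> P K k p pP kp; apply: IH => G sG; apply: h; exists P, K, k, p.
Qed.

Definition cycles_gpd n X : Prop := bounded X /\ forall i,
  (forall K (k : {linear K -> X i}), is_kernel (diff X i) k -> gpd_le n K) /\
  (forall B (s : {linear X i -> B}), coimage (diff X i) s -> gpd_le n B).

Lemma cycles_gpd_desuspension n X : cycles_gpd n X ->
  exists Y (f : chain_map (shift Y) X), chain_iso f /\ cycles_gpd n Y.
Proof.
move=> [bX hX]; have [Y [f [isof YX Yd]]] := exists_desuspension X.
have [g isog] := chain_iso_inv isof; exists Y, g; split=> //.
split=> [|i]; first exact: bounded_desuspension bX YX.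
have [a [b [ia sa ib sb dE]]] := Yd i; have [hk hc] := hX (i + 1); split.
  move=> K k [ik kerk]; apply: (hk K (a \o k)); split=> [x y /ia /ik //|x].
  have [y <-] := sa x; split=> [dy|[z /ia <-]].
    by have /kerk[z <-] : diff Y i y = 0 by [rewrite dE dy linear0]; exists z.
  by apply: (inj0 ib); rewrite -dE; apply/kerk; exists z.
move=> B s [ss kers]; have [|t tP] := linear_factor_surj (f := s) sa.
  by move=> x /(inj0 ia) ->; apply: linear0.
apply: (hc B t); split=> [y|x]; first by have [x <-] := ss y; exists (a x); rewrite tP.
have [y <-] := sa x; rewrite tP kers dE; split=> [/(inj0 ib) //|->].
exact: linear0.
Qed.

Definition gp_resolved n X : Prop := exists2 L,
  layered (as_complexes (@gorenstein_projective R)) n L &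
  exists q : chain_map L X, quasi_iso q.

Lemma gp_resolved_base X : cycles_gpd 0 X -> gp_resolved 1 X.
Proof.
move=> [bX hX]; exists X; last by exists (id_map X); apply: id_quasi_iso.
have [||Z [k kP]] := @exists_subcomplex R X (fun i => [set x | diff X i x = 0]).
- by move=> i; apply: ker_submod.
- by move=> i x /= ->; rewrite linear0.
have [||Q [q qP]] := @exists_quotient_complex R X (fun i => [set x | diff X i x = 0]).
- by move=> i; apply: ker_submod.
- by move=> i x /= ->; rewrite linear0.
exists Z, Q, k, q; split.
- move=> i; split; [exact: (kP i).1|exact: (qP i).1|move=> x].
  by rewrite (qP i).2; apply: (kP i).2.
- apply: thick1_graded.
  + move=> i x; apply: (inj0 (kP _).1); rewrite chain_mapP.
    by apply/(kP i).2; exists x.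
  + by apply: bounded_inj bX _ => i; exists (k i); apply: (kP i).1.
  + by move=> i; apply: (hX i).1 _ (k i) _; split; [exact: (kP i).1|exact: (kP i).2].
- apply: thick1_graded.
  + move=> i x; have [y <-] := (qP i).1 x; rewrite -chain_mapP.
    by apply/(qP _).2; apply: diffK.
  + by apply: bounded_surj bX _ => i; exists (q i); apply: (qP i).1.
  + by move=> i; apply: (hX i).2 _ (q i) _; split; [exact: (qP i).1|exact: (qP i).2].
Qed.

(** A chain map from a disk is given by any graded map, here u, on the generating components. On the
    others it is then forced to be the differential of u, with the sign of the shift. *)
Lemma exists_disk_cover Y : bounded Y -> exists (U : int -> lmodType R)
    (u : forall i, {linear U i -> Y i}) (f : chain_map (disk U) (shift Y)),
  [/\ forall i, projective (U i), forall i, surj (u i), bounded (graded U) &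
      forall i x, f i x = u (i - 1) x.1 - diff Y i (u i x.2)].
Proof.
move=> [n bY].
have [U [u uP]] := dep_choice2 (fun i => projective_cover (Y i)).
have exf i : exists f : {linear disk U i -> shift Y i},
    forall x, f x = u (i - 1) x.1 - diff Y i (u i x.2).
  by exists ((u (i - 1) \o fst) \- ((diff Y i \o u i) \o snd)).
have [f fE] := dep_choice exf.
have ch i x : f (i - 1) (diff (disk U) i x) = diff (shift Y) i (f i x).
  rewrite !fE /= linearB diffK subr0 addr0 oppr0 linear0 sub0r //.
exists U, u, (ChainMap ch); split=> // [i|i|].
- by case: (uP i).
- by case: (uP i).
- by exists n => i /bY; case: (uP i).
Qed.

Lemma gp_resolved_step n X :
    (forall X, cycles_gpd n X -> gp_resolved n.+1 X) ->
  cycles_gpd n.+1 X -> gp_resolved n.+2 X.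
Proof.
move=> IH /cycles_gpd_desuspension[Y [th [isoth [bY hY]]]].
have [U [u [f [pU su bU fE]]]] := exists_disk_cover bY.
have exS i : exists (S : lmodType R) (v : {linear S -> Y (i - 1)}), [/\ projective S,
    forall x, diff Y (i - 1) x = 0 <-> exists s, v s = x &
    trivial_module (Y (i - 1)) -> trivial_module S].
  have [Z [z [iz zP]]] := exists_kernel (diff Y (i - 1)).
  have [S [s [pS ss tS]]] := projective_cover Z.
  exists S, (z \o s); split=> // [x|tY].
    rewrite zP; split=> [[y <-]|[y <-]]; last by exists (s y).
    by have [t <-] := ss y; exists t.
  by apply: tS => y; apply: iz; rewrite [LHS]tY [RHS]tY.
have [S [v vP]] := dep_choice2 exS.
have dv i s : diff Y (i - 1) (v i s) = 0.
  by have [_ h _] := vP i; apply/h; exists s.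
have bS : bounded (graded S).
  by have [m bm] := bounded_shift bY; exists m => i /bm; case: (vP i).
pose F := disk_pair S U.
have [g gE] : exists g : forall i, {linear F i -> shift Y i},
    forall i x, g i x = v i x.1 + f i x.2.
  exact: dep_choice (fun i => copair_linear (v i) (f i)).
have chg i x : g (i - 1) (diff F i x) = diff (shift Y) i (g i x).
  rewrite !gE linearD -chain_mapP; congr (_ + _).
  by rewrite /= dv oppr0 linear0.
have sg i : surj (g i).
  move=> y; have [a ay] := su (i - 1) y; exists (0, (a, 0)).
  by rewrite gE fE /= !(linear0, oppr0, addr0, add0r).
have [||K [k kP]] := @exists_subcomplex R F (fun i => [set x | g i x = 0]).
- by move=> i; apply: ker_submod.
- by move=> i x /= gx; rewrite chg gx linear0.
have kg : cses k (ChainMap chg).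
  by move=> i; split; [exact: (kP i).1|exact: sg|exact: (kP i).2].
(* The differential of F moves only the component in U (i - 1), so the cycles of K are the elements
   without it. *)
have dk i y : diff K i y = 0 <-> (k i y).2.1 = 0.
  split=> [dy|h]; last first.
    by apply: (inj0 (kP _).1); rewrite chain_mapP disk_pair_diff h.
  have := chain_mapP k y; rewrite dy linear0 disk_pair_diff.
  by move=> /esym/(congr1 (fun t => t.2.2)).
have cK : cycles_gpd n K.
  split=> [|i].
    apply: (bounded_inj (bounded_disk_pair bS bU)) => i.
    by exists (k i); apply: (kP i).1.
  have [hk hc] := hY (i - 1); have [pS kerv _] := vP i; split.
  (* Cycles of K are the pairs (s, b) with v s equal to the differential of u b: the kernel of a map
     from S i x U i onto the cycles Z of Y, onto because v alone reaches them all. *)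
  - move=> L l [il lP].
    have [Z [z [iz zP]]] := exists_kernel (diff Y (i - 1)).
    have hZ : gpd_le n.+1 Z by apply: hk (_ : is_kernel _ z).
    have [p pE] : exists p : {linear (S i * U i)%type -> Z},
        forall x, z (p x) = v i x.1 - diff Y i (u i x.2).
      apply: (linear_factor_inj
        (f := (v i \o fst) \- ((diff Y i \o u i) \o snd)) iz) => x /=.
      by apply/zP; rewrite linearB dv diffK subrr.
    have [h hE] := pair_linear ((fst \o k i) \o l) (((snd \o snd) \o k i) \o l).
    apply: (hZ (S i * U i)%type L h p); first exact: projective_prod.
    split=> [|y|x].
    + apply: inj0P => x; rewrite hE /= => -[s0 b0].
      have a0 : (k i (l x)).2.1 = 0 by apply/dk/lP; exists x.
      apply: (inj0 il); apply: (inj0 (kP i).1).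
      rewrite [LHS]surjective_pairing s0 [X in (_, X)]surjective_pairing a0 b0 //.
    + have /kerv[s sE] : diff Y (i - 1) (z y) = 0 by apply/zP; exists y.
      by exists (s, 0); apply: iz; rewrite pE /= !(linear0, oppr0, addr0).
    + split=> [px|[y <-]].
        have /(kP i).2[w wE] : g i (x.1, (0, x.2)) = 0.
          rewrite gE fE /= linear0 sub0r.
          by have := pE x; rewrite px linear0 => <-.
        have /lP[y yE] : diff K i w = 0 by apply/dk; rewrite wE.
        by exists y; rewrite hE /= yE wE /= -surjective_pairing.
      apply: (inj0 iz); rewrite pE hE /=.
      have : g i (k i (l y)) = 0 by apply/(kP i).2; exists (l y).
      have a0 : (k i (l y)).2.1 = 0 by apply/dk/lP; exists y.
      by rewrite gE fE /= a0 linear0 sub0r.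
  (* Boundaries of K are the a in U (i - 1) for which u a is a cycle, as the spheres can then cancel
     u a: the kernel of the cover of C by U (i - 1). *)
  - move=> B s [ss sP].
    have [C [r [sr rP]]] := exists_coimage (diff Y (i - 1)).
    have hC : gpd_le n.+1 C by apply: hc (_ : coimage _ r).
    have [|h hE] := linear_factor_surj (f := (fst \o snd) \o k i) ss.
      by move=> x /sP/dk.
    apply: (hC (U (i - 1)) B h (r \o u (i - 1))) => //.
    split=> [|y|a].
    + apply: inj0P => y; have [x <-] := ss y; rewrite hE /= => a0.
      by apply/sP/dk.
    + have [x <-] := sr y; have [a <-] := su (i - 1) x; by exists a.
    + rewrite /= rP; split=> [/kerv[t tE]|[y <-]].
        have /(kP i).2[w wE] : g i (- t, (a, 0)) = 0.
          by rewrite gE fE /= !(linear0, oppr0, addr0) linearN tE addNr.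
        by exists (s w); rewrite hE /= wE.
      have [x <-] := ss y; rewrite hE /=.
      have : g i (k i x) = 0 by apply/(kP i).2; exists x.
      rewrite gE fE => /(congr1 (diff Y (i - 1))).
      by rewrite linearD dv add0r linearB diffK subr0 linear0.
have [L lL [q qq]] := IH K cK.
have tF : thick1 (as_complexes (@gorenstein_projective R)) F.
  apply: thick1_graded_disk => // i; apply: projective_gorenstein.
  by case: (vP i).
exists (cone (comp_map k q)).
  exists F, (shift L), (cone_in _), (cone_out _); split=> //.
    exact: cone_in_out_cses.
  exact: layered_shift.
exists (comp_map th (cone_proj q kg)); apply: comp_quasi_iso.
  exact: chain_iso_quasi_iso.
exact: cone_proj_quasi_iso.
Qed.

Lemma gp_resolved_all n X : cycles_gpd n X -> gp_resolved n.+1 X.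
Proof.
elim: n X => [|n IH] X; first exact: gp_resolved_base.
exact: gp_resolved_step.
Qed.

(* Replacing X by the kernel of a cover by a contractible complex of projectives
   makes its cycles and boundaries first syzygies. *)
Lemma thick_gorenstein_projective d X M :
    (forall N, gpd_le d N) -> bounded X -> disomorphic X M ->
  thick (as_complexes (@gorenstein_projective R)) d.-1.+2 M.
Proof.
move=> all bX XM; have [Y [f0 [iso0 YX _]]] := exists_desuspension X.
have bY := bounded_desuspension bX YX.
have [U [u [f [pU su bU fE]]]] := exists_disk_cover bY.
have sf i : surj (f i).
  move=> y; have [a ay] := su (i - 1) y; exists (a, 0).
  by rewrite fE /= !(linear0, oppr0, addr0).
have [||K [k kP]] := @exists_subcomplex R (disk U) (fun i => [set x | f i x = 0]).
- by move=> i; apply: ker_submod.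
- by move=> i x /= fx; rewrite chain_mapP fx linear0.
have kf : cses k f.
  by move=> i; split; [exact: (kP i).1|exact: sf|exact: (kP i).2].
(* N is a first syzygy of P/N, which saves one step. For d = 0 the predecessor is 0 and the bound is
   the given one. *)
have sub N P (j : {linear N -> P}) : projective P -> injective j -> gpd_le d.-1 N.
  move=> pP ij; case: (d) all => [|d'] all; first exact: all.
  by have [C [p jp]] := ses_of_inj ij; apply: (all C) pP jp.
have cK : cycles_gpd d.-1 K.
  split=> [|i].
    apply: bounded_inj (bounded_disk_pair (bU) bU) _ => i.
    have [h hE] := pair_linear (\0 : {linear K i -> U i}) (k i).
    by exists h => x y; rewrite !hE => -[] /(kP i).1.
  have pD j : projective (disk U j) by apply: projective_prod.
  split=> [L l [il _]|B s [ss sP]].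
    by apply: (sub L _ (k i \o l) (pD i)) => x y /(kP i).1/il.
  have [|t tE] := linear_factor_surj (f := k (i - 1) \o diff K i) ss.
    by move=> x /sP /= ->; rewrite linear0.
  apply: (sub B _ t (pD (i - 1))); apply: inj0P => y.
  have [x <-] := ss y; rewrite tE /= => /(inj0 (kP _).1) h.
  by apply/sP.
have [L lL [q qq]] := gp_resolved_all cK.
(* The cone of K -> disk U is quasi-isomorphic to the cokernel [shift Y] and, the disk being
   acyclic, also to [shift K]; so X is isomorphic to [shift K]. *)
have h := cone_proj_quasi_iso kf (@id_quasi_iso R K).
have h' : quasi_iso (cone_out (comp_map k (id_map K))).
  by apply: cone_out_quasi_iso; apply: disk_acyclic.
apply: (layered_thick (layered_shift lL)).
apply: disomorphic_trans (quasi_iso_disomorphic (shift_quasi_iso qq)) _.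
apply: disomorphic_trans (disomorphic_sym (quasi_iso_disomorphic h')) _.
apply: disomorphic_trans (quasi_iso_disomorphic h) _.
apply: disomorphic_trans XM.
exact: disomorphic_sym (quasi_iso_disomorphic (chain_iso_quasi_iso iso0)).
Qed.

End Projective.
End Resolving.

(** * Injective layers *)

Section Coresolving.
Variable R : comNzRingType.
Implicit Types (A B C E G J K N P : lmodType R) (X Y M : complex R)
  (S U : int -> lmodType R).

Fixpoint gid_le (n : nat) N : Prop :=
  if n is n'.+1 then forall J C (i : {linear N -> J}) (q : {linear J -> C}),
    injective_module J -> ses i q -> gid_le n' C
  else gorenstein_injective N.

Lemma gid_le_cosyzygy n N : (forall G, cosyzygy n N G -> gorenstein_injective G) -> gid_le n N.
Proof.
elim: n N => [|n IH] N h /=; first exact: h.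
by move=> J C i q iJ iq; apply: IH => G cG; apply: h; exists J, C, i, q.
Qed.

(** Dually to [cycles_gpd], cokernels of the differentials take the place of cycles, while the
    boundaries remain. *)
Definition cokernels_gid n X : Prop := bounded X /\ forall i,
  (forall C (c : {linear X (i - 1) -> C}), is_cokernel (diff X i) c -> gid_le n C) /\
  (forall B (s : {linear X i -> B}), coimage (diff X i) s -> gid_le n B).

Lemma cokernels_gid_desuspension n X : cokernels_gid n X ->
  exists Y (f : chain_map X (shift Y)), chain_iso f /\ cokernels_gid n Y.
Proof.
move=> [bX hX]; have [Y [f [isof YX Yd]]] := exists_desuspension X.
exists Y, f; split=> //; split=> [|i]; first exact: bounded_desuspension bX YX.
have [a [b [ia sa ib sb dE]]] := Yd i; have [hk hc] := hX (i + 1); split.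
  move=> C c [sc kerc]; apply: (hk C (c \o b)); split=> [y|x].
    by have [x <-] := sc y; have [z <-] := sb x; exists z.
  rewrite /= kerc; split=> [[y yE]|[y <-]].
    by exists (a y); apply: ib; rewrite -dE.
  by have [z <-] := sa y; exists z; rewrite dE.
move=> B s [ss kers]; have [|t tP] := linear_factor_surj (f := s) sa.
  by move=> x /(inj0 ia) ->; apply: linear0.
apply: (hc B t); split=> [y|x]; first by have [x <-] := ss y; exists (a x); rewrite tP.
have [y <-] := sa x; rewrite tP kers dE; split=> [/(inj0 ib) //|->].
exact: linear0.
Qed.

Lemma cokernels_gid_desuspension2 n X : cokernels_gid n X ->
  exists Y (f : chain_map X (shift (shift Y))), quasi_iso f /\ cokernels_gid n Y.
Proof.
move=> /cokernels_gid_desuspension[Y [f [isof]]].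
move=> /cokernels_gid_desuspension[Z [g [isog cZ]]].
exists Z, (comp_map (shift_map g) f); split=> //; apply: comp_quasi_iso.
  exact/shift_quasi_iso/chain_iso_quasi_iso.
exact: chain_iso_quasi_iso.
Qed.

Definition gi_resolved n X : Prop := exists2 L,
  layered (as_complexes (@gorenstein_injective R)) n L &
  exists q : chain_map X L, quasi_iso q.

(** The two layers are the boundaries and the quotient by them. Boundaries sit in degrees written i
    - 1, and the desuspension turns these into all degrees of [shift Y]. *)
Lemma gi_resolved_base X : cokernels_gid 0 X -> gi_resolved 1 X.
Proof.
move=> /cokernels_gid_desuspension[Y [f [isof [bY hY]]]].
exists (shift Y); last by exists f; apply: chain_iso_quasi_iso.
have hB i : submod [set x : shift Y i | boundary x] by apply: im_submod.
have dB i (x : shift Y i) : boundary x -> diff (shift Y) i x = 0.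
  by move=> [y <-]; rewrite /= diffK oppr0.
have Bd i (x : shift Y i) : @boundary R Y (i - 1) (diff (shift Y) i x).
  by exists (- x); rewrite linearN.
have [|B [k kP]] := @exists_subcomplex R (shift Y) (fun i => [set x | boundary x]) hB.
  by move=> i x _; apply: Bd.
have [|Q [q qP]] := @exists_quotient_complex R (shift Y) (fun i => [set x | boundary x]) hB.
  by move=> i x _; apply: Bd.
have bS := bounded_shift bY.
exists B, Q, k, q; split.
- move=> i; split; [exact: (kP i).1|exact: (qP i).1|move=> x].
  by rewrite (qP i).2; apply: (kP i).2.
- apply: thick1_graded.
  + move=> i x; apply: (inj0 (kP _).1); rewrite chain_mapP.
    by apply/dB/(kP i).2; exists x.
  + by apply: bounded_inj bS _ => i; exists (k i); apply: (kP i).1.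
  + move=> i; have [|t tE] := linear_factor_inj (f := diff Y i) (kP i).1.
      by move=> x; apply/(kP i).2; exists x.
    apply: ((hY i).2 (B i) t); split=> [y|x].
      have [x xE] := ((kP i).2 (k i y)).2 (ex_intro _ y erefl).
      by exists x; apply: (kP i).1; rewrite tE.
    rewrite -tE; split=> [->|]; first exact: linear0.
    exact: inj0 (kP i).1.
- apply: thick1_graded.
  + move=> i x; have [y <-] := (qP i).1 x; rewrite -chain_mapP.
    by apply/(qP _).2; apply: Bd.
  + by apply: bounded_surj bS _ => i; exists (q i); apply: (qP i).1.
  + by move=> i; apply: (hY i).1 _ (q i) _; split; [exact: (qP i).1|exact: (qP i).2].
Qed.

Lemma exists_disk_hull Y : bounded Y -> exists (U : int -> lmodType R)
    (u : forall i, {linear Y (i - 1) -> U i}) (f : chain_map (shift Y) (disk U)),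
  [/\ forall i, injective_module (U i), forall i, injective (u i), bounded (graded U) &
      forall i x, f i x = (u (i - 1) (- diff Y (i - 1) x), u i x)].
Proof.
move=> bY; have [n bS] := bounded_shift bY.
have [U [u uP]] := dep_choice2 (fun i => injective_hull (Y (i - 1))).
have exf i : exists f : {linear shift Y i -> disk U i},
    forall x, f x = (u (i - 1) (- diff Y (i - 1) x), u i x).
  have [h hE] := pair_linear (\- (u (i - 1) \o diff Y (i - 1))) (u i).
  by exists h => x; rewrite hE /= linearN.
have [f fE] := dep_choice exf.
have ch i x : f (i - 1) (diff (shift Y) i x) = diff (disk U) i (f i x).
  rewrite !fE; apply: injective_projections => /=.
    by rewrite [diff Y _ (- _)]linearN opprK diffK linear0 oppr0.
  by rewrite addr0.
exists U, u, (ChainMap ch); split=> // [i|i|].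
- by case: (uP i).
- by case: (uP i).
- by exists n => i /bS; case: (uP i).
Qed.

Lemma gi_resolved_step n X :
    (forall X, cokernels_gid n X -> gi_resolved n.+1 X) ->
  cokernels_gid n.+1 X -> gi_resolved n.+2 X.
Proof.
(* One desuspension aligns the degrees with the disks, the other provides the shift in
   [cone_incl_exists]. *)
move=> IH /cokernels_gid_desuspension2[Y [th [qth [bY hY]]]].
have [U [u [f [iU iu bU fE]]]] := exists_disk_hull bY.
have exS i : exists (S : lmodType R) (w : {linear Y (i - 1) -> S}), [/\ injective_module S,
    forall x, w x = 0 <-> boundary x &
    trivial_module (Y (i - 1)) -> trivial_module S].
  have [Z [z [sz zP]]] := exists_cokernel (diff Y i).
  have [S [s [iS is_ tS]]] := injective_hull Z.
  exists S, (s \o z); split=> // [x|tY].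
    rewrite -[boundary x]/(exists y, diff Y i y = x) -zP /=.
    by split=> [/(inj0 is_)|->] //; apply: linear0.
  by apply: tS => y; have [x <-] := sz y; rewrite [x]tY linear0.
have [S [w wP]] := dep_choice2 exS.
have wd i x : w i (diff Y i x) = 0.
  by have [_ h _] := wP i; apply/h; exists x.
have bS : bounded (graded S).
  by have [m bm] := bounded_shift bY; exists m => i /bm; case: (wP i).
pose F := disk_pair S U.
have [g gE] : exists g : forall i, {linear shift Y i -> F i},
    forall i x, g i x = (w i x, f i x).
  exact: dep_choice (fun i => pair_linear (w i) (f i)).
have chg i x : g (i - 1) (diff (shift Y) i x) = diff F i (g i x).
  rewrite !gE [f _ _]chain_mapP; congr (_, _).
  by rewrite /= linearN wd oppr0.
have ig i : injective (g i).
  by move=> x y; rewrite !gE !fE => -[_ _ /iu].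
have [||C [q qP]] := @exists_quotient_complex R F (fun i => [set y | exists x, g i x = y]).
- by move=> i; apply: im_submod.
- by move=> i _ [x <-]; exists (diff (shift Y) i x); rewrite chg.
have gq : cses (ChainMap chg) q.
  by move=> i; split; [exact: ig|exact: (qP i).1|exact: (qP i).2].
have cC : cokernels_gid n C.
  split=> [|i].
    apply: (bounded_surj (bounded_disk_pair bS bU)) => i.
    by exists (q i); apply: (qP i).1.
  have [hk hc] := hY (i - 1); split.
  (* Boundaries of the disk remove one of its components, so the cokernel L is S x U modulo a copy
     of the cokernel Z, embedded by w and minus u after the differential. *)
  - move=> L c [sc kerc].
    have [Z [z [sz zP]]] := exists_cokernel (diff Y (i - 1)).
    have hZ : gid_le n.+1 Z by apply: hk (_ : is_cokernel _ z).
    have [iS kerw _] := wP (i - 1).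
    have [h0 h0E] := pair_linear (w (i - 1)) (\- (u (i - 1 - 1) \o diff Y (i - 1 - 1))).
    have [|h hE] := linear_factor_surj (f := h0) sz.
      move=> x /zP[y <-]; rewrite h0E wd /= diffK linear0 oppr0 //.
    have [l lE] : exists l : {linear (S (i - 1) * U (i - 1 - 1))%type -> L},
        forall x, l x = c (q (i - 1) (x.1, (x.2, 0))).
      apply: linear_exists => k x y; rewrite -linearP -[in RHS]linearP; congr (c (q _ _)).
      by congr (_, (_, _)); rewrite /= scaler0 addr0.
    apply: (hZ (S (i - 1) * U (i - 1 - 1))%type L h l); first exact: injective_prod.
    split=> [|y|x].
    + apply: inj0P => y; have [x <-] := sz y; rewrite hE h0E => -[/kerw[x' x'E] _].
      by apply/zP; exists x'.
    + have [x <-] := sc y; have [[s [a b]] <-] := (qP (i - 1)).1 x.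
      exists (s, a); rewrite lE /=; apply/eqP; rewrite -subr_eq0 -!linearB; apply/eqP.
      apply/kerc; exists (q i (0, (- b, 0))); rewrite -chain_mapP disk_pair_diff /=.
      congr (q _ _); apply: injective_projections => /=; rewrite ?subrr //.
      by apply: injective_projections => /=; rewrite ?subrr ?sub0r.
    + split=> [|[y <-]]; last first.
        have [t <-] := sz y; rewrite hE h0E lE /=; apply/kerc.
        exists (q i (0, (- u (i - 1) t, 0))); rewrite -chain_mapP disk_pair_diff /=.
        apply/eqP; rewrite -subr_eq0 -linearB; apply/eqP/(qP _).2.
        exists (- t); rewrite linearN gE fE -[LHS]/(- (_, (_, _))).
        apply: injective_projections => /=; first by rewrite sub0r.
        by apply: injective_projections => /=; rewrite ?sub0r ?subr0 ?linearN.
      rewrite lE => /kerc[t tE]; have [[s [a b]] tq] := (qP i).1 t.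
      have /(qP (i - 1)).2[v vE] : q (i - 1) ((x.1, (x.2, 0)) - diff F i (s, (a, b))) = 0.
        by rewrite linearB chain_mapP tq tE subrr.
      exists (z v); rewrite hE h0E; move: vE; rewrite gE fE disk_pair_diff.
      case: x {tE} => x1 x2 /= [-> ud _]; rewrite subr0; congr (_, _).
      by rewrite -linearN ud subr0.
  (* The boundaries of C are U (i - 1) modulo the boundaries E of Y, embedded by minus u after the
     differential. *)
  - move=> B s [ss sP].
    have [E [r [sr rP]]] := exists_coimage (diff Y (i - 1)).
    have hE : gid_le n.+1 E by apply: hc (_ : coimage _ r).
    have [|h hhE] := linear_factor_surj (f := \- (u (i - 1) \o diff Y (i - 1))) sr.
      by move=> x /rP /= ->; rewrite linear0 oppr0.
    have [l lE] : exists l : {linear U (i - 1) -> B},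
        forall a, l a = s (q i (0, (a, 0))).
      apply: linear_exists => k x y; rewrite -linearP -[in RHS]linearP; congr (s (q _ _)).
      by congr (_, (_, _)); rewrite /= scaler0 addr0.
    apply: (hE (U (i - 1)) B h l) => //.
    split=> [|y|a].
    + apply: inj0P => y; have [x <-] := sr y; rewrite hhE /= => /eqP.
      by rewrite oppr_eq0 => /eqP/(inj0 (@iu _))/rP.
    + have [x <-] := ss y; have [[t [a b]] <-] := (qP i).1 x.
      exists a; rewrite lE; apply/eqP; rewrite -subr_eq0 -!linearB; apply/eqP/sP.
      rewrite -chain_mapP disk_pair_diff /= subrr.
      exact: linear0.
    + have [_ kerw _] := wP (i - 1).
      rewrite lE sP -chain_mapP disk_pair_diff (qP _).2 /=; split=> [[x]|[y <-]].
        rewrite gE fE => -[/kerw[y yx] _ <-].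
        by exists (r (- y)); rewrite hhE /= linearN -yx linearN opprK.
      have [x <-] := sr y; rewrite hhE /=; exists (- diff Y (i - 1) x).
      by rewrite gE fE !linearN wd diffK /= !(linear0, oppr0).
have [L lL [p qp]] := IH C cC.
have tF : thick1 (as_complexes (@gorenstein_injective R)) F.
  apply: thick1_graded_disk => // i; apply: injective_gorenstein.
  by case: (wP i).
have [psi psiE] := cone_incl_exists p gq.
have qpsi := cone_incl_quasi_iso gq qp psiE.
exists (cone (comp_map p q)); last first.
  by exists (comp_map psi th); apply: comp_quasi_iso.
(* Unlike on the projective side, the new layer is the quotient of the cone, so it is appended as
   the last one. *)
apply: (layered_rcons (cone_in_out_cses (comp_map p q))) => //.
exact: thick1_shift.
Qed.

Lemma gi_resolved_all n X : cokernels_gid n X -> gi_resolved n.+1 X.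
Proof.
elim: n X => [|n IH] X; first exact: gi_resolved_base.
exact: gi_resolved_step.
Qed.

(** The quotient C of a disk of injectives has quotients of injectives as cokernels and boundaries,
    that is first cosyzygies. As the disk is acyclic, C is isomorphic to X, the shift in the cone
    accounting for the second desuspension. *)
Lemma thick_gorenstein_injective d X M :
    (forall N, gid_le d N) -> bounded X -> disomorphic X M ->
  thick (as_complexes (@gorenstein_injective R)) d.-1.+2 M.
Proof.
move=> all bX XM; have [Y0 [f0 [iso0 YX0 _]]] := exists_desuspension X.
have [Y [f1 [iso1 YX _]]] := exists_desuspension Y0.
have bY := bounded_desuspension (bounded_desuspension bX YX0) YX.
have [U [u [f [iU iu bU fE]]]] := exists_disk_hull bY.
have fi i : injective (f i) by move=> x y; rewrite !fE => -[_ /iu].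
have [||C [q qP]] := @exists_quotient_complex R (disk U)
    (fun i => [set y | exists x, f i x = y]).
- by move=> i; apply: im_submod.
- by move=> i _ [x <-]; exists (diff (shift Y) i x); rewrite chain_mapP.
have fq : cses f q.
  by move=> i; split; [exact: fi|exact: (qP i).1|exact: (qP i).2].
have quot N J (j : {linear J -> N}) : injective_module J -> surj j -> gid_le d.-1 N.
  move=> iJ sj; case: (d) all => [|d'] all; first exact: all.
  by have [K [k kj]] := ses_of_surj sj; apply: (all K) iJ kj.
have cC : cokernels_gid d.-1 C.
  have iD j : injective_module (disk U j) by apply: injective_prod.
  split=> [|i].
    apply: bounded_surj (bounded_disk_pair (bU) bU) _ => i.
    exists (q i \o (snd : {linear (U i * disk U i)%type -> disk U i})) => y.
    by have [x <-] := (qP i).1 y; exists (0, x).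
  split=> [L c [sc _]|B s [ss _]].
    apply: (quot L _ (c \o q (i - 1)) (iD (i - 1))) => y.
    by have [x <-] := sc y; have [z <-] := (qP (i - 1)).1 x; exists z.
  apply: (quot B _ (s \o q i) (iD i)) => y.
  by have [x <-] := ss y; have [z <-] := (qP i).1 x; exists z.
have [L lL [p qp]] := gi_resolved_all cC.
apply: (layered_thick lL).
have [psi psiE] := cone_incl_exists (id_map C) fq.
have h := cone_incl_quasi_iso fq (@id_quasi_iso R C) psiE.
have h' : quasi_iso (cone_in (comp_map (id_map C) q)).
  by apply: cone_in_quasi_iso; apply: disk_acyclic.
apply: disomorphic_trans XM; apply: disomorphic_sym.
apply: disomorphic_trans (quasi_iso_disomorphic qp).
apply: disomorphic_trans (disomorphic_sym (quasi_iso_disomorphic h')).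
apply: disomorphic_trans (quasi_iso_disomorphic h).
apply: (@quasi_iso_disomorphic _ _ _ (comp_map (shift_map f1) f0)).
apply: comp_quasi_iso; last exact: chain_iso_quasi_iso.
exact/shift_quasi_iso/chain_iso_quasi_iso.
Qed.

End Coresolving.

(** * Level *)

Section Level.
Variable R : comNzRingType.
Implicit Types (T D : complex R -> Prop) (M : complex R).

(** [infimum] picks one of the existing infima, so one has to be exhibited: the least n, which is
    attained. *)
Lemma level_le T n M : thick T n M ->
  exists2 k, (k <= n)%N & level T M = (k%:Z)%:E%E.
Proof.
move=> tM; pose Q k := `[< thick T k M >].
have exQ : exists k, Q k by exists n; apply/asboolP.
case: (ex_minnP exQ) => k /asboolP tk kmin.
exists k; first by apply: kmin; apply/asboolP.
rewrite /level; set A := [set l | _].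
have Ak : A (k%:Z)%:E%E by exists k.
have lbk : lbound A (k%:Z)%:E%E.
  move=> _ [l tl ->]; rewrite lee_fin lez_nat.
  by apply: kmin; apply/asboolP.
have inf : infimums A !=set0 by exists (k%:Z)%:E%E; split=> // x; apply.
rewrite /infimum; case: eqP => [A0|_]; first by rewrite A0 in Ak.
have [lbi ubi] := xgetPex +oo%E inf.
by apply/eqP; rewrite eq_le lbi // ubi.
Qed.

(** The levels lie in a finite set of integers, so if there are any, their maximum is the supremum;
    otherwise it is -oo. *)
Lemma sup_level_le T D n : (forall M, D M -> thick T n M) ->
  (sup_level T D <= (n%:Z)%:E)%E.
Proof.
move=> tD; rewrite /sup_level; set A := [set l | _].
have AP l : A l -> exists2 k, (k <= n)%N & l = (k%:Z)%:E%E.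
  by move=> [M /tD/level_le h ->].
rewrite /supremum; case: eqP => [_|/eqP/set0P[l Al]]; first exact: leNye.
have [k0 k0n lE] := AP l Al; rewrite lE in Al.
pose Q k := `[< A (k%:Z)%:E%E >].
have exQ : exists k, Q k by exists k0; apply/asboolP.
have bQ k : Q k -> (k <= n)%N.
  by move=> /asboolP/AP[j jn [->]].
case: (ex_maxnP exQ bQ) => k Qk kmax.
have sup : supremums A !=set0.
  exists (k%:Z)%:E%E; split=> [x Ax|x ub]; last exact: ub (asboolW Qk).
  have [j _ xE] := AP x Ax; rewrite xE in Ax *; rewrite lee_fin lez_nat.
  by apply: kmax; apply/asboolP.
have [_ lbs] := xgetPex -oo%E sup.
by apply: lbs => x /AP[j jn ->]; rewrite lee_fin lez_nat.
Qed.

Lemma thick1_mono T T' M : (forall X, T X -> T' X) -> thick1 T M -> thick1 T' M.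
Proof.
move=> TT'; elim=> {M} [X /TT' tX|X Y _ tX XY|X _ tX|X _ tX|X Y _ tX _ tY|X Y _ tXY].
- exact: thick1_base.
- exact: thick1_iso tX XY.
- exact: thick1_shift.
- exact: thick1_unshift.
- exact: thick1_sum.
- exact: thick1_summand tXY.
Qed.

Lemma thick_mono T T' n M : (forall X, T X -> T' X) -> thick T n M -> thick T' n M.
Proof.
move=> TT'; elim: n M => [//|[|n] IH] M; first exact: thick1_mono.
move=> [K [L [N [u [v [w [tK tN dist]]]]]]].
by exists K, L, N, u, v, w; split=> //; [apply: thick1_mono tK|apply: IH].
Qed.

End Level.

Theorem corollary3p4p2 (R : comNzRingType) (m : {pred R}) (d : nat)
    (R_noetherian : noetherian R) (R_local : local_ring m)
    (R_gorenstein : gorenstein R) (R_dim : krull_dim R d) :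
  [/\ (sup_level (as_complexes (@gorenstein_projective R)) (@bounded_homology R)
         <= ((maxn 2 d.+1)%:Z)%:E)%E,
      (sup_level (as_complexes (@gorenstein_injective R)) (@bounded_homology R)
         <= ((maxn 2 d.+1)%:Z)%:E)%E
    & (sup_level (as_complexes (@gorenstein_flat R)) (@bounded_homology R)
         <= ((maxn 2 d.+1)%:Z)%:E)%E].
Proof.
have [C [J [i [q [C0 iq iJ iC]]]]] :=
  gorenstein_cosyzygy R_noetherian R_local R_gorenstein R_dim.
have inj_syz (E G : lmodType R) : injective_module E -> syzygy d E G -> projective G.
  exact: (@injective_syzygy R R_noetherian C J i q d C0 iq iJ iC E G).
have proj_cosyz (Q Y : lmodType R) : projective Q -> cosyzygy d Q Y -> injective_module Y.
  exact: (@projective_cosyzygy R R_noetherian C J i q d C0 iq iJ iC Q Y).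
have gpd (N : lmodType R) : gpd_le d N.
  by apply: gpd_le_syzygy => G; apply: syzygy_gorenstein.
have gid (N : lmodType R) : gid_le d N.
  by apply: gid_le_cosyzygy => G; apply: cosyzygy_gorenstein.
(* The covers number d - 1, truncated at 0, and the two final layers are added. *)
have -> : maxn 2 d.+1 = d.-1.+2 by case: (d) => [|[|d']].
have tP M : bounded_homology M ->
    thick (as_complexes (@gorenstein_projective R)) d.-1.+2 M.
  move=> /bounded_homology_bounded[X [bX MX]].
  exact: thick_gorenstein_projective gpd bX (disomorphic_sym MX).
split; apply: sup_level_le => M; first exact: tP.
  move=> /bounded_homology_bounded[X [bX MX]].
  exact: thick_gorenstein_injective gid bX (disomorphic_sym MX).
(* Enlarging the collection can only lower the level, so the bound for Gorenstein projectives passes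
   to Gorenstein flats. *)
move=> /tP; apply: thick_mono => X [G gG ->].
exists G => //; exact: gorenstein_projective_flat inj_syz gG.
Qed.
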